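(* Let $F$ be a smooth vector bundle over a smooth manifold $M$, let $E=F^*$ be its dual with projection $p:E\to M$, and let $\Pi$ be a Lie algebroid structure on $F$, viewed as a fiber-wise linear Poisson structure on the total space $E$. Let $k\ge 1$ be an integer, let $m\in M$ be a singularity of order $k$ of the Lie algebroid $\Pi$, and let $\Pi^{(k)}$ be its $k$-homogeneous part at $m$. Equip the space $\mathcal{V}_2(E)$ of smooth bivector fields on $E$ with the $\mathcal{C}^{2k}$-topology. If $H^{2,s}_{lin}(\Pi^{(k)})=\{0\}$ for every $s=0,\dots,k-1$, then $m$ is a $k$-stable algebroid singularity; that is, for every neighborhood $\Omega$ of $m$ in $M$ there is a neighborhood $\mathcal{W}$ of $\Pi$ in $\mathcal{V}_2(E)$ such that every fiber-wise linear Poisson structure on $E$ belonging to $\mathcal{W}$ has (as a Lie algebroid) a singularity of order $k$ in $\Omega$.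
   Context: A Poisson structure is a smooth bivector field $\Pi$ with $[\Pi,\Pi]=0$, where $[\ ,\ ]$ is the Schouten–Nijenhuis bracket. The $\mathcal{C}^{s}$-topology on $\mathcal{V}_2(E)$ (all smooth bivector fields on the manifold $E$) is the topology of uniform convergence on compact sets of maps $E\to\bigwedge^2TE$ and their derivatives up to order $s$. A Lie algebroid $(F,[\ ,\ ],\varrho)$ over $M$ is a vector bundle $F\to M$ with a Lie bracket on $\Gamma(F)$ and a bundle map $\varrho:F\to TM$ such that $[X,fY]=f[X,Y]+(\varrho(X)\cdot f)Y$. A function on the total space of $p:E\to M$ is basic if it is of the form $f\circ p$ with $f$ a function on $M$. A fiber-wise linear Poisson structure on $E$ is a Poisson structure on $E$ such that the bracket of two fiber-wise linear functions is fiber-wise linear, the bracket of a fiber-wise linear function and a basic function is basic, and the bracket of two basic functions vanishes. Lie algebroid structures on $F$ are in one-to-one correspondence with fiber-wise linear Poisson structures on $E=F^*$, and the two are identified. A point $m\in M$ is a singularity of order $k$ ($k>0$) of the Lie algebroid $\Pi$ if, $0_m$ denoting the origin of the fiber $p^{-1}(m)$, the $(k-1)$-jet of the bivector field $\Pi$ at $0_m$ vanishes but its $k$-jet at $0_m$ does not. The $k$-th order terms of the Taylor expansion of $\Pi$ at $0_m$ then determine a Poisson structure $\Pi^{(k)}$ on the vector space $V=T_{0_m}E$ with homogeneous polynomial coefficients of degree $k$; it is called the $k$-homogeneous part of $\Pi$ at $m$. It is fiber-wise linear when $V$ is viewed as a trivial vector bundle with base $T_mM$ and fiber $T_{0_m}(p^{-1}(m))\simeq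 p^{-1}(m)$. With $V=T_{0_m}E$ viewed as this trivial vector bundle, $\mathcal{V}_{r,lin}^{(s)}(V)$ denotes the space of $r$-vector fields $K$ on $V$ whose coefficients in linear coordinates are homogeneous polynomials of degree $s$ (and $\{0\}$ if $s<0$) and such that: $K(df_1,\dots,df_r)$ is fiber-wise linear if $f_1,\dots,f_r$ are fiber-wise linear; $K(df_1,\dots,df_r)$ is basic if $f_1,\dots,f_{r-1}$ are fiber-wise linear and $f_r$ is basic; $K(df_1,\dots,df_r)=0$ if at least two of the $f_i$ are basic. Equivalently, in linear coordinates $x$ on $T_mM$ and $y$ on the fiber, elements of $\mathcal{V}_{r,lin}^{(s)}(V)$ have the form $$\sum f^{(s-1),u}_{i_1\dots i_r}(x)\,y_u\,\partial_{y_{i_1}}\wedge\dots\wedge\partial_{y_{i_r}}+\sum g^{(s)}_{j_1\dots j_{r-1},t}(x)\,\partial_{x_t}\wedge\partial_{y_{j_1}}\wedge\dots\wedge\partial_{y_{j_{r-1}}},$$ with $g^{(s)}_{j_1\dots j_{r-1},t}$ homogeneous polynomials of degree $s$ and $f^{(s-1),u}_{i_1\dots i_r}$ homogeneous polynomials of degree $s-1$ on $T_mM$. Define $\partial_r^{\ell}:\mathcal{V}_{r,lin}^{(\ell)}(V)\to\mathcal{V}_{r+1,lin}^{(\ell+k-1)}(V)$ by $\partial_r^{\ell}(A)=[\Pi^{(k)},A]$. Then $$H^{2,s}_{lin}(\Pi^{(k)})=\frac{\ker\big(\partial_2^{s}:\mathcal{V}_{2,lin}^{(s)}(V)\to\mathcal{V}_{3,lin}^{(s+k-1)}(V)\big)}{\operatorname{Im}\big(\partial_1^{s-k+1}:\mathcal{V}_{1,lin}^{(s-k+1)}(V)\to\mathcal{V}_{2,lin}^{(s)}(V)\big)}.$$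 *)

(* Defs.v *)
From HB Require Import structures.
From mathcomp Require Import all_boot all_order all_algebra all_fingroup.
From mathcomp Require Import all_classical all_reals all_analysis.
Set Implicit Arguments.
Unset Strict Implicit.
Unset Printing Implicit Defensive.
Import Order.TTheory GRing.Theory Num.Theory.
Import numFieldNormedType.Exports.
Local Open Scope classical_set_scope.
Local Open Scope ring_scope.

Definition partial (R : realType) (d : nat) (i : 'I_d) (f : 'rV[R]_d -> R) :
    'rV[R]_d -> R :=
  fun x => 'D_(delta_mx 0 i) f x.

Definition partials (R : realType) (d : nat) (w : seq 'I_d)
    (f : 'rV[R]_d -> R) : 'rV[R]_d -> R :=
  foldr (@partial R d) f w.

(* C^oo on an open set U *)
Definition smooth_on (R : realType) (d : nat) (U : set 'rV[R]_d)
    (f : 'rV[R]_d -> R) : Prop :=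
  forall (w : seq 'I_d) (x : 'rV[R]_d), U x ->
    {for x, continuous (partials w f)} /\
    forall i, derivable (partials w f) x (delta_mx 0 i).

(* r-vector fields on R^d: K [tuple i_1; ...; i_r] is the function
   K(dx_{i_1}, ..., dx_{i_r}); skew-symmetry is imposed by [alternating]. *)
Definition mvf (R : realType) (d r : nat) : Type :=
  r.-tuple 'I_d -> 'rV[R]_d -> R.

Definition alternating (R : realType) (d r : nat) (U : set 'rV[R]_d)
    (K : mvf R d r) : Prop :=
  forall (s : 'S_r) (t : r.-tuple 'I_d) (x : 'rV[R]_d), U x ->
    K [tuple tnth t (s i) | i < r] x = (-1) ^+ s * K t x.

(* K(df_1, ..., df_r) *)
Definition mvf_eval (R : realType) (d r : nat) (K : mvf R d r)
    (f : 'I_r -> 'rV[R]_d -> R) (x : 'rV[R]_d) : R :=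
  \sum_(t : r.-tuple 'I_d) K t x * \prod_(i < r) partial (tnth t i) (f i) x.

(* The sum over (q+1, p)-shuffles
     (g_0, ..., g_N) |-> sum_s sgn(s) A(B(g_s(0), ..., g_s(q)), g_s(q+1), ...)
   evaluated on coordinate functions, for N = p + q. It is written as a sum
   over all permutations, divided by (q+1)! p!. *)
Definition insertion (R : realType) (d p q N : nat)
    (A : mvf R d p.+1) (B : mvf R d q.+1) : mvf R d N.+1 :=
  fun t x =>
    ((q.+1)`! * p`!)%:R^-1 *
    \sum_(s : 'S_N.+1) (-1) ^+ s *
      \sum_(u < d)
        A [tuple of u :: [tuple tnth t (s (inord (q.+1 + j))) | j < p]] x *
        partial u (B [tuple tnth t (s (inord j)) | j < q.+1]) x.

(* Schouten-Nijenhuis bracket of a (p+1)-vector field and a (q+1)-vector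
   field; for p = q = 0 it is the Lie bracket. *)
Definition schouten (R : realType) (d p q : nat)
    (A : mvf R d p.+1) (B : mvf R d q.+1) : mvf R d (p + q).+1 :=
  fun t x =>
    insertion A B t x -
    (-1) ^+ (p * q)%N * insertion B A t x.

(** Manifolds and multivector fields *)

Record atlas (R : realType) (T : Type) (d : nat) := Atlas {
  chart : Type;
  dom : chart -> set T;
  cmap : chart -> T -> 'rV[R]_d;
  cinv : chart -> 'rV[R]_d -> T;
  chart_at : T -> chart
}.

Definition img (R : realType) (T : Type) (d : nat) (A : atlas R T d)
  (c : chart A) : set 'rV[R]_d := cmap c @` dom c.

Definition transition (R : realType) (T : Type) (d : nat) (A : atlas R T d)
    (c c' : chart A) (x : 'rV[R]_d) : 'rV[R]_d :=
  cmap c' (cinv c x).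

Record manifold (R : realType) (n : nat) := Manifold {
  carrier :> topologicalType;
  atl : atlas R carrier n;
  manifold_hausdorff : hausdorff_space carrier;
  manifold_countable : @second_countable carrier;
  dom_chart_at : forall m, dom (chart_at atl m) m;
  dom_open : forall c : chart atl, open (dom c);
  img_open : forall c : chart atl, open (img c);
  cmapK : forall (c : chart atl) m, dom c m -> cinv c (cmap c m) = m;
  cmap_continuous : forall (c : chart atl) m, dom c m ->
    {for m, continuous (cmap c)};
  cinv_continuous : forall (c : chart atl) x, img c x ->
    {for x, continuous (cinv c)};
  transition_smooth : forall (c c' : chart atl) (b : 'I_n),
    smooth_on (cmap c @` (dom c `&` dom c'))
      (fun x => transition c c' x 0 b)
}.

Definition smooth_function (R : realType) (T : Type) (d : nat)
    (A : atlas R T d) (f : T -> R) : Prop :=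
  forall c : chart A, smooth_on (img c) (f \o cinv c).

(* Smooth r-vector fields, given by their components in all charts; [coef] is
   meaningful on the images of the charts only. *)
Record mvfield (R : realType) (T : Type) (d : nat) (A : atlas R T d)
    (r : nat) := MVField {
  coef :> chart A -> mvf R d r;
  coef_smooth : forall c t, smooth_on (img c) (coef c t);
  coef_alternating : forall c, alternating (img c) (coef c);
  coef_change : forall (c c' : chart A) (e : T) (t : r.-tuple 'I_d),
    dom c e -> dom c' e ->
    coef c' t (cmap c' e) =
      \sum_(u : r.-tuple 'I_d)
        (\prod_(i < r) partial (tnth u i)
           (fun x => transition c c' x 0 (tnth t i)) (cmap c e))
        * coef c u (cmap c e)
}.

(* Pi(df, dg) *)
Definition bracket (R : realType) (T : Type) (d : nat) (A : atlas R T d)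
    (Pi : mvfield A 2) (f g : T -> R) (e : T) : R :=
  let c := chart_at A e in
  mvf_eval (Pi c)
    (fun i : 'I_2 => (if i == ord0 then f else g) \o cinv c) (cmap c e).

Definition poisson (R : realType) (T : Type) (d : nat) (A : atlas R T d)
    (Pi : mvfield A 2) : Prop :=
  forall (c : chart A) t x, img c x -> @schouten R d 1 1 (Pi c) (Pi c) t x = 0.

(* The neighborhoods of Pi in the topology of uniform convergence on compact
   sets of the derivatives up to order s. *)
Definition Cs_nbhs (R : realType) (T : Type) (d r : nat) (A : atlas R T d)
    (s : nat) (Pi : mvfield A r) (W : set (mvfield A r)) : Prop :=
  exists (N : nat) (c : 'I_N -> chart A) (K : 'I_N -> set 'rV[R]_d) (eps : R),
    [/\ 0 < eps,
        forall a, compact (K a) /\ K a `<=` img (c a) &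
        forall Pi' : mvfield A r,
          (forall a w t x, (size w <= s)%N -> K a x ->
             `|partials w (Pi' (c a) t) x - partials w (Pi (c a) t) x| < eps) ->
          W Pi'].

Definition jet_vanishes (R : realType) (T : Type) (d r : nat) (A : atlas R T d)
    (l : nat) (Pi : mvfield A r) (e : T) : Prop :=
  forall (c : chart A) w t, dom c e -> (size w <= l)%N ->
    partials w (Pi c t) (cmap c e) = 0.

(** Vector bundles *)

Record bundle (R : realType) (n : nat) (M : manifold R n) (q : nat) :=
    Bundle {
  fiber : M -> vectType R;
  triv : Type;
  tdom : triv -> set M;
  tmap : triv -> forall m : M, 'Hom(fiber m, 'rV[R]_q);
  triv_at : M -> triv;
  tdom_triv_at : forall m, tdom (triv_at m) m;
  tdom_open : forall i, open (tdom i);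
  tmap_bijective : forall i m, tdom i m -> bijective (tmap i m);
  tmap_smooth : forall (i j : triv) (c : chart (atl M)) (v : 'rV[R]_q) b,
    smooth_on (cmap c @` (dom c `&` (tdom i `&` tdom j)))
      (fun x => let m := cinv c x in
         tmap j m (((tmap i m)^-1)%VF v) 0 b)
}.

Section Dual.
Variables (R : realType) (n q : nat) (M : manifold R n) (F : bundle M q).

Definition dual_total : Type := {m : M & 'Hom(fiber F m, R^o)}.

Definition zero_at (m : M) : dual_total := existT _ m (0 : 'Hom(fiber F m, R^o)).

(* The fiber coordinates of a covector over the domain of a trivialization
   are its values on the corresponding local frame. *)
Definition dual_cmap (ci : chart (atl M) * triv F) (e : dual_total) :
    'rV[R]_(n + q) :=
  let: existT m xi := e in
  row_mx (cmap ci.1 m)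
    (\row_j (xi (((tmap ci.2 m)^-1)%VF (delta_mx 0 j)) : R)).

Definition dual_cinv (ci : chart (atl M) * triv F) (z : 'rV[R]_(n + q)) :
    dual_total :=
  let m := cinv ci.1 (lsubmx z) in
  existT _ m
    (linfun (fun v => (\sum_(j < q) rsubmx z 0 j * tmap ci.2 m v 0 j) : R^o)).

Definition dual_atlas : atlas R dual_total (n + q) := {|
  chart := chart (atl M) * triv F;
  dom := fun ci => [set e | dom ci.1 (projT1 e) /\ tdom ci.2 (projT1 e)];
  cmap := dual_cmap;
  cinv := dual_cinv;
  chart_at := fun e => (chart_at (atl M) (projT1 e), triv_at F (projT1 e))
|}.

Definition bivector_field : Type := mvfield dual_atlas 2.

Definition fiberwise_linear (f : dual_total -> R) : Prop :=
  forall m (a : R) (xi eta : 'Hom(fiber F m, R^o)),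
    f (existT _ m (a *: xi + eta)) =
    a * f (existT _ m xi) + f (existT _ m eta).

Definition basic (f : dual_total -> R) : Prop :=
  exists g : M -> R, f = g \o @projT1 _ _.

Definition linear_poisson (Pi : bivector_field) : Prop :=
  poisson Pi /\
  forall f g, smooth_function dual_atlas f -> smooth_function dual_atlas g ->
    [/\ fiberwise_linear f -> fiberwise_linear g ->
          fiberwise_linear (bracket Pi f g),
        fiberwise_linear f -> basic g -> basic (bracket Pi f g) &
        basic f -> basic g -> forall e, bracket Pi f g e = 0].

Definition singularity (k : nat) (Pi : bivector_field) (m : M) : Prop :=
  jet_vanishes k.-1 Pi (zero_at m) /\ ~ jet_vanishes k Pi (zero_at m).

(* The k-homogeneous part of Pi at m, on T_{0_m} E identified with R^(n+q)
   by the chart ci; this identification carries T_m M to the first summand and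
   the fiber to the second one. *)
Definition homogeneous_part (k : nat) (Pi : bivector_field) (m : M)
    (ci : chart dual_atlas) : mvf R (n + q) 2 :=
  fun t v =>
    k`!%:R^-1 *
    \sum_(w : k.-tuple 'I_(n + q))
      partials w (Pi ci t) (cmap ci (zero_at m)) * \prod_(j < k) v 0 (tnth w j).

Definition k_stable (k : nat) (Pi : bivector_field) (m : M) : Prop :=
  forall Omega : set M, nbhs m Omega ->
    exists W : set bivector_field,
      Cs_nbhs (2 * k) Pi W /\
      forall Pi', W Pi' -> linear_poisson Pi' ->
        exists m', Omega m' /\ singularity k Pi' m'.

End Dual.

(** Linear Poisson cohomology of the trivial bundle R^n x R^q -> R^n *)

Definition homogeneous (R : realType) (d : nat) (s : int)
    (f : 'rV[R]_d -> R) : Prop :=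
  match s with
  | Posz s' => exists a : s'.-tuple 'I_d -> R, forall x,
      f x = \sum_(w : s'.-tuple 'I_d) a w * \prod_(j < s') x 0 (tnth w j)
  | Negz _ => forall x, f x = 0
  end.

Section LinearCohomology.
Variables (R : realType) (n q : nat).

Definition vlinear (f : 'rV[R]_(n + q) -> R) : Prop :=
  forall (x : 'rV[R]_n) (a : R) (y z : 'rV[R]_q),
    f (row_mx x (a *: y + z)) = a * f (row_mx x y) + f (row_mx x z).

Definition vbasic (f : 'rV[R]_(n + q) -> R) : Prop :=
  exists g : 'rV[R]_n -> R, f = g \o lsubmx.

Definition Vlin (r : nat) (s : int) : set (mvf R (n + q) r) :=
  [set K | [/\ alternating setT K,
      forall t, homogeneous s (K t) &
      forall f : 'I_r -> 'rV[R]_(n + q) -> R,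
        (forall i, smooth_on setT (f i)) ->
        [/\ (forall i, vlinear (f i)) -> vlinear (mvf_eval K f),
            forall i, vbasic (f i) -> (forall j, j != i -> vlinear (f j)) ->
              vbasic (mvf_eval K f) &
            forall i j, i != j -> vbasic (f i) -> vbasic (f j) ->
              forall x, mvf_eval K f x = 0]]].

(* The kernel of [P, -] on V_{2,lin}^(s), and its image on
   V_{1,lin}^(s-k+1), for P homogeneous of degree k. *)
Definition cocycles (P : mvf R (n + q) 2) (s : nat) :
    set (mvf R (n + q) 2) :=
  [set A | @Vlin 2 s%:Z A /\ forall t x, @schouten R _ 1 1 P A t x = 0].

Definition coboundaries (P : mvf R (n + q) 2) (k s : nat) :
    set (mvf R (n + q) 2) :=
  [set @schouten R _ 1 0 P X | X in @Vlin 1 (s%:Z - k%:Z + 1)].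

(* The quotient, as the set of cosets of the coboundaries in the cocycles. *)
Definition H2lin (P : mvf R (n + q) 2) (k s : nat) :
    set (set (mvf R (n + q) 2)) :=
  [set [set (fun t x => A t x + B t x) | B in coboundaries P k s]
     | A in cocycles P s].

End LinearCohomology.

(* Main.v *)
Require Import Defs.
From HB Require Import structures.
From mathcomp Require Import all_boot all_order all_algebra.
From mathcomp Require Import perm.
From mathcomp Require Import all_classical all_reals all_analysis.
From mathcomp Require Import zify ring lra.
Set Implicit Arguments.
Unset Strict Implicit.
Unset Printing Implicit Defensive.
Import Order.TTheory GRing.Theory Num.Theory.
Import numFieldNormedType.Exports.
Local Open Scope classical_set_scope.
Local Open Scope ring_scope.

(* In a chart, a linear Poisson structure near [Pi] has Taylor components [Q_i] at a point
   [(x, 0)], and the Jacobi identity in degree [k + s - 1] reads, for [s < k],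
     [Pi^(k), Q_s] = [Pi^(k) - Q_k, Q_s] + brackets [Q_i, Q_j] with [i + j = k + s] and
     [i, j] different from [k] and [s],
   where each bracket of the last kind has a factor of degree [< s], or two factors of degree
   [< k]. The vanishing of the cohomology in degree [s] makes [Q |-> [Pi^(k), Q]] injective if
   [s < k - 1], as there are no fields of negative degree, while for [s = k - 1] its kernel is
   spanned by the derivatives of [Pi^(k)] along the base. Moving [x] in the base changes
   [Q_(k-1)] by these derivatives to first order, so a contraction argument provides [x] near
   [m] where the projection of [Q_(k-1)] to this kernel vanishes. There, [|Q_s|] is at most a
   constant times a small multiple of [|Q_0| + ... + |Q_(k-1)|] plus [|Q_0| + ... + |Q_(s-1)|],
   which forces [Q_s = 0] for all [s < k]. *)

(** In general [Q_(k-1)] has more components than the base has coordinates, so no implicit function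
    argument makes it vanish directly. What can be solved for is the projection: at [Pi] and [m] its
    derivative in the base point is surjective, whatever the rank of the base derivatives of
    [Pi^(k)], and a nearby structure changes this derivative by a small error only. The Jacobi
    identity has to supply all remaining equations. It is used in total degree [k + s], at most
    [2k - 1], so terms [Q_i] with [i > k] occur. Nothing is known of them but a bound, and this is
    what closeness in derivatives up to order [2k] provides. The rigidity constants come from
    [Pi^(k)] alone, by injectivity in finite dimension, hence before the neighborhood is chosen. The
    points stay on the zero section, where fiberwise linearity puts the [Q_i] into the linear
    complex. Two obstacles come from the definitions: fiberwise linearity is tested on functions
    defined on all of [E], so the coefficients in a chart are recovered through cut-off coordinates;
    and the vanishing of a jet is asked in every chart, so it is transported from one chart to the
    others. *)

Section Line.
Variables (R : realType) (V : normedModType R).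

Lemma growth_line (f : V -> R) (x v : V) (t : R) :
  (fun h : R => h^-1 *: (f (x + (h *: 1 + t) *: v) - f (x + t *: v))) =
  (fun h : R => h^-1 *: (f (h *: v + (x + t *: v)) - f (x + t *: v))).
Proof.
apply: funext => h; congr (_ *: (f _ - _)).
by rewrite scalerDl addrCA [h *: 1]mulr1.
Qed.

Lemma is_derive_line (f : V -> R) (x v : V) (t : R) :
  derivable f (x + t *: v) v ->
  is_derive t 1 (fun s : R => f (x + s *: v)) ('D_v f (x + t *: v)).
Proof.
move=> df; apply: DeriveDef.
  by rewrite /derivable growth_line.
by rewrite /derive growth_line.
Qed.

Lemma is_derive_of_line (f : V -> R) (x v : V) (t df : R) :
  is_derive t 1 (fun s : R => f (x + s *: v)) df -> is_derive (x + t *: v) v f df.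
Proof.
case=> h1 h2; apply: DeriveDef; first by move: h1; rewrite /derivable growth_line.
by move: h2; rewrite /derive growth_line.
Qed.

Lemma MVT_line_ge0 (f : V -> R) (x v : V) (d : R) : 0 <= d ->
  (forall t, 0 <= t <= d -> derivable f (x + t *: v) v) ->
  exists2 t, 0 <= t <= d & f (x + d *: v) - f x = 'D_v f (x + t *: v) * d.
Proof.
move=> d0 df.
have [||c] := @MVT_segment R (fun s => f (x + s *: v)) (fun s => 'D_v f (x + s *: v)) 0 d d0.
- move=> t; rewrite in_itv /= => /andP[t0 td]; apply: is_derive_line; apply: df.
  by rewrite !ltW.
- apply: derivable_within_continuous => t; rewrite in_itv /= => t0d.
  by have [] := is_derive_line (df t t0d).
rewrite in_itv /= => c0d; rewrite scale0r addr0 subr0 => E.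
by exists c.
Qed.

Lemma MVT_line (f : V -> R) (x v : V) (d : R) :
  (forall t, 0 <= t <= d \/ d <= t <= 0 -> derivable f (x + t *: v) v) ->
  exists2 t, 0 <= t <= d \/ d <= t <= 0 &
    f (x + d *: v) - f x = 'D_v f (x + t *: v) * d.
Proof.
move=> df; have [d0|/ltW d0] := leP 0 d.
  have [|t t0 E] := @MVT_line_ge0 f x v d d0; first by move=> t t0; apply: df; left.
  by exists t => //; left.
(* For a negative displacement the segment is run through from its other end. *)
have [||t t0] := @MVT_line_ge0 f (x + d *: v) v (- d); first by rewrite oppr_ge0.
  move=> t t0; rewrite -addrA -scalerDl; apply: df; right.
  by move: t0 d0; lra.
rewrite -!addrA -!scalerDl subrr scale0r addr0 => E.
exists (d + t); first by right; move: t0 d0; lra.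
by rewrite -opprB E mulrN opprK.
Qed.
End Line.

Section Calculus.
Variables (R : realType) (d : nat).
Implicit Types (f g : 'rV[R]_d -> R) (x y : 'rV[R]_d).

Definition box x y : set 'rV[R]_d :=
  [set z | forall j, x 0 j <= z 0 j <= y 0 j \/ y 0 j <= z 0 j <= x 0 j].

(** The path from [x] to [y] changes one coordinate at a time; the increments telescope, and the
    one-variable theorem applies on each edge. Only partial derivatives are involved. *)
Lemma MVT_box f x y :
  (forall z i, box x y z -> derivable f z (delta_mx 0 i)) ->
  exists2 xi : 'I_d -> 'rV[R]_d, forall i, box x y (xi i) &
    f y - f x = \sum_i partial i f (xi i) * (y 0 i - x 0 i).
Proof.
move=> df.
pose h (k : nat) : 'rV[R]_d := \row_j if (j < k)%N then y 0 j else x 0 j.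
have hS (i : 'I_d) : h i.+1 = h i + (y 0 i - x 0 i) *: delta_mx 0 i.
  apply/rowP => j; rewrite !mxE eqxx /= ltnS leq_eqVlt.
  have [<-|ij] := eqVneq i j; first by rewrite eqxx /= ltnn; ring.
  by rewrite val_eqE eq_sym (negbTE ij) /= mulr0 addr0.
have H (i : 'I_d) : exists z, box x y z /\
    f (h i.+1) - f (h i) = partial i f z * (y 0 i - x 0 i).
  have hb (t : R) : 0 <= t <= y 0 i - x 0 i \/ y 0 i - x 0 i <= t <= 0 ->
      box x y (h i + t *: delta_mx 0 i).
    move=> ht j; rewrite !mxE eqxx /=.
    have [<-|ij] := eqVneq i j.
      by rewrite ltnn mulr1; move: ht; lra.
    rewrite mulr0 addr0; case: ifP => _; by lra.
  have [|t ht E] := @MVT_line _ _ f (h i) (delta_mx 0 i) (y 0 i - x 0 i).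
    by move=> t ht; apply: df; exact: hb.
  by exists (h i + t *: delta_mx 0 i); split; [exact: hb|rewrite hS E].
have [xi xiP] := choice H.
exists xi; first by move=> i; case: (xiP i).
have hd : y = h d by apply/rowP => j; rewrite !mxE ltn_ord.
have h0 : x = h 0%N by apply/rowP => j; rewrite !mxE.
rewrite {1}hd {1}h0 -(telescope_sumr (f \o h) (leq0n d)) big_mkord.
by apply: eq_bigr => i _; rewrite /= (xiP i).2.
Qed.

End Calculus.

Section MatrixNorm.
Variables (R : realType).

Lemma rV_normP d (x : 'rV[R]_d) (e : R) : 0 <= e ->
  `|x| <= e <-> forall j, `|x 0 j| <= e.
Proof.
move=> e0; rewrite {1}/Num.Def.normr/= mx_normrE; split.
  by move=> h j; apply: le_trans h; apply: (@le_bigmax _ _ _ 0 (fun ij => `|x ij.1 ij.2|) (0, j)).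
by move=> h; apply: bigmax_le => // -[i j] _ /=; rewrite (ord1 i).
Qed.

Lemma rV_norm_coord d (x : 'rV[R]_d) j : `|x 0 j| <= `|x|.
Proof. by apply: (rV_normP x (normr_ge0 x)).1. Qed.

Lemma rV_norm_lt d (x : 'rV[R]_d) (e : R) : 0 < e ->
  `|x| < e <-> forall j, `|x 0 j| < e.
Proof.
move=> e0; rewrite {1}/Num.Def.normr/= mx_normrE; split.
  by move=> h j; apply: le_lt_trans h; apply: (@le_bigmax _ _ _ 0 (fun ij => `|x ij.1 ij.2|) (0, j)).
by move=> h; apply: bigmax_lt => // -[i j] _ /=; rewrite (ord1 i).
Qed.

Lemma nbhs_rV_normP d (x : 'rV[R]_d) (A : set 'rV[R]_d) : nbhs x A ->
  exists2 r : R, 0 < r & forall z, `|x - z| < r -> A z.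
Proof.
move=> /nbhs_ballP[r /= r0 rP]; exists r => // z hz.
by apply: rP; rewrite -ball_normE.
Qed.

Lemma cvg_rV (T : Type) (F : set_system T) d (f : T -> 'rV[R]_d) (l : 'rV[R]_d) :
  Filter F -> (forall j, f t 0 j @[t --> F] --> l 0 j) -> f @ F --> l.
Proof.
move=> FF h A [P Pl PA].
have : \forall t \near F, forall j, P 0 j (f t 0 j).
  apply: filter_forall => j; exact: (h j _ (Pl 0 j)).
by apply: filterS => t ht; apply: PA => i j; rewrite (ord1 i); exact: ht.
Qed.

End MatrixNorm.

(** * Functions with finitely many derivatives *)

Section Smooth.
Variables (R : realType) (d : nat).
Implicit Types (f g : 'rV[R]_d -> R) (x y : 'rV[R]_d) (U : set 'rV[R]_d).

Lemma partialE i f x : partial i f x = 'D_(delta_mx 0 i) f x.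
Proof. by []. Qed.

Lemma partial_near f g x i : (\near x, f x = g x) -> partial i f x = partial i g x.
Proof. exact: near_eq_derive. Qed.

Lemma partial_eq_on U f g : open U -> (forall x, U x -> f x = g x) ->
  forall i x, U x -> partial i f x = partial i g x.
Proof.
move=> oU fg i x Ux; apply: partial_near.
by apply: filterS (open_nbhs_nbhs (conj oU Ux)) => z /fg.
Qed.

Lemma partials_eq_on U f g : open U -> (forall x, U x -> f x = g x) ->
  forall w x, U x -> partials w f x = partials w g x.
Proof.
move=> oU fg; elim=> [|i w IH] x Ux //=; first exact: fg.
by apply: (partial_eq_on oU).
Qed.

(** Weaker than continuous differentiability: the partial derivatives exist at [x], and their
    continuity is left to the next level of [Cn]. *)
Record C1_at f x : Prop := C1At {
  C1_continuous : {for x, continuous f};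
  C1_derivable : forall i, derivable f x (delta_mx 0 i) }.

(** Class C^N together with the existence of the derivatives of order [N + 1]. Unlike [smooth_on],
    it allows induction on the order for products and compositions. *)
Fixpoint Cn (N : nat) U f : Prop :=
  (forall x, U x -> C1_at f x) /\
  if N is N'.+1 then forall i, Cn N' U (partial i f) else True.

Lemma CnI0 U f : (forall x, U x -> C1_at f x) -> Cn 0 U f.
Proof. by split. Qed.

Lemma CnIS N U f : (forall x, U x -> C1_at f x) -> (forall i, Cn N U (partial i f)) ->
  Cn N.+1 U f.
Proof. by split. Qed.

Lemma CnSE N U f : Cn N.+1 U f ->
  (forall x, U x -> C1_at f x) /\ (forall i, Cn N U (partial i f)).
Proof. by []. Qed.

Lemma Cn_partial N U f i : Cn N.+1 U f -> Cn N U (partial i f).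
Proof. by move=> /CnSE[_]; exact. Qed.

Lemma C1_at_near f g x : (\near x, f x = g x) -> C1_at f x -> C1_at g x.
Proof.
move=> fg [cf df]; split; last by move=> i; apply: near_eq_derivable (df i).
rewrite /prop_for /continuous_at -(nbhs_singleton fg).
exact: cvg_trans (near_eq_cvg fg) cf.
Qed.

Lemma Cn0 N U f : Cn N U f -> forall x, U x -> C1_at f x.
Proof. by case: N => [|N] []. Qed.

Lemma Cn_eq N U f g : open U -> (forall x, U x -> f x = g x) -> Cn N U f -> Cn N U g.
Proof.
move=> oU.
have H (f' g' : 'rV[R]_d -> R) : (forall x, U x -> f' x = g' x) ->
    (forall x, U x -> C1_at f' x) -> forall x, U x -> C1_at g' x.
  move=> fg hf x Ux; apply: C1_at_near (hf x Ux).
  by apply: filterS (open_nbhs_nbhs (conj oU Ux)) => z /fg.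
elim: N f g => [|N IH] f g fg Cf.
  by apply: CnI0; apply: (H f g fg); exact: (Cn0 Cf).
apply: CnIS; first by apply: (H f g fg); exact: (Cn0 Cf).
move=> i; apply: IH (Cf.2 i) => x Ux; exact: (partial_eq_on oU).
Qed.

Lemma CnS N U f : Cn N.+1 U f -> Cn N U f.
Proof.
elim: N f => [|N IH] f [h1 h2]; first exact: CnI0.
by apply: CnIS => // i; apply: IH; apply: h2.
Qed.

Lemma CnW N M U f : (M <= N)%N -> Cn N U f -> Cn M U f.
Proof.
move=> /subnK <-; elim: (N - M)%N => [//|k IH]; by rewrite addSn => /CnS.
Qed.

Lemma smooth_onP U f : smooth_on U f <-> forall N, Cn N U f.
Proof.
split.
  move=> sf N; elim: N f sf => [|N IH] f sf.
    by apply: CnI0 => x Ux; have [? ?] := sf [::] x Ux; split.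
  apply: CnIS; first by move=> x Ux; have [? ?] := sf [::] x Ux; split.
  move=> i; apply: IH => w x Ux.
  by have := sf (rcons w i) x Ux; rewrite /partials foldr_rcons.
move=> Cf w; elim/last_ind: w f Cf => [|w i IH] f Cf x Ux.
  by have [? ?] := Cn0 (Cf 0%N) Ux.
rewrite /partials foldr_rcons; apply: IH => // N; exact: (Cf N.+1).2.
Qed.

Lemma C1_at_cst (c : R) x : C1_at (fun=> c) x.
Proof. split; first exact: cst_continuous.
by move=> i; exact: derivable_cst. Qed.

Lemma partial_cst (c : R) i x : partial i (fun=> c) x = 0.
Proof. exact: derive_cst. Qed.

Lemma is_derive_coord (j : 'I_d) x v :
  is_derive x v (fun z : 'rV[R]_d => z 0 j) (v 0 j).
Proof.
have E : (fun h : R => h^-1 *: ((h *: v + x) 0 j - x 0 j)) @ 0^' --> v 0 j.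
  apply: cvg_near_cst; apply: filterS (@nbhs_dnbhs_neq R 0) => h h0.
  by rewrite !mxE addrK [_ *: _]mulrA mulVf// mul1r.
by apply: DeriveDef; [apply/cvg_ex; exists (v 0 j)|apply: cvg_lim].
Qed.

Lemma C1_at_coord j x : C1_at (fun z => z 0 j) x.
Proof.
split; first exact: coord_continuous.
by move=> i; have [] := is_derive_coord j x (delta_mx 0 i).
Qed.

Lemma partial_coord i j x : partial i (fun z => z 0 j) x = (i == j)%:R.
Proof.
have [_] := is_derive_coord j x (delta_mx 0 i).
by rewrite /partial => ->; rewrite mxE eqxx /= eq_sym.
Qed.

Lemma C1_atD f g x : C1_at f x -> C1_at g x -> C1_at (fun z => f z + g z) x.
Proof.
move=> [cf df] [cg dg]; split; first exact: (continuousD cf cg).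
by move=> i; apply: (derivableD (df i) (dg i)).
Qed.

Lemma partialD f g x i : C1_at f x -> C1_at g x ->
  partial i (fun z => f z + g z) x = partial i f x + partial i g x.
Proof. by move=> [_ df] [_ dg]; apply: (deriveD (df i) (dg i)). Qed.

Lemma C1_atM f g x : C1_at f x -> C1_at g x -> C1_at (fun z => f z * g z) x.
Proof.
move=> [cf df] [cg dg]; split; first exact: (continuousM cf cg).
by move=> i; apply: (derivableM (df i) (dg i)).
Qed.

Lemma partialM f g x i : C1_at f x -> C1_at g x ->
  partial i (fun z => f z * g z) x = partial i f x * g x + f x * partial i g x.
Proof.
move=> [_ df] [_ dg]; rewrite addrC [partial i f x * _]mulrC.
exact: (deriveM (df i) (dg i)).
Qed.

Lemma C1_atZ c f x : C1_at f x -> C1_at (fun z => c * f z) x.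
Proof. by move=> hf; apply: C1_atM => //; apply: C1_at_cst. Qed.

Lemma partialZ c f x i : C1_at f x -> partial i (fun z => c * f z) x = c * partial i f x.
Proof. by move=> hf; rewrite partialM ?partial_cst ?mul0r ?add0r//; apply: C1_at_cst. Qed.

Lemma C1_at_sum (I : Type) (r : seq I) (P : pred I) (F : I -> 'rV[R]_d -> R) x :
  (forall i, P i -> C1_at (F i) x) -> C1_at (fun z => \sum_(i <- r | P i) F i z) x.
Proof.
move=> hF; elim: r => [|a r IH].
  by under eq_fun do rewrite big_nil; apply: C1_at_cst.
under eq_fun do rewrite big_cons.
by case Pa: (P a) => //; apply: C1_atD => //; apply: hF.
Qed.

Lemma partial_sum (I : Type) (r : seq I) (P : pred I) (F : I -> 'rV[R]_d -> R) x j :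
  (forall i, P i -> C1_at (F i) x) ->
  partial j (fun z => \sum_(i <- r | P i) F i z) x = \sum_(i <- r | P i) partial j (F i) x.
Proof.
move=> hF; elim: r => [|a r IH].
  by under eq_fun do rewrite big_nil; rewrite big_nil partial_cst.
under eq_fun do rewrite big_cons.
rewrite big_cons; case: ifPn => // Pa.
by rewrite partialD ?IH//; [apply: hF|apply: C1_at_sum].
Qed.

Lemma Cn_cst N U c : Cn N U (fun=> c).
Proof.
elim: N c => [|N IH] c; first by apply: CnI0 => x _; exact: C1_at_cst.
apply: CnIS => [x _|i]; first exact: C1_at_cst.
have -> : partial i (fun=> c) = fun=> 0 by apply: funext => x; exact: partial_cst.
exact: IH.
Qed.

Lemma Cn_coord N U j : Cn N U (fun z => z 0 j).
Proof.
case: N => [|N]; first by apply: CnI0 => x _; exact: C1_at_coord.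
apply: CnIS => [x _|i]; first exact: C1_at_coord.
have -> : partial i (fun z : 'rV[R]_d => z 0 j) = fun=> (i == j)%:R.
  by apply: funext => x; exact: partial_coord.
exact: Cn_cst.
Qed.

Lemma CnD N U f g : open U -> Cn N U f -> Cn N U g -> Cn N U (fun z => f z + g z).
Proof.
move=> oU; elim: N f g => [|N IH] f g Cf Cg.
  by apply: CnI0 => x Ux; apply: C1_atD; [exact: Cn0 Cf _ Ux|exact: Cn0 Cg _ Ux].
apply: CnIS => [x Ux|i].
  by apply: C1_atD; [exact: Cn0 Cf _ Ux|exact: Cn0 Cg _ Ux].
apply: (Cn_eq oU _ (IH _ _ (Cf.2 i) (Cg.2 i))) => x Ux.
by rewrite partialD//; [exact: Cn0 Cf _ Ux|exact: Cn0 Cg _ Ux].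
Qed.

Lemma CnM N U f g : open U -> Cn N U f -> Cn N U g -> Cn N U (fun z => f z * g z).
Proof.
move=> oU; elim: N f g => [|N IH] f g Cf Cg.
  by apply: CnI0 => x Ux; apply: C1_atM; [exact: Cn0 Cf _ Ux|exact: Cn0 Cg _ Ux].
apply: CnIS => [x Ux|i].
  by apply: C1_atM; [exact: Cn0 Cf _ Ux|exact: Cn0 Cg _ Ux].
have := CnD oU (IH _ _ (Cf.2 i) (CnS Cg)) (IH _ _ (CnS Cf) (Cg.2 i)).
apply: Cn_eq => // x Ux.
by rewrite partialM//; [exact: Cn0 Cf _ Ux|exact: Cn0 Cg _ Ux].
Qed.

Lemma CnZ N U c f : open U -> Cn N U f -> Cn N U (fun z => c * f z).
Proof. by move=> oU; apply: CnM => //; apply: Cn_cst. Qed.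

Lemma Cn_sum N U (I : Type) (r : seq I) (P : pred I) (F : I -> 'rV[R]_d -> R) :
  open U -> (forall i, P i -> Cn N U (F i)) -> Cn N U (fun z => \sum_(i <- r | P i) F i z).
Proof.
move=> oU hF; elim: r => [|a r IH].
  by under eq_fun do rewrite big_nil; apply: Cn_cst.
under eq_fun do rewrite big_cons.
by case Pa: (P a) => //; apply: CnD => //; apply: hF.
Qed.

Lemma Cn_prod N U (I : Type) (r : seq I) (P : pred I) (F : I -> 'rV[R]_d -> R) :
  open U -> (forall i, P i -> Cn N U (F i)) -> Cn N U (fun z => \prod_(i <- r | P i) F i z).
Proof.
move=> oU hF; elim: r => [|a r IH].
  by under eq_fun do rewrite big_nil; apply: Cn_cst.
under eq_fun do rewrite big_cons.
by case Pa: (P a) => //; apply: CnM => //; apply: hF.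
Qed.

Lemma Cn_local N U f : (forall x, U x -> exists V : set 'rV[R]_d, [/\ open V, V x & Cn N V f]) ->
  Cn N U f.
Proof.
elim: N f => [|N IH] f h.
  by apply: CnI0 => x /h[V [oV Vx Cf]]; exact: Cn0 Cf _ Vx.
apply: CnIS => [x /h[V [oV Vx Cf]]|i]; first exact: Cn0 Cf _ Vx.
apply: IH => x Ux; have [V [oV Vx /CnSE[_ hf]]] := h x Ux.
by exists V; split => //; exact: hf.
Qed.

End Smooth.

Arguments C1_derivable {R d f x} _ i.
Arguments Cn_partial {R d N U f} i _.

(** * The chain rule *)

Section Chain.
Variables (R : realType) (d d' : nat).
Implicit Types (phi : 'rV[R]_d' -> R) (tau : 'rV[R]_d -> 'rV[R]_d').

Lemma cvg_sumr (T I : Type) (F : set_system T) (r : seq I) (f : I -> T -> R) (l : I -> R) :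
  Filter F -> (forall i, f i t @[t --> F] --> l i) ->
  (\sum_(i <- r) f i t) @[t --> F] --> \sum_(i <- r) l i.
Proof.
move=> FF h; elim: r => [|a r IH].
  rewrite big_nil; under eq_fun do rewrite big_nil; exact: cvg_cst.
rewrite big_cons; under eq_fun do rewrite big_cons.
exact: (cvgD (h a) IH).
Qed.

Lemma continuous_rV tau x : (forall j, {for x, continuous (fun z => tau z 0 j)}) ->
  {for x, continuous tau}.
Proof. by move=> h; apply: (@cvg_rV _ _ (nbhs x) _ tau (tau x) (nbhs_filter x)) => j; exact: h. Qed.

(** [MVT_box] writes the increment of [phi] as partial derivatives at intermediate points times the
    increments of the coordinates of [tau]. The intermediate points tend to [tau x], where the
    partial derivatives of [phi] are continuous. *)
Lemma chain_rule (V : set 'rV[R]_d') phi tau (x v : 'rV[R]_d) :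
  open V -> Cn 1 V phi -> V (tau x) -> {for x, continuous tau} ->
  (forall j, derivable (fun z => tau z 0 j) x v) ->
  is_derive x v (phi \o tau)
    (\sum_j partial j phi (tau x) * 'D_v (fun z => tau z 0 j) x).
Proof.
move=> oV Cphi Vx ctau dtau.
pose tl (h : R) := tau (h *: v + x).
have tlc : tl h @[h --> 0^'] --> tau x.
  apply: cvg_trans (_ : tl h @[h --> (0 : R)] --> tau x).
    by apply: cvg_app; exact: cvg_within.
  apply: (@cvg_comp _ _ _ (fun h : R => h *: v + x) tau _ (nbhs x)); last exact: ctau.
  have : h *: v + x @[h --> (0 : R)] --> 0 *: v + x.
    by apply: cvgD; [apply: cvgZr_tmp; exact: cvg_id|exact: cvg_cst].
  by rewrite scale0r add0r.
(* The box lies in [V] only for small [h]; for the other [h] the point [tau x] serves as a dummy, so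
   that [xi] is defined everywhere. *)
have H (h : R) : exists xi : 'I_d' -> 'rV[R]_d',
    (forall j, box (tau x) (tl h) (xi j)) /\
    (box (tau x) (tl h) `<=` V ->
     phi (tl h) - phi (tau x) = \sum_j partial j phi (xi j) * (tl h 0 j - tau x 0 j)).
  have [bV|nbV] := pselect (box (tau x) (tl h) `<=` V).
    have [|xi xib E] := @MVT_box R d' phi (tau x) (tl h).
      by move=> z i /bV Vz; have [] := Cn0 Cphi Vz.
    by exists xi; split.
  exists (fun=> tau x); split => // j; rewrite /box /= => l; lra.
have [xi xiP] := choice H.
have boxV (e : R) : 0 < e -> \forall h \near 0^', forall z,
    box (tau x) (tl h) z -> `|tau x - z| < e.
  move=> e0; move/cvgrPdist_lt: tlc => /(_ e e0); apply: filterS => h hh z bz.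
  apply/rV_norm_lt => // j; rewrite !mxE.
  have /(rV_norm_lt _ e0) /(_ j) := hh; rewrite !mxE.
  by move: (bz j); rewrite !ltr_norml; lra.
have xic j : xi h j @[h --> 0^'] --> tau x.
  apply/cvgrPdist_lt => e e0; apply: filterS (boxV e e0) => h; apply.
  exact: (xiP h).1.
have subV : \forall h \near 0^', box (tau x) (tl h) `<=` V.
  have /nbhs_ballP[e /= e0 eV] := open_nbhs_nbhs (conj oV Vx).
  apply: filterS (boxV e e0) => h hh z /hh hz.
  by apply: eV; rewrite -ball_normE.
have key : (fun h : R => h^-1 *: (phi (tl h) - phi (tau x))) @ 0^' -->
    \sum_j partial j phi (tau x) * 'D_v (fun z => tau z 0 j) x.
  apply: cvg_trans (near_eq_cvg _)
    (_ : (\sum_j partial j phi (xi h j) * (h^-1 *: (tl h 0 j - tau x 0 j))) @[h --> 0^'] --> _).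
    apply: filterS subV => h hV; rewrite (xiP h).2// scaler_sumr.
    by apply: eq_bigr => j _; rewrite [RHS]mulrCA.
  apply: cvg_sumr => j; apply: cvgM; last exact: dtau.
  apply: (cvg_comp _ _ (xic j)).
  exact: C1_continuous (Cn0 (Cn_partial j Cphi) Vx).
apply: DeriveDef; last exact: cvg_lim key.
by apply/cvg_ex; eexists; exact: key.
Qed.

Lemma C1_at_comp (V : set 'rV[R]_d') phi tau (x : 'rV[R]_d) :
  open V -> Cn 1 V phi -> V (tau x) -> (forall j, C1_at (fun z => tau z 0 j) x) ->
  C1_at (phi \o tau) x.
Proof.
move=> oV Cphi Vx Ctau.
have ctau : {for x, continuous tau} by apply: continuous_rV => j; case: (Ctau j).
split.
  by apply: continuous_comp => //; exact: C1_continuous (Cn0 Cphi Vx).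
move=> i.
by have [] := chain_rule oV Cphi Vx ctau (fun j => C1_derivable (Ctau j) i).
Qed.

Lemma partial_comp (V : set 'rV[R]_d') phi tau (x : 'rV[R]_d) i :
  open V -> Cn 1 V phi -> V (tau x) -> (forall j, C1_at (fun z => tau z 0 j) x) ->
  partial i (phi \o tau) x =
    \sum_j partial j phi (tau x) * partial i (fun z => tau z 0 j) x.
Proof.
move=> oV Cphi Vx Ctau.
have ctau : {for x, continuous tau} by apply: continuous_rV => j; case: (Ctau j).
by have [_] := chain_rule oV Cphi Vx ctau (fun j => C1_derivable (Ctau j) i).
Qed.

(** The extra order on [phi] gives the continuous partial derivatives that the chain rule asks for
    at the last level. *)
Lemma Cn_comp N (U : set 'rV[R]_d) (V : set 'rV[R]_d') phi tau :
  open U -> open V -> (forall x, U x -> V (tau x)) ->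
  Cn N.+1 V phi -> (forall j, Cn N U (fun z => tau z 0 j)) -> Cn N U (phi \o tau).
Proof.
move=> oU oV UV; elim: N phi => [|N IH] phi Cphi Ctau.
  apply: CnI0 => x Ux; apply: (C1_at_comp oV Cphi (UV _ Ux)) => j.
  exact: (Cn0 (Ctau j) Ux).
have C1 : Cn 1 V phi by apply: CnW Cphi.
apply: CnIS => [x Ux|i].
  by apply: (C1_at_comp oV C1 (UV _ Ux)) => j; exact: (Cn0 (Ctau j) Ux).
have C' : Cn N U (fun x => \sum_j (partial j phi \o tau) x * partial i (fun z => tau z 0 j) x).
  apply: Cn_sum => // j _; apply: CnM => //; last exact: (Ctau j).2.
  by apply: IH => [|l]; [exact: Cphi.2|exact: CnS].
apply: Cn_eq C' => // x Ux; rewrite (partial_comp _ oV C1 (UV _ Ux))// => j.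
exact: (Cn0 (Ctau j) Ux).
Qed.
End Chain.

Local Opaque partial.

(** * Smooth functions and the symmetry of their derivatives *)

Section SmoothOn.
Variables (R : realType) (d : nat).
Implicit Types (f g : 'rV[R]_d -> R) (U V : set 'rV[R]_d).

Lemma smooth_eq U f g : open U -> (forall x, U x -> f x = g x) -> smooth_on U f -> smooth_on U g.
Proof. by move=> oU fg /smooth_onP Cf; apply/smooth_onP => N; exact: Cn_eq fg (Cf N). Qed.

Lemma smooth_C1 U f x : smooth_on U f -> U x -> C1_at f x.
Proof. by move=> /smooth_onP /(_ 0%N) Cf; exact: (Cn0 Cf). Qed.

Lemma smooth_partial U f i : smooth_on U f -> smooth_on U (partial i f).
Proof. by move=> /smooth_onP Cf; apply/smooth_onP => N; exact: (Cf N.+1).2. Qed.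

Lemma smooth_partials U f w : smooth_on U f -> smooth_on U (partials w f).
Proof. by move=> sf; elim: w => [|i w IH]; [exact: sf|exact: (smooth_partial i IH)]. Qed.

Lemma smooth_cst U c : smooth_on U (fun=> c).
Proof. by apply/smooth_onP => N; exact: Cn_cst. Qed.

Lemma smooth_coord U j : smooth_on U (fun z => z 0 j).
Proof. by apply/smooth_onP => N; exact: Cn_coord. Qed.

Lemma smoothD U f g : open U -> smooth_on U f -> smooth_on U g ->
  smooth_on U (fun z => f z + g z).
Proof. by move=> oU /smooth_onP Cf /smooth_onP Cg; apply/smooth_onP => N; exact: CnD. Qed.

Lemma smoothM U f g : open U -> smooth_on U f -> smooth_on U g ->
  smooth_on U (fun z => f z * g z).
Proof. by move=> oU /smooth_onP Cf /smooth_onP Cg; apply/smooth_onP => N; exact: CnM. Qed.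

Lemma smooth_sum U (I : Type) (r : seq I) (P : pred I) (F : I -> 'rV[R]_d -> R) :
  open U -> (forall i, P i -> smooth_on U (F i)) ->
  smooth_on U (fun z => \sum_(i <- r | P i) F i z).
Proof.
by move=> oU h; apply/smooth_onP => N; apply: Cn_sum => // i /h /smooth_onP.
Qed.

Lemma smooth_prod U (I : Type) (r : seq I) (P : pred I) (F : I -> 'rV[R]_d -> R) :
  open U -> (forall i, P i -> smooth_on U (F i)) ->
  smooth_on U (fun z => \prod_(i <- r | P i) F i z).
Proof.
by move=> oU h; apply/smooth_onP => N; apply: Cn_prod => // i /h /smooth_onP.
Qed.

Lemma smooth_local U f :
  (forall x, U x -> exists V : set 'rV[R]_d, [/\ open V, V x & smooth_on V f]) ->
  smooth_on U f.
Proof.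
move=> h; apply/smooth_onP => N; apply: Cn_local => x /h[V [oV Vx /smooth_onP Cf]].
by exists V.
Qed.

Lemma smooth_sub U V f : V `<=` U -> smooth_on U f -> smooth_on V f.
Proof. by move=> VU sf w x /VU; exact: sf. Qed.

Lemma smooth_comp d' U (V : set 'rV[R]_d') (phi : 'rV[R]_d' -> R) (tau : 'rV[R]_d -> 'rV[R]_d') :
  open U -> open V -> (forall x, U x -> V (tau x)) ->
  smooth_on V phi -> (forall j, smooth_on U (fun z => tau z 0 j)) -> smooth_on U (phi \o tau).
Proof.
move=> oU oV UV /smooth_onP Cphi Ctau; apply/smooth_onP => N.
by apply: (Cn_comp oU oV UV (Cphi _)) => j; have /smooth_onP := Ctau j.
Qed.

Lemma derive_addl f (c x v : 'rV[R]_d) : derivable f (x + c) v ->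
  is_derive x v (fun y => f (y + c)) ('D_v f (x + c)).
Proof.
have E : (fun h : R => h^-1 *: (f (h *: v + x + c) - f (x + c))) =
    (fun h : R => h^-1 *: (f (h *: v + (x + c)) - f (x + c))).
  by apply: funext => h; rewrite addrA.
by move=> df; apply: DeriveDef; rewrite /derivable /derive /= E.
Qed.

(** The mean value theorem in direction [i] applied to the increment in direction [j], then in
    direction [j] applied to the resulting derivative. *)
Lemma second_difference f x i j (r : R) : 0 <= r ->
  (forall a b : R, 0 <= a <= r -> 0 <= b <= r ->
     let z := x + a *: delta_mx 0 i + b *: delta_mx 0 j in
     C1_at f z /\ C1_at (partial i f) z) ->
  exists a b : R, [/\ 0 <= a <= r, 0 <= b <= r &
    (f (x + r *: delta_mx 0 i + r *: delta_mx 0 j) - f (x + r *: delta_mx 0 i)) -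
    (f (x + r *: delta_mx 0 j) - f x) =
    partial j (partial i f) (x + a *: delta_mx 0 i + b *: delta_mx 0 j) * r ^+ 2].
Proof.
move=> r0 h.
pose F y := f (y + r *: delta_mx 0 j) - f y.
have dF (a : R) : 0 <= a <= r -> is_derive (x + a *: delta_mx 0 i) (delta_mx 0 i) F
    (partial i f (x + a *: delta_mx 0 i + r *: delta_mx 0 j) - partial i f (x + a *: delta_mx 0 i)).
  move=> ha; apply: is_deriveB.
    apply: derive_addl; have [] := h a r ha _; first by rewrite r0 lexx.
    by move=> C _; exact: (C1_derivable C).
  have [|] := h a 0 ha _; first by rewrite r0 lexx.
  by rewrite scale0r addr0 => C _; apply: derivableP; exact: (C1_derivable C).
have [|a ha Ea] := @MVT_line_ge0 _ _ F x (delta_mx 0 i) r r0.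
  by move=> t /dF[].
have [|b hb Eb] := @MVT_line_ge0 _ _ (partial i f) (x + a *: delta_mx 0 i) (delta_mx 0 j) r r0.
  by move=> t ht; have [_ C] := h a t ha ht; exact: (C1_derivable C).
exists a, b; split => //.
have [_ E] := dF a ha; move: Ea; rewrite {}E Eb /F => ->.
by rewrite -mulrA -expr2.
Qed.

Lemma eq_approx (A B : R) :
  (forall e : R, 0 < e -> exists c, `|A - c| < e /\ `|B - c| < e) -> A = B.
Proof.
move=> h; apply/eqP; rewrite -subr_eq0 -normr_le0 leNgt; apply/negP => AB.
have [c [hA hB]] := h (`|A - B| / 2) (divr_gt0 AB (ltr0Sn _ _)).
have : `|A - B| <= `|A - c| + `|B - c|.
  by rewrite -[A - B](subrKA c) (le_trans (ler_normD _ _))// lerD2l distrC.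
lra.
Qed.

(** Thirds leave room for the case [i = j], in which the two displacements add up. *)
Lemma norm_cross_lt x i j (a b r : R) : 0 < r -> 0 <= a <= r / 3 -> 0 <= b <= r / 3 ->
  `|x - (x + a *: (delta_mx 0 i : 'rV[R]_d) + b *: delta_mx 0 j)| < r.
Proof.
move=> r0 /andP[a0 ar] /andP[b0 br].
rewrite -addrA opprD addrA subrr add0r normrN.
apply/rV_norm_lt => // l; rewrite !mxE eqxx /=.
apply: le_lt_trans (ler_normD _ _) _; rewrite !normrM !ger0_norm ?ler0n//.
have : (l == i)%:R <= 1 :> R by case: (l == i).
have : (l == j)%:R <= 1 :> R by case: (l == j).
have : 0 <= (l == i)%:R :> R by [].
have : 0 <= (l == j)%:R :> R by [].
nra.
Qed.

(* Both mixed derivatives are limits of the same second difference quotient. *)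
Lemma partialC U f i j x : open U -> Cn 2 U f -> U x ->
  partial i (partial j f) x = partial j (partial i f) x.
Proof.
move=> oU Cf Ux; apply: eq_approx => e e0.
have cA := C1_continuous (Cn0 (Cn_partial i (Cn_partial j Cf)) Ux).
have cB := C1_continuous (Cn0 (Cn_partial j (Cn_partial i Cf)) Ux).
have [r r0 hr] : exists2 r : R, 0 < r & forall z, `|x - z| < r ->
    [/\ U z, `|partial i (partial j f) x - partial i (partial j f) z| < e &
     `|partial j (partial i f) x - partial j (partial i f) z| < e].
  have h1 := open_nbhs_nbhs (conj oU Ux).
  move/cvgrPdist_lt: cA => /(_ _ e0) h2.
  move/cvgrPdist_lt: cB => /(_ _ e0) h3.
  have [r r0 rP] := nbhs_rV_normP (filterI (filterI h1 h2) h3).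
  exists r; first exact: r0.
  by move=> z hz; have [[Uz hA] hB] := rP z hz; split; [exact: Uz|exact: hA|exact: hB].
have r3 : 0 <= r / 3 by rewrite divr_ge0// ltW.
have hz (a b : R) i' j' (ha : 0 <= a <= r / 3) (hb : 0 <= b <= r / 3) :=
  hr _ (norm_cross_lt x i' j' r0 ha hb).
have [|a [b [ha hb E1]]] := @second_difference f x i j (r / 3) r3.
  move=> a b ha hb z; have [Uz _ _] := hz a b i j ha hb.
  by split; [exact: (Cn0 Cf Uz)|exact: (Cn0 (Cn_partial i Cf) Uz)].
have [|a' [b' [ha' hb' E2]]] := @second_difference f x j i (r / 3) r3.
  move=> a' b' ha' hb' z; have [Uz _ _] := hz a' b' j i ha' hb'.
  by split; [exact: (Cn0 Cf Uz)|exact: (Cn0 (Cn_partial j Cf) Uz)].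
have [_ _ h1] := hz a b i j ha hb.
have [_ h2 _] := hz a' b' j i ha' hb'.
have E : partial i (partial j f) (x + a' *: delta_mx 0 j + b' *: delta_mx 0 i) =
    partial j (partial i f) (x + a *: delta_mx 0 i + b *: delta_mx 0 j).
  have rn0 : (r / 3) ^+ 2 != 0 by rewrite expf_neq0// gt_eqF// divr_gt0.
  apply: (mulIf rn0).
  have swap : x + (r / 3) *: delta_mx 0 j + (r / 3) *: delta_mx 0 i =
    x + (r / 3) *: delta_mx 0 i + (r / 3) *: delta_mx 0 j by rewrite addrAC.
  rewrite swap in E2; apply: etrans (esym E2) (etrans _ E1).
  have sub4 (c1 c2 c3 c4 : R) : c1 - c2 - (c3 - c4) = c1 - c3 - (c2 - c4) by ring.
  exact: sub4.
rewrite E in h2.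
by exists (partial j (partial i f) (x + a *: delta_mx 0 i + b *: delta_mx 0 j)); split; [exact: h2|exact: h1].
Qed.

Lemma partials_perm U f w w' x : open U -> smooth_on U f -> U x -> perm_eq w w' ->
  partials w f x = partials w' f x.
Proof.
move=> oU sf.
have move_front p1 i p2 y : U y ->
    partials (p1 ++ i :: p2) f y = partials (i :: p1 ++ p2) f y.
  elim: p1 y => [//|a p1 IH] y Uy.
  rewrite -[LHS]/(partial a (partials (p1 ++ i :: p2) f) y) (partial_eq_on oU IH a Uy).
  apply: (partialC _ _ oU _ Uy); have /smooth_onP := smooth_partials (p1 ++ p2) sf.
  exact.
elim: w w' x => [|i w IH] w' x Ux; first by rewrite perm_sym => /perm_nilP ->.
move=> pw; have iw : i \in w' by rewrite -(perm_mem pw) mem_head.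
case/splitPr: iw pw => p1 p2; rewrite perm_sym -[i :: p2]cat1s perm_catCA /= perm_cons perm_sym => pw.
rewrite (move_front _ _ _ _ Ux); apply: (partial_eq_on oU _ _ Ux) => y Uy; exact: IH.
Qed.

End SmoothOn.

(** * Smooth bump functions *)

Section Bump.
Variable R : realType.

(** [flat 0] is the classical [exp (-1/x)]. The negative powers of [x] make the family stable under
    differentiation, so that smoothness is one induction on the order for all [n] at once. *)
Definition flat (n : nat) (x : R) : R :=
  if 0 < x then (x^-1) ^+ n * expR (- x^-1) else 0.

Lemma flat_gt0 n x : 0 < x -> 0 < flat n x.
Proof. by move=> x0; rewrite /flat x0 mulr_gt0 ?expR_gt0// exprn_gt0// invr_gt0. Qed.

Lemma flat_le0 n x : x <= 0 -> flat n x = 0.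
Proof. by move=> x0; rewrite /flat ltNge x0. Qed.

(** One term of the exponential series, of degree [n.+2] in [1/x], suffices. The quadratic bound
    gives the derivative 0 at the origin. *)
Lemma flat_small n x : `|flat n x| <= (n.+2)`!%:R * `|x| ^+ 2.
Proof.
have [x0|x0] := leP x 0; first by rewrite flat_le0// normr0 mulr_ge0.
rewrite gtr0_norm ?flat_gt0// gtr0_norm// /flat x0 expRN.
have y0 : 0 < x^-1 by rewrite invr_gt0.
have h : (x^-1) ^+ n.+2 / (n.+2)`!%:R <= expR x^-1.
  by apply: le_trans (expR_ge1Dxn n.+1 (ltW y0)); rewrite lerDr.
rewrite ler_pdivrMr ?expR_gt0//.
move: h; rewrite ler_pdivrMr ?ltr0n ?fact_gt0// => h.
have x2 : 0 < x ^+ 2 by rewrite exprn_gt0.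
rewrite -(ler_pM2r x2) in h.
have -> : x^-1 ^+ n = x^-1 ^+ n.+2 * x ^+ 2.
  by rewrite -(addn2 n) exprD -mulrA -exprMn mulVf ?gt_eqF// expr1n mulr1.
by apply: (le_trans h); rewrite mulrAC [_ * expR _]mulrC -mulrA [_%:R * _]mulrC mulrAC -mulrA.
Qed.

Lemma is_derive_flat (n : nat) (x : R) :
  is_derive x 1 (flat n) (flat n.+2 x - n%:R * flat n.+1 x).
Proof.
have [x0|x0|->] := ltgtP x 0.
- rewrite !flat_le0 ?ltW// mulr0 subr0.
  apply: near_eq_is_derive (is_derive_cst 0 x 1).
  by apply: filterS (lt_nbhsl x0) => y /ltW /flat_le0 ->.
- pose g : R -> R := fun y => (y^-1) ^+ n * expR (- y^-1).
  have xn0 : x != 0 by rewrite gt_eqF.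
  have fg : \near x, g x = flat n x.
    by apply: filterS (lt_nbhsr x0) => y y0; rewrite /flat y0.
  apply: near_eq_is_derive fg _; rewrite /flat x0.
  have di : is_derive x 1 (fun y : R => y^-1) (- x ^- 2 *: 1) by apply: is_deriveV.
  have dN : is_derive x 1 (fun y : R => - y^-1) (x ^- 2).
    by apply: is_derive_eq; rewrite scaleNr opprK [_ *: _]mulr1.
  have dE : is_derive x 1 (expR \o (fun y : R => - y^-1)) (expR (- x^-1) * x ^- 2).
    exact: is_derive1_comp.
  have := is_deriveX n di; rewrite exprfctE => dX.
  apply: (is_derive_eq (is_deriveM dX dE)).
  change (x^-1 ^+ n * (expR (- x^-1) / x ^+ 2) +
    expR (- x^-1) * (n%:R * x^-1 ^+ n.-1 * (- x ^- 2 * 1)) =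
    x^-1 ^+ n.+2 * expR (- x^-1) - n%:R * (x^-1 ^+ n.+1 * expR (- x^-1))).
  rewrite -exprVn; move: x^-1 (expR _) => y e.
  case: n {dX g} => [|m]; first by rewrite mulr0n expr0 !mul0r mulr0; ring.
  by rewrite /= !exprS; ring.
- rewrite !flat_le0// mulr0 subr0.
  have E : (fun h : R => h^-1 *: (flat n (h *: 1 + 0) - flat n 0)) @ 0^' --> (0 : R).
    apply/cvgr0Pnorm_le => e e0.
    have C0 : 0 < (n.+2)`!%:R :> R by rewrite ltr0n fact_gt0.
    have : \forall h \near (0 : R)^', `|h| <= e / (n.+2)`!%:R.
      by apply: dnbhs0_le; rewrite divr_gt0.
    apply: filterS2 (@nbhs_dnbhs_neq R 0) => h h0 he.
    rewrite (flat_le0 n (lexx 0)) subr0 addr0 [_ *: 1]mulr1 normrM normfV.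
    rewrite ler_pdivrMl ?normr_gt0// (le_trans (flat_small n h))//.
    rewrite expr2 mulrCA ler_wpM2l// mulrC -ler_pdivlMr//.
  by apply: DeriveDef; [apply/cvg_ex; exists 0|apply: cvg_lim].
Qed.

Lemma Cn_flat N n d (U : set 'rV[R]_d) f : open U -> smooth_on U f ->
  Cn N U (flat n \o f).
Proof.
move=> oU sf.
have D m x i : U x -> is_derive x (delta_mx 0 i) (flat m \o f)
    ((flat m.+2 (f x) - m%:R * flat m.+1 (f x)) * partial i f x).
  move=> Ux; have C := smooth_C1 sf Ux.
  have df := is_derive_flat m (f x).
  have -> : x = x + 0 *: delta_mx 0 i by rewrite scale0r addr0.
  apply: is_derive_of_line; apply: (is_derive1_comp (f := flat m)).
    by rewrite scale0r addr0.
  rewrite scale0r addr0; rewrite -[in X in partial i f X](addr0 x) -[in X in partial i f X](scale0r (delta_mx 0 i)).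
  apply: is_derive_line; rewrite scale0r addr0; exact: (C1_derivable C).
have C m x : U x -> C1_at (flat m \o f) x.
  move=> Ux; split; last by move=> i; case: (D m x i Ux).
  apply: continuous_comp; first exact: C1_continuous (smooth_C1 sf Ux).
  apply: differentiable_continuous; apply/derivable1_diffP.
  by have [] := is_derive_flat m (f x).
elim: N n => [|N IH] n.
  by apply: CnI0; exact: C.
apply: CnIS; first exact: C.
move=> i; have h : Cn N U (fun x => ((flat n.+2 \o f) x + (- n%:R) * (flat n.+1 \o f) x) * partial i f x).
  apply: (CnM oU); last by have /smooth_onP := smooth_partial i sf; exact.
  apply: (CnD oU); [exact: IH|exact: (CnZ _ oU)].
apply: (Cn_eq oU _ h) => x Ux; rewrite mulNr.
by have [_ <-] := D n x i Ux.
Qed.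

(** A product over the coordinates, because the norm on row vectors is the maximum norm: the support
    is the closed ball of radius [r] for that norm when [r > 0]. *)
Definition bumpf d (a : 'rV[R]_d) (r : R) (x : 'rV[R]_d) : R :=
  \prod_i flat 0 (r ^+ 2 - (x 0 i - a 0 i) ^+ 2).

Lemma smooth_bumpf d (a : 'rV[R]_d) (r : R) : smooth_on setT (bumpf a r).
Proof.
apply: smooth_prod => [|i _]; first exact: openT.
apply/smooth_onP => N; apply: (Cn_flat _ _ openT); apply: (smoothD openT).
  exact: smooth_cst.
apply: (@smooth_eq _ _ _ (fun z => -1 * ((z 0 i + - a 0 i) * (z 0 i + - a 0 i))) _ openT).
  by move=> z _; rewrite expr2 mulN1r.
apply: (smoothM openT); first exact: smooth_cst.
by apply: (smoothM openT); apply: (smoothD openT);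
  [exact: smooth_coord|exact: smooth_cst|exact: smooth_coord|exact: smooth_cst].
Qed.

Lemma bumpf_center d (a : 'rV[R]_d) (r : R) : 0 < r -> 0 < bumpf a r a.
Proof.
move=> r0; apply: prodr_gt0 => i _; apply: flat_gt0.
by rewrite subrr expr0n subr0 exprn_gt0.
Qed.

Lemma bumpf_out d (a : 'rV[R]_d) (r : R) x : 0 < r -> r <= `|x - a| -> bumpf a r x = 0.
Proof.
move=> r0; rewrite leNgt => /negP h; have [[i hi]|nh] := pselect (exists i, r <= `|x 0 i - a 0 i|).
  rewrite /bumpf (bigD1 i)//= flat_le0 ?mul0r// subr_le0.
  by rewrite -[leRHS]real_normK ?num_real// ler_sqr ?nnegrE// ltW.
exfalso; apply: h; apply/rV_norm_lt => // j; rewrite !mxE ltNge; apply/negP => hj.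
by apply: nh; exists j.
Qed.

(* [bumpf a r] is even around [a] in each coordinate. *)
Lemma partial_bumpf_center d (a : 'rV[R]_d) (r : R) i : partial i (bumpf a r) a = 0.
Proof.
pose h s := bumpf a r (a + s *: delta_mx 0 i).
have C := smooth_C1 (smooth_bumpf a r) (I : setT a).
have dh : is_derive (0 : R) 1 h (partial i (bumpf a r) (a + 0 *: delta_mx 0 i)).
  by apply: is_derive_line; rewrite scale0r addr0; exact: (C1_derivable C).
rewrite scale0r addr0 in dh.
have hN : h \o -%R = h.
  apply: funext => s; apply: eq_bigr => j _.
  by rewrite !mxE ![a 0 j + _]addrC !addrK mulNr sqrrN.
have dN : is_derive (0 : R) 1 (h \o -%R) (partial i (bumpf a r) a * -1).
  by apply: is_derive1_comp; rewrite oppr0.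
rewrite hN in dN; case: dh => _ E1; case: dN => _; rewrite {}E1 => /eqP.
by rewrite mulrN1 eq_sym eqNr => /eqP.
Qed.
End Bump.

(** * Linear estimates in finite dimension *)

Section LinearAlgebra.
Variables (R : realType).

Definition linear_form (I : Type) (l : (I -> R) -> R) :=
  forall c a b, l (fun i => c * a i + b i) = c * l a + l b.

Lemma linear_form0 (I : Type) (l : (I -> R) -> R) : linear_form l -> l (fun=> 0) = 0.
Proof.
move=> ll; have := ll (-1) (fun=> 0) (fun=> 0).
have -> : (fun _ : I => -1 * 0 + 0 : R) = fun=> 0 by apply: funext => i; rewrite mulr0 addr0.
by rewrite mulN1r addNr.
Qed.

Lemma linear_form_sum (I J : Type) (r : seq J) (l : (I -> R) -> R) (c : J -> R) (a : J -> I -> R) :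
  linear_form l ->
  l (fun i => \sum_(j <- r) c j * a j i) = \sum_(j <- r) c j * l (a j).
Proof.
move=> ll; elim: r => [|j r IH].
  rewrite [RHS]big_nil -[RHS](linear_form0 ll); congr l; apply: funext => i; by rewrite big_nil.
rewrite big_cons -IH -ll; congr l; apply: funext => i; by rewrite big_cons.
Qed.

(* Adjoin one form at a time, each one separating a vector killed by the previous ones. *)
Lemma injective_forms_bound (I : finType) (J : Type) (l : J -> (I -> R) -> R) :
  (forall j, linear_form (l j)) ->
  (forall a, (forall j, l j a = 0) -> forall i, a i = 0) ->
  exists2 C : R, 0 < C & forall a (e : R), 0 <= e ->
    (forall j, `|l j a| <= e) -> forall i, `|a i| <= C * e.
Proof.
move=> ll linj; pose N := #|I|.
pose col j : 'cV[R]_N := \col_k l j (fun i => (i == enum_val k)%:R).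
pose vec (a : I -> R) : 'rV[R]_N := \row_k a (enum_val k).
have lE j a : l j a = (vec a *m col j) 0 0.
  rewrite mxE; have -> : a = fun i => \sum_(k < N) a (enum_val k) * (i == enum_val k)%:R.
    apply: funext => i; rewrite (bigD1 (enum_rank i))//= enum_rankK eqxx mulr1 big1 ?addr0// => k ki.
    case: eqP => [ik|_]; last by rewrite mulr0.
    by move: ki; rewrite ik enum_valK eqxx.
  rewrite linear_form_sum//; apply: eq_bigr => k _; rewrite !mxE; congr (_ * _).
  rewrite (bigD1 k)//= eqxx mulr1 big1 ?addr0// => k' kk'.
  by rewrite (inj_eq enum_val_inj) eq_sym (negbTE kk') mulr0.
have H r : (r <= N)%N -> exists m (A : 'M[R]_(N, m)),
    (forall c, exists j, forall k, A k c = col j k 0) /\ (r <= \rank A)%N.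
  elim: r => [_|r IH rN]; first by exists 0%N, 0; split => // -[].
  have [m [A [cA rA]]] := IH (ltnW rN).
  have [rA'|rA'] := ltnP r (\rank A); first by exists m, A.
  have kA : kermx A != 0.
    by rewrite kermx_eq0 /row_free neq_ltn (leq_ltn_trans rA' rN).
  have [i [u0 uA]] : exists i, row i (kermx A) != 0 /\ row i (kermx A) *m A = 0.
    have /rowV0Pn[v /submxP[w vE] v0] := kA.
    have [i hi] : exists i, row i (kermx A) != 0.
      apply: contrapT => hn; move/eqP: kA; apply; apply/row_matrixP => i.
      by rewrite row0; apply/eqP; apply: contrapT => /negP h; apply: hn; exists i.
    by exists i; split => //; rewrite -row_mul mulmx_ker row0.
  set u := row i (kermx A) in u0 uA.
  have [j lj] : exists j, l j (fun x => u 0 (enum_rank x)) != 0.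
    apply: contrapT => hn; move/eqP: u0; apply; apply/rowP => k; rewrite [RHS]mxE.
    rewrite -[k]enum_valK; apply: (linj (fun x => u 0 (enum_rank x))) => j.
    by apply/eqP; apply: contrapT => /negP h; apply: hn; exists j.
  exists (m + 1)%N, (row_mx A (col j)); split.
    move=> c; case: (splitP c) => c' cc'.
      have [j' hj'] := cA c'; exists j' => k; rewrite -hj'.
      have -> : c = lshift 1 c' by apply: val_inj.
      by rewrite row_mxEl.
    exists j => k; have -> : c = rshift m c' by apply: val_inj.
    by rewrite row_mxEr (ord1 c').
  have uE : vec (fun x => u 0 (enum_rank x)) = u.
    by apply/rowP => k; rewrite mxE enum_valK.
  have uc : u *m col j != 0.
    apply: contra lj => /eqP h; by rewrite lE uE h mxE.
  have lt : (kermx (row_mx A (col j)) < kermx A)%MS.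
    rewrite ltmxE; apply/andP; split.
      apply/rV_subP => v /sub_kermxP; rewrite mul_mx_row => /eqP; rewrite row_mx_eq0 => /andP[/eqP h _].
      exact/sub_kermxP.
    apply: contra uc => h; have /sub_kermxP : (u <= kermx (row_mx A (col j)))%MS.
      by apply: submx_trans h; exact: row_sub.
    by rewrite mul_mx_row => /eqP; rewrite row_mx_eq0 => /andP[].
  have := rank_ltmx lt; rewrite !mxrank_ker ltn_sub2lE ?rank_leq_row//.
  by apply: leq_trans.
have [m [A [cA rA]]] := H N (leqnn N).
(* The family [J] may be infinite, but the finitely many selected forms already determine [a]; a
   right inverse recovers it, and the entries of this inverse give the constant. *)
have /row_freeP[B AB] : row_free A by rewrite /row_free eqn_leq rank_leq_row.
exists (1 + \sum_c \sum_k `|B c k|).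
  by rewrite ltr_pwDl// sumr_ge0// => c _; exact: sumr_ge0.
move=> a e e0 ae i.
have -> : a i = (vec a *m A *m B) 0 (enum_rank i).
  by rewrite -mulmxA AB mulmx1 mxE enum_rankK.
rewrite mxE; apply: le_trans (ler_norm_sum _ _ _) _.
rewrite mulrDl mul1r mulr_suml -[leLHS]add0r lerD//; apply: ler_sum => c _.
rewrite normrM mulrC; apply: ler_pM => //.
  by rewrite (bigD1 (enum_rank i))//= lerDl sumr_ge0.
have [j hj] := cA c; have <- : l j a = (vec a *m A) 0 c; last exact: ae.
by rewrite lE !mxE; apply: eq_bigr => k _; rewrite hj.
Qed.

(** In the factorization of [J] as [col_base J *m row_base J], a right inverse [X] of the second
    factor gives [J *m X = col_base J], which has a left inverse. For [J] the derivative of a jet in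
    the base point, [X] is the projection: faithful on the span of the rows of [J], and making the
    projected jet a submersion. *)
Lemma rank_factor_projection n N (J : 'M[R]_(n, N)) :
  exists d (X : 'M[R]_(N, d)) (B : 'M[R]_(d, n)),
    B *m (J *m X) = 1%:M /\ forall u : 'rV[R]_n, u *m J *m X = 0 -> u *m J = 0.
Proof.
have /row_freeP[X XE] := row_base_free J.
have /row_fullP[B BE] := col_base_full J.
have JX : J *m X = col_base J.
  by have := congr1 (mulmx^~ X) (mulmx_base J); rewrite -mulmxA XE mulmx1.
exists (\rank J), X, B; split; first by rewrite JX.
move=> u; rewrite -mulmxA JX => uJ.
by have := congr1 (mulmx u) (mulmx_base J); rewrite mulmxA uJ mul0mx.
Qed.

(** A discrete Gronwall argument: with [S] the full sum, the partial sums plus [e * S] grow at most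
    by the factor [1 + c] per step, so [S <= e * (1 + c) ^+ k * S], which forces [S = 0]. *)
Lemma triangular_vanishing (k : nat) (c e : R) (b : nat -> R) : 0 <= c -> 0 <= e ->
  e * (1 + c) ^+ k < 1 -> (forall s, 0 <= b s) ->
  (forall s, (s < k)%N -> b s <= c * (e * \sum_(r < k) b r + \sum_(r < s) b r)) ->
  forall s, (s < k)%N -> b s = 0.
Proof.
move=> c0 e0 ec b0 H.
set S := \sum_(r < k) b r in H.
have S0 : 0 <= S by apply: sumr_ge0.
have Hs s : (s <= k)%N -> \sum_(r < s) b r + e * S <= (1 + c) ^+ s * (e * S).
  elim: s => [_|s IH sk]; first by rewrite big_ord0 add0r expr0 mul1r.
  rewrite big_ord_recr /= exprS.
  have h1 := IH (ltnW sk); have h2 := H s sk.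
  have : (1 + c) * (\sum_(r < s) b r + e * S) <= (1 + c) * ((1 + c) ^+ s * (e * S)).
    by rewrite ler_wpM2l// addr_ge0.
  rewrite -[_ * _ * (e * S)]mulrA; lra.
have : S <= e * (1 + c) ^+ k * S.
  have := Hs k (leqnn k); rewrite -/S => h.
  have : 0 <= e * S by rewrite mulr_ge0.
  by rewrite mulrAC [_ * S * _]mulrC; lra.
have -> : (S <= e * (1 + c) ^+ k * S) = (S * (1 - e * (1 + c) ^+ k) <= 0).
  by rewrite mulrBr mulr1 subr_le0 mulrC.
rewrite pmulr_lle0 ?subr_gt0// => S00 s sk.
have : b s <= S by rewrite /S (bigD1 (Ordinal sk))//= lerDl sumr_ge0.
by move=> h; apply/eqP; rewrite eq_le b0 (le_trans h).
Qed.

End LinearAlgebra.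

(** * Homogeneous polynomials and Taylor expansions *)

Section HomogeneousPolynomials.
Variables (R : realType) (d : nat).
Implicit Types (v x : 'rV[R]_d) (f g : 'rV[R]_d -> R) (U : set 'rV[R]_d).

(** Coefficients are indexed by words, as in [homogeneous], so that Taylor coefficients are iterated
    partial derivatives without multinomial factors. Uniqueness then holds among symmetric
    arrays. *)
Definition hpoly l (a : l.-tuple 'I_d -> R) v : R :=
  \sum_(w : l.-tuple 'I_d) a w * \prod_(j < l) v 0 (tnth w j).

Definition symmetric_coef l (a : l.-tuple 'I_d -> R) :=
  forall w w' : l.-tuple 'I_d, perm_eq w w' -> a w = a w'.

Lemma big_tuple0 (F : 0.-tuple 'I_d -> R) : \sum_(w : 0.-tuple 'I_d) F w = F [tuple].
Proof.
by rewrite (bigD1 [tuple])//= big1 ?addr0// => w /eqP[]; exact: tuple0.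
Qed.

Lemma big_tupleS l (F : l.+1.-tuple 'I_d -> R) :
  \sum_(w : l.+1.-tuple 'I_d) F w =
  \sum_i \sum_(w : l.-tuple 'I_d) F [tuple of i :: w].
Proof.
rewrite pair_big /=.
rewrite (reindex (fun p : 'I_d * l.-tuple 'I_d => [tuple of p.1 :: p.2]))//=.
exists (fun w => (thead w, [tuple of behead w])) => [[i w] _|w _] /=.
  by rewrite theadE; congr (_, _); apply: val_inj.
by rewrite -tuple_eta.
Qed.

Lemma hpoly0 a v : hpoly (a : 0.-tuple 'I_d -> R) v = a [tuple].
Proof. by rewrite /hpoly big_tuple0 big_ord0 mulr1. Qed.

Lemma hpolyS l (a : l.+1.-tuple 'I_d -> R) v :
  hpoly a v = \sum_i v 0 i * hpoly (fun w => a [tuple of i :: w]) v.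
Proof.
rewrite /hpoly big_tupleS; apply: eq_bigr => i _; rewrite mulr_sumr.
apply: eq_bigr => w _; rewrite big_ord_recl tnth0 mulrCA; congr (_ * (_ * _)).
by apply: eq_bigr => j _; rewrite tnthS.
Qed.

Lemma hpolyZ l c (a : l.-tuple 'I_d -> R) v : hpoly (fun w => c * a w) v = c * hpoly a v.
Proof. by rewrite /hpoly mulr_sumr; apply: eq_bigr => w _; rewrite mulrA. Qed.

Lemma hpolyD l (a b : l.-tuple 'I_d -> R) v :
  hpoly (fun w => a w + b w) v = hpoly a v + hpoly b v.
Proof. by rewrite /hpoly -big_split; apply: eq_bigr => w _; rewrite mulrDl. Qed.

Lemma hpolyB l (a b : l.-tuple 'I_d -> R) v :
  hpoly (fun w => a w - b w) v = hpoly a v - hpoly b v.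
Proof. by rewrite /hpoly -sumrB; apply: eq_bigr => w _; rewrite mulrBl. Qed.

Lemma hpoly_sum l (I : finType) (a : I -> l.-tuple 'I_d -> R) v :
  hpoly (fun w => \sum_i a i w) v = \sum_i hpoly (a i) v.
Proof. by rewrite /hpoly exchange_big; apply: eq_bigr => w _; rewrite mulr_suml. Qed.

Lemma eq_hpoly l (a b : l.-tuple 'I_d -> R) v : a =1 b -> hpoly a v = hpoly b v.
Proof. by move=> ab; apply: eq_bigr => w _; rewrite ab. Qed.

Lemma smooth_hpoly l (a : l.-tuple 'I_d -> R) : smooth_on setT (hpoly a).
Proof.
apply: smooth_sum => [|w _]; first exact: openT.
 apply: (smoothM openT); first exact: smooth_cst.
by apply: smooth_prod => [|j _]; [exact: openT|exact: smooth_coord].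
Qed.

Lemma C1_at_hpoly l (a : l.-tuple 'I_d -> R) v : C1_at (hpoly a) v.
Proof. exact: (smooth_C1 (smooth_hpoly a) I). Qed.

Lemma symmetric_coef_cons l (a : l.+1.-tuple 'I_d -> R) i :
  symmetric_coef a -> symmetric_coef (fun w => a [tuple of i :: w]).
Proof. by move=> sa w w' ww'; apply: sa; rewrite /= perm_cons. Qed.

Lemma partial_hpoly l (a : l.+1.-tuple 'I_d -> R) u v : symmetric_coef a ->
  partial u (hpoly a) v = l.+1%:R * hpoly (fun w => a [tuple of u :: w]) v.
Proof.
elim: l a => [|l IH] a sa.
  have -> : hpoly a = fun v => \sum_i v 0 i * a [tuple of [:: i]].
    apply: funext => z; rewrite hpolyS; apply: eq_bigr => i _.
    by rewrite hpoly0; congr (_ * a _); apply: val_inj.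
  rewrite partial_sum; last first.
    by move=> i _; apply: C1_atM; [exact: C1_at_coord|exact: C1_at_cst].
  rewrite (bigD1 u)//= big1 => [|i iu].
    rewrite partialM ?partial_coord ?partial_cst; [|exact: C1_at_coord|exact: C1_at_cst].
    rewrite eqxx mul1r mulr0 !addr0 mul1r hpoly0; congr a; exact: val_inj.
  rewrite partialM ?partial_coord ?partial_cst; [|exact: C1_at_coord|exact: C1_at_cst].
  by rewrite eq_sym (negbTE iu) mul0r mulr0 addr0.
have -> : hpoly a = fun v => \sum_i v 0 i * hpoly (fun w => a [tuple of i :: w]) v.
  by apply: funext => z; rewrite hpolyS.
rewrite partial_sum; last first.
  by move=> i _; apply: C1_atM; [exact: C1_at_coord|exact: C1_at_hpoly].
have E i : partial u (fun z => z 0 i * hpoly (fun w => a [tuple of i :: w]) z) v =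
    (u == i)%:R * hpoly (fun w => a [tuple of i :: w]) v +
    l.+1%:R * (v 0 i * hpoly (fun w => a [tuple of u :: [tuple of i :: w]]) v).
  rewrite partialM ?partial_coord; [|exact: C1_at_coord|exact: C1_at_hpoly].
  rewrite (IH _ (symmetric_coef_cons i sa)) mulrCA; congr (_ + _ * (_ * _)).
  apply: eq_hpoly => w; apply: sa; rewrite /= -[[:: i, u & w]]/([:: i] ++ [:: u] ++ w).
  by rewrite perm_catCA.
under eq_bigr do rewrite E.
rewrite big_split /= -mulr_sumr -[in RHS]natr1 mulrDl mul1r [RHS]addrC.
congr (_ + _ * _); last by rewrite hpolyS.
rewrite (bigD1 u)//= big1 => [|i iu]; first by rewrite eqxx mul1r addr0.
by rewrite eq_sym (negbTE iu) mul0r.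
Qed.

(** For a symmetric array, differentiation in direction [u] strips the letter [u], so induction on
    the degree reads off every coefficient. *)
Lemma hpoly_inj l (a : l.-tuple 'I_d -> R) : symmetric_coef a ->
  (forall v, hpoly a v = 0) -> forall w, a w = 0.
Proof.
elim: l a => [|l IH] a sa h w; first by rewrite [w]tuple0 -(hpoly0 a 0) h.
case/tupleP: w => u w.
apply: (IH _ (symmetric_coef_cons u sa)) => v.
have : partial u (hpoly a) v = 0.
  have -> : hpoly a = fun=> 0 by apply: funext.
  exact: partial_cst.
by rewrite partial_hpoly// => /eqP; rewrite mulf_eq0 pnatr_eq0 /= => /eqP.
Qed.

Lemma hpoly_homog l (a : l.-tuple 'I_d -> R) c v : hpoly a (c *: v) = c ^+ l * hpoly a v.
Proof.
rewrite /hpoly mulr_sumr; apply: eq_bigr => w _; rewrite mulrCA; congr (_ * _).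
under eq_bigr do rewrite mxE.
by rewrite big_split /= prodr_const card_ord.
Qed.

Lemma hpoly_le l (a : l.-tuple 'I_d -> R) (e : R) v : (forall w, `|a w| <= e) -> `|v| <= 1 ->
  `|hpoly a v| <= #|{: l.-tuple 'I_d}|%:R * e.
Proof.
move=> ae v1; apply: le_trans (ler_norm_sum _ _ _) _.
rewrite -sumr_const mulr_suml; apply: ler_sum => w _.
rewrite normrM mul1r -[leRHS]mulr1; apply: ler_pM => //.
rewrite normr_prod; apply: prodr_ile1 => j _; rewrite normr_ge0 /=.
exact: le_trans (rV_norm_coord _ _) v1.
Qed.

Definition dir v f x : R := \sum_i v 0 i * partial i f x.

Lemma smooth_dir U v f : open U -> smooth_on U f -> smooth_on U (dir v f).
Proof.
move=> oU sf; apply: smooth_sum => [//|i _]; apply: (smoothM oU).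
  exact: smooth_cst.
exact: smooth_partial.
Qed.

Lemma smooth_iter_dir U v f l : open U -> smooth_on U f -> smooth_on U (iter l (dir v) f).
Proof. by move=> oU sf; elim: l => [|l IH]; [exact: sf|exact: (smooth_dir v oU IH)]. Qed.

Lemma dir_eq_on U v f g : open U -> (forall x, U x -> f x = g x) ->
  forall x, U x -> dir v f x = dir v g x.
Proof.
move=> oU fg x Ux; apply: eq_bigr => i _; congr (_ * _); exact: (partial_eq_on oU fg).
Qed.

Lemma dirM v f g x : C1_at f x -> C1_at g x ->
  dir v (fun z => f z * g z) x = dir v f x * g x + f x * dir v g x.
Proof.
move=> cf cg; rewrite /dir mulr_suml mulr_sumr -big_split; apply: eq_bigr => i _.
by rewrite partialM// mulrDr mulrA [v 0 i * (f x * _)]mulrCA.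
Qed.

Lemma dirZ v c f x : C1_at f x -> dir v (fun z => c * f z) x = c * dir v f x.
Proof.
move=> cf; rewrite /dir mulr_sumr; apply: eq_bigr => i _.
by rewrite partialZ// mulrCA.
Qed.

Lemma dir_sum v (I : Type) (r : seq I) (P : pred I) (F : I -> 'rV[R]_d -> R) x :
  (forall i, P i -> C1_at (F i) x) ->
  dir v (fun z => \sum_(i <- r | P i) F i z) x = \sum_(i <- r | P i) dir v (F i) x.
Proof.
move=> hF; rewrite /dir exchange_big /=; apply: eq_bigr => j _.
by rewrite partial_sum// mulr_sumr.
Qed.

Lemma iter_dirE U v f l x : open U -> smooth_on U f -> U x ->
  iter l (dir v) f x = hpoly (fun w : l.-tuple 'I_d => partials w f x) v.
Proof.
move=> oU sf; elim: l x => [|l IH] x Ux; first by rewrite hpoly0.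
rewrite hpolyS iterS (dir_eq_on _ oU IH Ux); apply: eq_bigr => i _; congr (_ * _).
rewrite partial_sum.
  apply: eq_bigr => w _; rewrite partialM ?partial_cst ?mulr0 ?addr0//.
    exact: (smooth_C1 (smooth_partials w sf) Ux).
  exact: C1_at_cst.
move=> w _; apply: C1_atM; last exact: C1_at_cst.
exact: (smooth_C1 (smooth_partials w sf) Ux).
Qed.

(** The term of degree [l] of the Taylor expansion at [x], evaluated at the increment [v]. Iterating
    a single directional derivative reduces the product rule to the one-variable Leibniz formula. *)
Definition taylor l f x v : R := l`!%:R^-1 * iter l (dir v) f x.

Lemma taylorE U l f x v : open U -> smooth_on U f -> U x ->
  taylor l f x v = hpoly (fun w : l.-tuple 'I_d => l`!%:R^-1 * partials w f x) v.
Proof. by move=> oU sf Ux; rewrite /taylor (iter_dirE _ _ oU sf Ux) hpolyZ. Qed.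

Lemma smooth_taylor U l f v : open U -> smooth_on U f -> smooth_on U (fun x => taylor l f x v).
Proof.
move=> oU sf; apply: (smoothM oU); first exact: smooth_cst.
exact: smooth_iter_dir.
Qed.

Lemma dir_taylor U l f v x : open U -> smooth_on U f -> U x ->
  dir v (fun z => taylor l f z v) x = l.+1%:R * taylor l.+1 f x v.
Proof.
move=> oU sf Ux; rewrite dirZ; last exact: (smooth_C1 (smooth_iter_dir v l oU sf) Ux).
by rewrite /taylor iterS factS natrM invfM !mulrA mulfV ?pnatr_eq0// mul1r.
Qed.

(** The inductive step of [taylorM]: one more derivative sends the term of index [i] to [i.+1] times
    the next one. The proof splits the weight [l.+1] into [i] and [l.+1 - i] and shifts the index in
    one half. *)
Lemma leibniz_sum (A B : nat -> R) l :
  \sum_(i < l.+1) (i.+1%:R * A i.+1 * B (l - i)%N + A i * ((l - i).+1%:R * B (l - i).+1)) =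
  l.+1%:R * \sum_(i < l.+2) A i * B (l.+1 - i)%N.
Proof.
have -> : l.+1%:R * \sum_(i < l.+2) A i * B (l.+1 - i)%N =
    \sum_(i < l.+2) (i%:R * A i * B (l.+1 - i)%N) +
    \sum_(i < l.+2) ((l.+1 - i)%:R * (A i * B (l.+1 - i)%N)).
  rewrite -big_split mulr_sumr; apply: eq_bigr => i _ /=.
  have E : l.+1%:R = i%:R + (l.+1 - i)%:R :> R by rewrite -natrD subnKC// -ltnS.
  by rewrite {1}E mulrDl -mulrA.
rewrite [X in _ = X + _]big_ord_recl !mul0r add0r [X in _ = _ + X]big_ord_recr /= subnn mul0r addr0.
rewrite -big_split; apply: eq_bigr => i _ /=.
rewrite /bump /= add1n subSS; congr (_ + _).
by rewrite subSn 1?mulrCA// -ltnS.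
Qed.

Lemma taylorM U l f g v x : open U -> smooth_on U f -> smooth_on U g -> U x ->
  taylor l (fun z => f z * g z) x v = \sum_(i < l.+1) taylor i f x v * taylor (l - i) g x v.
Proof.
move=> oU sf sg; elim: l x => [|l IH] x Ux.
  by rewrite big_ord_recl big_ord0 addr0 /taylor fact0 invr1 !mul1r.
have l1 : l.+1%:R != 0 :> R by rewrite pnatr_eq0.
apply: (mulfI l1); rewrite -(dir_taylor _ _ oU (smoothM oU sf sg) Ux).
rewrite (dir_eq_on _ oU IH Ux) dir_sum.
  rewrite -(leibniz_sum (fun i => taylor i f x v) (fun i => taylor i g x v)).
  apply: eq_bigr => i _; rewrite dirM.
  - by rewrite (dir_taylor _ _ oU sf Ux) (dir_taylor _ _ oU sg Ux).
  - exact: (smooth_C1 (smooth_taylor _ _ oU sf) Ux).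
  - exact: (smooth_C1 (smooth_taylor _ _ oU sg) Ux).
move=> i _; apply: C1_atM.
  exact: (smooth_C1 (smooth_taylor _ _ oU sf) Ux).
exact: (smooth_C1 (smooth_taylor _ _ oU sg) Ux).
Qed.

Lemma taylorZ U l c f v x : open U -> smooth_on U f -> U x ->
  taylor l (fun z => c * f z) x v = c * taylor l f x v.
Proof.
move=> oU sf Ux; rewrite /taylor mulrCA; congr (_ * _).
elim: l x Ux => [//|l IH] x Ux; rewrite !iterS (dir_eq_on _ oU IH Ux) dirZ//.
exact: (smooth_C1 (smooth_iter_dir v l oU sf) Ux).
Qed.

Lemma taylor_sum U l (I : Type) (r : seq I) (P : pred I) (F : I -> 'rV[R]_d -> R) v x :
  open U -> (forall i, P i -> smooth_on U (F i)) -> U x ->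
  taylor l (fun z => \sum_(i <- r | P i) F i z) x v = \sum_(i <- r | P i) taylor l (F i) x v.
Proof.
move=> oU sF Ux; rewrite /taylor -mulr_sumr; congr (_ * _).
elim: l x Ux => [//|l IH] x Ux; rewrite !iterS (dir_eq_on _ oU IH Ux) dir_sum//.
by move=> i Pi; exact: (smooth_C1 (smooth_iter_dir v l oU (sF i Pi)) Ux).
Qed.

Lemma taylor_eq_on U l f g v x : open U -> (forall z, U z -> f z = g z) -> U x ->
  taylor l f x v = taylor l g x v.
Proof.
move=> oU fg Ux; rewrite /taylor; congr (_ * _).
elim: l x Ux => [|l IH] x Ux; first exact: fg.
by rewrite !iterS (dir_eq_on _ oU IH Ux).
Qed.

(** Partial derivatives commute, so the Taylor coefficients form a symmetric array; the factor
    [l.+1] from differentiating the polynomial turns the inverse of [l.+1]![into that of]l[!]. *)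
Lemma partial_taylor U l f x u v : open U -> smooth_on U f -> U x ->
  partial u (fun z => taylor l.+1 f x z) v = taylor l (partial u f) x v.
Proof.
move=> oU sf Ux.
have -> : taylor l.+1 f x = hpoly (fun w : l.+1.-tuple 'I_d => l.+1`!%:R^-1 * partials w f x).
  by apply: funext => z; exact: (taylorE _ _ oU sf Ux).
rewrite partial_hpoly; last first.
  by move=> w w' ww'; congr (_ * _); exact: (partials_perm oU sf Ux).
rewrite (taylorE _ _ oU (smooth_partial u sf) Ux) -hpolyZ; apply: eq_hpoly => w.
rewrite mulrA factS natrM invfM mulrA mulfV ?pnatr_eq0// mul1r; congr (_ * _).
have -> : partials w (partial u f) x = partials (w ++ [:: u]) f x by rewrite /partials foldr_cat.
by apply: (partials_perm oU sf Ux); rewrite -[tval _]cat1s perm_catC.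
Qed.

Lemma partial_taylor0 f x u v : partial u (fun z => taylor 0 f x z) v = 0.
Proof. exact: (partial_cst (0`!%:R^-1 * f x)). Qed.

End HomogeneousPolynomials.

(** * Taylor terms and bounds for the Schouten bracket *)

Section InsertionEstimates.
Variables (R : realType) (d : nat).
Implicit Types (v x : 'rV[R]_d) (U : set 'rV[R]_d).

Definition smooth_mvf U r (K : mvf R d r) := forall t, smooth_on U (K t).

Lemma taylor_insertion p q N U (A : mvf R d p.+1) (B : mvf R d q.+1) l x v t :
  open U -> smooth_mvf U A -> smooth_mvf U B -> U x ->
  taylor l (@insertion R d p q N A B t) x v =
  \sum_(i < l.+1) @insertion R d p q N (fun t z => taylor i (A t) x z)
    (fun t z => taylor (l - i).+1 (B t) x z) t v.
Proof.
move=> oU sA sB Ux.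
have sAB f g u : smooth_on U f -> smooth_on U g -> smooth_on U (fun z => f z * partial u g z).
  by move=> sf sg; apply: (smoothM oU sf); exact: smooth_partial.
have sS (s : 'S_N.+1) : smooth_on U (fun z => \sum_(u < d)
        A [tuple of u :: [tuple tnth t (s (inord (q.+1 + j))) | j < p]] z *
        partial u (B [tuple tnth t (s (inord j)) | j < q.+1]) z).
  by apply: smooth_sum => [//|u _]; apply: sAB; [exact: sA|exact: sB].
have sS' (s : 'S_N.+1) : smooth_on U (fun z => (-1) ^+ s * \sum_(u < d)
        A [tuple of u :: [tuple tnth t (s (inord (q.+1 + j))) | j < p]] z *
        partial u (B [tuple tnth t (s (inord j)) | j < q.+1]) z).
  by apply: (smoothM oU); [exact: smooth_cst|exact: sS].
rewrite /insertion (taylorZ _ _ _ oU _ Ux); last by apply: smooth_sum => [//|s _]; exact: sS'.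
rewrite -mulr_sumr; congr (_ * _).
rewrite (taylor_sum _ _ _ oU _ Ux); last by move=> s _; exact: sS'.
rewrite exchange_big; apply: eq_bigr => s _.
rewrite (taylorZ _ _ _ oU (sS s) Ux) -mulr_sumr; congr (_ * _).
rewrite (taylor_sum _ _ _ oU _ Ux); last by move=> u _; apply: sAB; [exact: sA|exact: sB].
rewrite exchange_big; apply: eq_bigr => u _.
rewrite (taylorM _ _ oU (sA _) (smooth_partial u (sB _)) Ux); apply: eq_bigr => i _.
by rewrite (partial_taylor _ _ _ oU (sB _) Ux).
Qed.

Lemma schouten11E (A B : mvf R d 2) t v :
  @schouten R d 1 1 A B t v = @insertion R d 1 1 2 A B t v + @insertion R d 1 1 2 B A t v.
Proof. by rewrite /schouten /= muln1 expr1 mulN1r opprK. Qed.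

(** The bracket of [K] with itself is twice an insertion. Here [l] is the total degree of the two
    factors, so the identity is the part of degree [l - 1] of the Jacobi identity. *)
Lemma taylor_jacobi U (K : mvf R d 2) x v t l : open U -> smooth_mvf U K -> U x ->
  (forall t z, U z -> @schouten R d 1 1 K K t z = 0) ->
  \sum_(i < l.+1) @insertion R d 1 1 2 (fun t z => taylor i (K t) x z)
    (fun t z => taylor (l - i) (K t) x z) t v = 0.
Proof.
move=> oU sK Ux jac.
have jac2 t' z : U z -> @insertion R d 1 1 2 K K t' z = 0.
  move=> Uz; have := jac t' z Uz; rewrite schouten11E -mulr2n => /eqP.
  by rewrite mulrn_eq0 /= => /eqP.
(* The term [i = l] differentiates a constant; without it the sum is the one of [taylor_insertion],
   and for [l = 0] it is empty. *)
rewrite big_ord_recr /= subnn [X in _ + X](_ : _ = 0) ?addr0; last first.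
  rewrite /insertion big1 ?mulr0// => s _; rewrite big1 ?mulr0// => u _.
  by rewrite partial_taylor0 mulr0.
case: l => [|l]; first by rewrite big_ord0.
have := taylor_insertion l v t oU sK sK Ux.
rewrite (taylor_eq_on (g := fun=> 0) l v oU (jac2 t) Ux).
have -> : taylor l (fun=> 0) x v = 0.
  rewrite -[fun=> 0]/(fun _ : 'rV[R]_d => (0 : R)).
  have -> : (fun _ : 'rV[R]_d => (0 : R)) = (fun z => 0 * (fun=> 0) z).
    by apply: funext => z; rewrite mul0r.
  by rewrite (taylorZ _ _ _ oU _ Ux) ?mul0r//; exact: smooth_cst.
by move=> E; rewrite [RHS]E; apply: eq_bigr => i _; rewrite subSn// -ltnS.
Qed.

Definition coef2 l := 2.-tuple 'I_d -> l.-tuple 'I_d -> R.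
Definition hfield l (a : coef2 l) : mvf R d 2 := fun t v => hpoly (a t) v.
Definition bounded_coef l (a : coef2 l) (e : R) := forall t w, `|a t w| <= e.
Definition symmetric_coef2 l (a : coef2 l) := forall t, symmetric_coef (a t).

Lemma partial_hpoly_le l (a : l.-tuple 'I_d -> R) (e : R) u v : symmetric_coef a ->
  (forall w, `|a w| <= e) -> `|v| <= 1 ->
  `|partial u (hpoly a) v| <= l%:R * #|{: l.-1.-tuple 'I_d}|%:R * e.
Proof.
case: l a => [|l] a sa ae v1.
  have -> : hpoly a = fun=> a [tuple] by apply: funext => z; rewrite hpoly0.
  by rewrite partial_cst normr0 !mul0r.
rewrite partial_hpoly// normrM normr_nat -mulrA ler_wpM2l// hpoly_le// => w; exact: ae.
Qed.

Lemma insertion_bound i j : exists2 C : R, 0 <= C &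
  forall (a : coef2 i) (b : coef2 j) (e f : R) t v,
  symmetric_coef2 b -> bounded_coef a e -> bounded_coef b f -> `|v| <= 1 ->
  `|@insertion R d 1 1 2 (hfield a) (hfield b) t v| <= C * (e * f).
Proof.
pose c := #|{: i.-tuple 'I_d}|%:R * (j%:R * #|{: j.-1.-tuple 'I_d}|%:R) : R.
exists (((2`! * 1`!)%:R^-1 : R) * \sum_(s : 'S_3) \sum_(u < d) c).
  rewrite mulr_ge0 ?invr_ge0 ?ler0n//.
  by do 2 (apply: sumr_ge0 => ? _); rewrite /c !mulr_ge0// ler0n.
move=> a b e f t v sb ae bf v1; rewrite /insertion normrM gtr0_norm; last first.
  by rewrite invr_gt0 ltr0n.
rewrite -[leRHS]mulrA ler_wpM2l ?invr_ge0 ?ler0n//.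
apply: le_trans (ler_norm_sum _ _ _) _; rewrite mulr_suml; apply: ler_sum => s _.
rewrite normrM normrX normrN1 expr1n mul1r.
apply: le_trans (ler_norm_sum _ _ _) _; rewrite mulr_suml; apply: ler_sum => u _.
rewrite normrM /c mulrACA; apply: ler_pM => //; first exact: hpoly_le.
exact: partial_hpoly_le.
Qed.

Lemma insertion_bound_le n : exists2 C : R, 0 < C &
  forall i j (a : coef2 i) (b : coef2 j) (e f : R) t v, (i <= n)%N -> (j <= n)%N ->
  0 <= e -> 0 <= f ->
  symmetric_coef2 b -> bounded_coef a e -> bounded_coef b f -> `|v| <= 1 ->
  `|@insertion R d 1 1 2 (hfield a) (hfield b) t v| <= C * (e * f).
Proof.
have [C CP] := choice (fun ij : nat * nat => (fun H => let: ex_intro2 C h1 h2 := H in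
   ex_intro (fun C => _ /\ _) C (conj h1 h2)) (insertion_bound ij.1 ij.2)).
have C0 ij : 0 <= C ij by case: (CP ij).
exists (1 + \sum_(i < n.+1) \sum_(j < n.+1) C (i : nat, j : nat)).
  rewrite ltr_pwDl// sumr_ge0// => i _; exact: sumr_ge0.
move=> i j a b e f t v; rewrite -ltnS => ln; rewrite -ltnS => jn e0 f0 sb ae bf v1.
apply: le_trans ((CP (i, j)).2 a b e f t v sb ae bf v1) _.
rewrite ler_wpM2r ?mulr_ge0//.
rewrite (bigD1 (Ordinal ln))//= (bigD1 (Ordinal jn))//= addrCA -[leLHS]addr0 -addrA lerD2l.
by repeat first [exact: ler01|exact: C0|apply: addr_ge0|apply: sumr_ge0 => ? _].
Qed.

Lemma insertionBl (A A' B : mvf R d 2) t v :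
  @insertion R d 1 1 2 (fun t v => A t v - A' t v) B t v =
  @insertion R d 1 1 2 A B t v - @insertion R d 1 1 2 A' B t v.
Proof.
rewrite /insertion -mulrBr -sumrB; congr (_ * _); apply: eq_bigr => s _.
rewrite -mulrBr -sumrB; congr (_ * _); apply: eq_bigr => u _.
by rewrite mulrBl.
Qed.

Lemma insertionBr (A B B' : mvf R d 2) t v :
  (forall t, C1_at (B t) v) -> (forall t, C1_at (B' t) v) ->
  @insertion R d 1 1 2 A (fun t v => B t v - B' t v) t v =
  @insertion R d 1 1 2 A B t v - @insertion R d 1 1 2 A B' t v.
Proof.
move=> cB cB'.
have E u t' : partial u (fun z => B t' z - B' t' z) v = partial u (B t') v - partial u (B' t') v.
  have -> : (fun z => B t' z - B' t' z) = (fun z => B t' z + -1 * B' t' z).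
    by apply: funext => z; rewrite mulN1r.
  by rewrite partialD ?partialZ ?mulN1r//; exact: C1_atZ.
rewrite /insertion -mulrBr -sumrB; congr (_ * _); apply: eq_bigr => s _.
rewrite -mulrBr -sumrB; congr (_ * _); apply: eq_bigr => u _.
by rewrite E mulrBr.
Qed.

End InsertionEstimates.

(** * Fiber degree of functions on the total space *)

Section FiberDegree.
Variables (R : realType) (n q : nat).
Implicit Types (U : set 'rV[R]_n) (f g : 'rV[R]_(n + q) -> R).

(* Functions of fiber degree [m - 1] over [U]: zero, basic and fiberwise linear functions for
   [m = 0, 1, 2]; no condition for larger [m]. *)
Definition graded m U f : Prop :=
  match m with
  | 0 => forall x, U x -> forall y : 'rV[R]_q, f (row_mx x y) = 0
  | 1 => forall x, U x -> forall y z : 'rV[R]_q, f (row_mx x y) = f (row_mx x z)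
  | 2 => forall x, U x -> forall (c : R) (y z : 'rV[R]_q),
           f (row_mx x (c *: y + z)) = c * f (row_mx x y) + f (row_mx x z)
  | _ => True
  end.

Lemma graded_zero m U f : graded 0 U f -> graded m U f.
Proof.
case: m => [|[|[|m]]] //= h x Ux => [y z|c y z]; first by rewrite !h.
by rewrite !h// mulr0 addr0.
Qed.

Lemma graded1M m U f g : graded 1 U f -> graded m U g -> graded m U (fun z => f z * g z).
Proof.
case: m => [|[|[|m]]] //= hf hg x Ux => [y|y z|c y z]; first by rewrite hg// mulr0.
  by rewrite (hf x Ux y z) (hg x Ux y z).
by rewrite hg// mulrDr mulrCA (hf x Ux (c *: y + z) y) (hf x Ux z y).
Qed.

Lemma gradedM1 m U f g : graded m U f -> graded 1 U g -> graded m U (fun z => f z * g z).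
Proof.
move=> hf hg; have -> : (fun z => f z * g z) = fun z => g z * f z.
  by apply: funext => z; rewrite mulrC.
exact: graded1M.
Qed.

Lemma graded0M m U f g : graded 0 U f -> graded m U (fun z => f z * g z).
Proof. by move=> hf; apply: graded_zero => x Ux y; rewrite hf// mul0r. Qed.

Lemma gradedM0 m U f g : graded 0 U g -> graded m U (fun z => f z * g z).
Proof. by move=> hg; apply: graded_zero => x Ux y; rewrite hg// mulr0. Qed.

Lemma graded_sum m U (I : Type) (r : seq I) (P : pred I) (F : I -> 'rV[R]_(n + q) -> R) :
  (forall i, P i -> graded m U (F i)) -> graded m U (fun z => \sum_(i <- r | P i) F i z).
Proof.
case: m => [|[|[|m]]] //= h x Ux => [y|y z|c y z].
- by rewrite big1// => i Pi; rewrite h.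
- by apply: eq_bigr => i Pi; rewrite (h i Pi x Ux y z).
- by rewrite mulr_sumr -big_split; apply: eq_bigr => i Pi; rewrite h.
Qed.

Lemma graded_cst U c : graded 1 U (fun=> c).
Proof. by []. Qed.

Lemma graded_val0 m U f x : graded m U f -> (m < 3)%N -> m != 1%N -> U x ->
  f (row_mx x 0) = 0.
Proof.
case: m => [|[|[|m]]] //= h _ _ Ux; first exact: h.
by have := h x Ux (-1) 0 0; rewrite scaleN1r oppr0 addr0 mulN1r addNr.
Qed.

Definition fiber_index (i : 'I_(n + q)) := (n <= i)%N.

Lemma fiber_index_lshift (a : 'I_n) : fiber_index (lshift q a) = false.
Proof. by rewrite /fiber_index leqNgt /= ltn_ord. Qed.

Lemma fiber_index_rshift (j : 'I_q) : fiber_index (rshift n j) = true.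
Proof. by rewrite /fiber_index /= leq_addr. Qed.

Lemma delta_lshift (a : 'I_n) : delta_mx 0 (lshift q a) = row_mx (delta_mx 0 a) 0 :> 'rV[R]_(n + q).
Proof.
apply/rowP => i; rewrite !mxE eqxx /=; case: (splitP i) => j ij; rewrite !mxE ?eqxx /=.
  by rewrite -!val_eqE /= ij.
by rewrite -val_eqE /= ij gtn_eqF// ltn_addr.
Qed.

Lemma delta_rshift (j : 'I_q) : delta_mx 0 (rshift n j) = row_mx 0 (delta_mx 0 j) :> 'rV[R]_(n + q).
Proof.
apply/rowP => i; rewrite !mxE eqxx /=; case: (splitP i) => a ia; rewrite !mxE ?eqxx /=.
  by rewrite -val_eqE /= ia ltn_eqF// ltn_addr.
by rewrite -!val_eqE /= ia eqn_add2l.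
Qed.

Lemma growth_base f x y (a : 'I_n) :
  (fun h : R => h^-1 *: (f (h *: delta_mx 0 (lshift q a) + row_mx x y) - f (row_mx x y))) =
  (fun h : R => h^-1 *: (f (row_mx (h *: delta_mx 0 a + x) y) - f (row_mx x y))).
Proof.
apply: funext => h; congr (_ *: (f _ - _)).
by rewrite delta_lshift scale_row_mx scaler0 add_row_mx add0r.
Qed.

Lemma growth_fiber f x y (j : 'I_q) :
  (fun h : R => h^-1 *: (f (h *: delta_mx 0 (rshift n j) + row_mx x y) - f (row_mx x y))) =
  (fun h : R => h^-1 *: (f (row_mx x (h *: delta_mx 0 j + y)) - f (row_mx x y))).
Proof.
apply: funext => h; congr (_ *: (f _ - _)).
by rewrite delta_rshift scale_row_mx scaler0 add_row_mx add0r.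
Qed.

Definition over U : set 'rV[R]_(n + q) := [set z | U (lsubmx z)].

Lemma over_row U x y : over U (row_mx x y) <-> U x.
Proof. by rewrite /over /= row_mxKl. Qed.

Lemma continuous_lsubmx : continuous (lsubmx : 'rV[R]_(n + q) -> 'rV[R]_n).
Proof.
move=> z; apply: (@continuous_rV _ _ _ (fun z => lsubmx z) z) => j.
have -> : (fun z : 'rV[R]_(n + q) => lsubmx z 0 j) = fun z => z 0 (lshift q j).
  by apply: funext => w; rewrite mxE.
exact: coord_continuous.
Qed.

Lemma open_over U : open U -> open (over U).
Proof. by move=> oU; apply: open_comp => // z _; exact: continuous_lsubmx. Qed.

Lemma slice_base f x y (a : 'I_n) : C1_at f (row_mx x y) ->
  is_derive x (delta_mx 0 a) (fun z => f (row_mx z y)) (partial (lshift q a) f (row_mx x y)).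
Proof.
move=> C; have := C1_derivable C (lshift q a); rewrite partialE => h.
by apply: DeriveDef; move: h; rewrite /derivable /derive growth_base.
Qed.

Lemma near_slice U x : open U -> U x -> nbhs x U.
Proof. by move=> oU Ux; apply: open_nbhs_nbhs. Qed.

Lemma graded_partial_base m U f (a : 'I_n) : open U -> (forall z, over U z -> C1_at f z) ->
  graded m U f -> graded m U (partial (lshift q a) f).
Proof.
move=> oU Cf.
have sl x y : U x -> is_derive x (delta_mx 0 a) (fun z => f (row_mx z y))
    (partial (lshift q a) f (row_mx x y)).
  by move=> Ux; apply: slice_base; apply: Cf; apply/over_row.
case: m => [|[|[|m]]] //= h x Ux => [y|y z|c y z].
- have [_ <-] := sl x y Ux; rewrite -(derive_cst (0 : R) x (delta_mx 0 a)).
  by apply: near_eq_derive; apply: filterS (near_slice oU Ux) => x' Ux'; exact: h.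
- have [_ <-] := sl x y Ux; have [_ <-] := sl x z Ux.
  by apply: near_eq_derive; apply: filterS (near_slice oU Ux) => x' Ux'; exact: h.
- have [_ <-] := sl x (c *: y + z) Ux.
  have := is_deriveD (is_deriveZ c (sl x y Ux)) (sl x z Ux) => -[_ E].
  apply: etrans (etrans _ E) _ => //.
  by apply: near_eq_derive; apply: filterS (near_slice oU Ux) => x' Ux'; exact: h.
Qed.

Lemma graded_partial_fiber m U f (j : 'I_q) : (m < 2)%N -> graded m.+1 U f ->
  graded m U (partial (rshift n j) f).
Proof.
have P x y : partial (rshift n j) f (row_mx x y) =
    lim ((fun h : R => h^-1 *: (f (row_mx x (h *: delta_mx 0 j + y)) - f (row_mx x y))) @ 0^').
  by rewrite partialE /derive growth_fiber.
case: m => [|[|m]] //= _ h x Ux => [y|y z].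
- rewrite P; apply: cvg_lim => //; apply: cvg_near_cst; apply: nearW => t.
  by rewrite (h x Ux _ y) subrr scaler0.
- have L y' : partial (rshift n j) f (row_mx x y') = f (row_mx x (delta_mx 0 j)).
    rewrite P; apply: cvg_lim => //; apply: cvg_near_cst.
    apply: filterS (@nbhs_dnbhs_neq R 0) => t t0.
    by rewrite h// addrK [_ *: _]mulrA mulVf// mul1r.
  by rewrite !L.
Qed.

Lemma graded0_partial_fiber U f (j : 'I_q) : graded 0 U f -> graded 0 U (partial (rshift n j) f).
Proof. by move=> h; apply: graded_partial_fiber => //; exact: (graded_zero 1 h). Qed.

(** Base derivatives keep the fiber degree and fiber derivatives lower it by one. Truncated
    subtraction is right at [m = 0], since the derivatives of zero are zero. *)
Lemma graded_partial m U f i : open U -> (forall z, over U z -> C1_at f z) ->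
  (m < 3)%N -> graded m U f -> graded (m - fiber_index i) U (partial i f).
Proof.
move=> oU Cf m3 hf; case: (split_ordP i) => j ->.
  by rewrite fiber_index_lshift subn0; exact: graded_partial_base.
rewrite fiber_index_rshift; case: m m3 hf => [|m] m3 hf.
  exact: graded0_partial_fiber.
by rewrite subn1; apply: graded_partial_fiber.
Qed.

Lemma graded_partials m U f w : open U -> smooth_on (over U) f -> (m < 3)%N ->
  graded m U f -> graded (m - count fiber_index w) U (partials w f).
Proof.
move=> oU sf m3 hf; elim: w => [|i w IH]; first by rewrite subn0.
have -> : partials (i :: w) f = partial i (partials w f) by [].
rewrite [count _ _]/= addnC subnDA; apply: graded_partial => //.
  by move=> z; apply: smooth_C1; exact: smooth_partials.
by apply: leq_ltn_trans m3; exact: leq_subr.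
Qed.

Lemma graded_coord U i : graded (fiber_index i).+1 U (fun z => z 0 i).
Proof.
case: (split_ordP i) => j ->.
  by rewrite fiber_index_lshift => x Ux y z; rewrite !row_mxEl.
by rewrite fiber_index_rshift => x Ux c y z; rewrite !row_mxEr !mxE.
Qed.

Lemma graded_monomial U (w : seq 'I_(n + q)) :
  graded (count fiber_index w).+1 U (fun z => \prod_(i <- w) z 0 i).
Proof.
elim: w => [|i w IH].
  have -> : (fun z : 'rV[R]_(n + q) => \prod_(i <- [::]) z 0 i) = fun=> 1.
    by apply: funext => z; rewrite big_nil.
  exact: graded_cst.
have -> : (fun z : 'rV[R]_(n + q) => \prod_(j <- i :: w) z 0 j) =
    fun z => z 0 i * \prod_(j <- w) z 0 j.
  by apply: funext => z; rewrite big_cons.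
have := graded_coord U i; rewrite [count _ _]/=.
case: (fiber_index i) => hi; last by rewrite add0n; exact: graded1M.
case: (count fiber_index w) IH => [|c] IH //.
exact: gradedM1.
Qed.

Lemma vlinearP f : vlinear f <-> graded 2 setT f.
Proof. by split => [h x _|h x a y z]; [exact: h|rewrite h]. Qed.

Lemma vbasicP f : vbasic f <-> graded 1 setT f.
Proof.
split => [[g ->] x _ y z|h]; first by rewrite /= !row_mxKl.
exists (fun x => f (row_mx x 0)); apply: funext => z /=.
by rewrite -{1}(hsubmxK z); exact: h.
Qed.

End FiberDegree.

(** * Linear bivector fields with polynomial coefficients *)

Section LinearCoefficients.
Variables (R : realType) (n q : nat).
Notation fib := (@fiber_index n q).

(* The coefficients of the elements of [Vlin 2]: a monomial with [j] fiber variables may only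
   occur in front of a bivector with [j + 1] fiber directions. *)
Definition linear_coef l (a : coef2 R (n + q) l) :=
  [/\ symmetric_coef2 a,
      forall (s : 'S_2) (t : 2.-tuple 'I_(n + q)) (w : l.-tuple 'I_(n + q)),
        a [tuple tnth t (s i) | i < 2] w = (-1) ^+ s * a t w &
      forall (t : 2.-tuple 'I_(n + q)) (w : l.-tuple 'I_(n + q)),
        count fib t != (count fib w).+1 -> a t w = 0].

(** For a bivector the number of fiber directions is exactly the index of [graded]: with 0, 1 or 2
    of them the coefficient is zero, basic or fiberwise linear. *)
Lemma graded_hfield l (a : coef2 R (n + q) l) (t : 2.-tuple 'I_(n + q)) : linear_coef a ->
  graded (count fib t) setT (hfield a t).
Proof.
case=> _ _ h; apply: graded_sum => w _.
have [E|/eqP hw] := eqVneq (count fib t) (count fib w).+1; last first.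
  by apply: graded0M => x _ y; apply: h; apply/eqP.
rewrite E; apply: graded1M; first exact: graded_cst.
have -> : (fun z : 'rV[R]_(n + q) => \prod_(j < l) z 0 (tnth w j)) =
    fun z => \prod_(i <- w) z 0 i.
  by apply: funext => z; rewrite big_tuple.
exact: graded_monomial.
Qed.

Lemma count_fib2 (t : 2.-tuple 'I_(n + q)) :
  count fib t = (fib (tnth t ord0) + fib (tnth t ord_max))%N.
Proof.
case/tupleP: t => a t; case/tupleP: t => b t; rewrite (tuple0 t) /= addn0.
by rewrite tnth0; congr (_ + fib _)%N; rewrite (tnth_nth a).
Qed.

(** The three closure conditions of [Vlin] in one: indices (2, 2), (1, 2) and (1, 1) of the
    arguments yield a linear, a basic and a zero value. *)
Lemma graded_mvf_eval2 (A : mvf R (n + q) 2) (f : 'I_2 -> 'rV[R]_(n + q) -> R)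
    (m : 'I_2 -> nat) :
  (forall t : 2.-tuple 'I_(n + q), graded (count fib t) setT (A t)) ->
  (forall i, smooth_on setT (f i)) -> (forall i, (0 < m i < 3)%N) -> (forall i, graded (m i) setT (f i)) ->
  graded (m ord0 + m ord_max - 2) setT (mvf_eval A f).
Proof.
move=> hA sf m12 hf; apply: graded_sum => t _.
have -> : (fun z => A t z * \prod_(i < 2) partial (tnth t i) (f i) z) =
    (fun z => A t z * (partial (tnth t ord0) (f ord0) z * partial (tnth t ord_max) (f ord_max) z)).
  apply: funext => z; rewrite big_ord_recl big_ord_recl big_ord0 mulr1.
  by have -> : lift ord0 ord0 = ord_max :> 'I_2 by exact: val_inj.
have gp i : graded (m i - fib (tnth t i)) setT (partial (tnth t i) (f i)).
  apply: graded_partial; [exact: openT| |by case/andP: (m12 i)|exact: hf].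
  by move=> z _; exact: (smooth_C1 (sf i) (I : setT z)).
have := hA t; have := gp ord0; have := gp ord_max; rewrite count_fib2.
case/andP: (m12 ord0); case/andP: (m12 ord_max).
case: (m ord0) => [|[|[|?]]] // _ _; case: (m ord_max) => [|[|[|?]]] // _ _;
  case: (fib (tnth t ord0)); case: (fib (tnth t ord_max)) => h1 h0 hA';
  rewrite ?addn0 ?add0n ?subn0 ?subnn in h1 h0 hA' *.
all: try (by apply: graded0M).
all: try (by apply: gradedM0; apply: graded0M).
all: try (by apply: gradedM0; apply: gradedM0).
all: try (by apply: graded1M => //; apply: graded1M).
all: try (by apply: graded1M => //; apply: gradedM1).
all: try (by apply: gradedM1 => //; apply: gradedM1).
Qed.

Lemma Vlin_hfield l (a : coef2 R (n + q) l) : linear_coef a -> @Vlin R n q 2 l%:Z (hfield a).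
Proof.
move=> la; have [sa aa _] := la; split.
- move=> s t x _; rewrite /hfield -hpolyZ; apply: eq_hpoly => w; exact: aa.
- by move=> t; exists (a t).
move=> f sf.
have gA t := graded_hfield t la.
split.
- move=> fl; apply/vlinearP.
  have := @graded_mvf_eval2 _ f (fun=> 2%N) gA sf; apply => // i; exact/vlinearP.
- move=> i fb fl; apply/vbasicP.
  have := @graded_mvf_eval2 _ f (fun j => if j == i then 1 else 2)%N gA sf.
  have -> : ((if ord0 == i then 1 else 2) + (if ord_max == i then 1 else 2) - 2 = 1)%N.
    by case: i {fb fl} => -[|[|]].
  apply; first by move=> j; case: ifP.
  move=> j; case: (eqVneq j i) => [->|ji]; first exact/vbasicP.
  by apply/vlinearP; exact: fl.
- move=> i j ij fi fj x.
  have := @graded_mvf_eval2 _ f (fun=> 1%N) gA sf.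
  rewrite -(hsubmxK x); apply => // i'; apply/vbasicP.
  have [->|ne] := eqVneq i' i; first exact: fi.
  suff -> : i' = j by [].
  move: i' i j ij ne {fi fj}; case=> -[|[|]] // ?; case=> -[|[|]] // ?; case=> -[|[|]] // ? //= _ _;
  exact: val_inj.
Qed.

Lemma linear_form_bracket k l t v (p : coef2 R (n + q) k) :
  linear_form (fun a : 2.-tuple 'I_(n + q) * l.-tuple 'I_(n + q) -> R =>
    @schouten R (n + q) 1 1 (hfield p) (hfield (fun t w => a (t, w))) t v).
Proof.
move=> c a b; rewrite !schouten11E.
have hE t' z : hfield (fun t w => c * a (t, w) + b (t, w)) t' z =
    c * hfield (fun t w => a (t, w)) t' z + hfield (fun t w => b (t, w)) t' z.
  by rewrite /hfield hpolyD hpolyZ.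
have pE u t' : partial u (hfield (fun t w => c * a (t, w) + b (t, w)) t') v =
    c * partial u (hfield (fun t w => a (t, w)) t') v +
    partial u (hfield (fun t w => b (t, w)) t') v.
  have -> : hfield (fun t w => c * a (t, w) + b (t, w)) t' = fun z =>
      c * hfield (fun t w => a (t, w)) t' z + hfield (fun t w => b (t, w)) t' z.
    by apply: funext => z; exact: hE.
  rewrite partialD ?partialZ//; try exact: C1_at_hpoly.
  by apply: C1_atZ; exact: C1_at_hpoly.
rewrite mulrDr addrACA; congr (_ + _).
  rewrite /insertion mulrCA -mulrDr; congr (_ * _).
  rewrite mulr_sumr -big_split; apply: eq_bigr => s _ /=.
  rewrite mulrCA -mulrDr; congr (_ * _).
  rewrite mulr_sumr -big_split; apply: eq_bigr => u _ /=.
  by rewrite pE mulrDr mulrCA.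
rewrite /insertion mulrCA -mulrDr; congr (_ * _).
rewrite mulr_sumr -big_split; apply: eq_bigr => s _ /=.
rewrite mulrCA -mulrDr; congr (_ * _).
rewrite mulr_sumr -big_split; apply: eq_bigr => u _ /=.
by rewrite hE mulrDl mulrA.
Qed.

Lemma partial_hpoly_homog l (a : l.-tuple 'I_(n + q) -> R) u c v : symmetric_coef a ->
  c * partial u (hpoly a) (c *: v) = c ^+ l * partial u (hpoly a) v.
Proof.
case: l a => [|l] a sa.
  have -> : hpoly a = fun=> a [tuple] by apply: funext => z; rewrite hpoly0.
  by rewrite !partial_cst !mulr0.
by rewrite !partial_hpoly// hpoly_homog exprS; ring.
Qed.

(** The degree is [k + l - 1]; the additional factor [c] on the left avoids the truncated
    subtraction. *)
Lemma insertion_homog k l (p : coef2 R (n + q) k) (a : coef2 R (n + q) l) t c v :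
  symmetric_coef2 a ->
  c * @insertion R (n + q) 1 1 2 (hfield p) (hfield a) t (c *: v) =
  c ^+ (k + l) * @insertion R (n + q) 1 1 2 (hfield p) (hfield a) t v.
Proof.
move=> sa; rewrite /insertion mulrCA [RHS]mulrCA; congr (_ * _).
rewrite !mulr_sumr; apply: eq_bigr => s _ /=.
rewrite mulrCA [RHS]mulrCA; congr (_ * _).
rewrite !mulr_sumr; apply: eq_bigr => u _ /=.
rewrite mulrCA /hfield partial_hpoly_homog// hpoly_homog exprD; ring.
Qed.

(* The bracket is homogeneous, so its vanishing on the unit ball suffices. *)
Lemma schouten_homog k l (p : coef2 R (n + q) k) (a : coef2 R (n + q) l) t :
  symmetric_coef2 p -> symmetric_coef2 a ->
  (forall v, `|v| <= 1 -> @schouten R (n + q) 1 1 (hfield p) (hfield a) t v = 0) ->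
  forall v, @schouten R (n + q) 1 1 (hfield p) (hfield a) t v = 0.
Proof.
move=> sp sa h v; pose c := (1 + `|v|)^-1.
have v0 : 0 < 1 + `|v| by rewrite ltr_pwDl.
have c0 : 0 < c by rewrite invr_gt0.
have := h (c *: v) _; rewrite !schouten11E => /(_ _)/(congr1 ( *%R c)).
rewrite mulr0 mulrDr !insertion_homog// [(l + k)%N]addnC -mulrDr => H.
have cn0 : c ^+ (k + l) != 0 by rewrite expf_neq0// gt_eqF.
apply: (mulfI cn0); rewrite mulr0; apply: H.
by rewrite normrZ gtr0_norm// ler_pdivrMl// mulr1 lerDr.
Qed.

Lemma zero_coboundary (P : mvf R (n + q) 2) k s : coboundaries P k s (fun _ _ => 0).
Proof.
exists (fun _ _ => 0).
  split=> [s' t x _|t|f sf]; first by rewrite mulr0.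
    case: (s%:Z - k%:Z + 1) => [m|m] //=.
    exists (fun=> 0) => x; by rewrite big1// => w _; rewrite mul0r.
  have E x : mvf_eval (fun (_ : 1.-tuple 'I_(n + q)) _ => 0) f x = 0.
    by rewrite /mvf_eval big1// => t _; rewrite mul0r.
  split=> [_|i _ _|i j _ _ _] //.
    by move=> x a y z; rewrite !E mulr0 addr0.
  by exists (fun=> 0); apply: funext.
apply: funext => t; apply: funext => x; rewrite /schouten /insertion.
rewrite big1 ?mulr0 => [|s' _]; last first.
  by rewrite big1 ?mulr0// => u _; rewrite partial_cst mulr0.
by rewrite big1 ?mulr0 ?subr0// => s' _; rewrite big1 ?mulr0// => u _; rewrite mul0r.
Qed.

(** If the coboundaries are the only coset, they are the coset of [A], which contains [A] because
    zero is a coboundary. *)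
Lemma cocycle_coboundary (P : mvf R (n + q) 2) k s A :
  H2lin P k s = [set coboundaries P k s] -> cocycles P s A -> coboundaries P k s A.
Proof.
move=> H cA.
have : H2lin P k s [set (fun t x => A t x + B t x) | B in coboundaries P k s] by exists A.
rewrite H => <-; exists (fun _ _ => 0); first exact: zero_coboundary.
by apply: funext => t; apply: funext => x; rewrite addr0.
Qed.

End LinearCoefficients.

(** * Consequences of the vanishing of the cohomology *)

Section Rigidity.
Variables (R : realType) (n q : nat).
Notation D := (n + q)%N.

Lemma hfield_inj l (a : coef2 R D l) : symmetric_coef2 a ->
  (forall t v, hfield a t v = 0) -> forall t w, a t w = 0.
Proof. by move=> sa h t w; apply: (hpoly_inj (sa t)) => v; exact: h. Qed.

Lemma cocycle_hfield k l (p : coef2 R D k) (a : coef2 R D l) :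
  linear_coef a -> (forall t v, @schouten R D 1 1 (hfield p) (hfield a) t v = 0) ->
  cocycles (hfield p) l (hfield a).
Proof. by move=> la h; split; [exact: Vlin_hfield|exact: h]. Qed.

Lemma rigid_low k s (p : coef2 R D k) (a : coef2 R D s) : (s.+1 < k)%N ->
  H2lin (hfield p) k s = [set coboundaries (hfield p) k s] ->
  linear_coef a -> (forall t v, @schouten R D 1 1 (hfield p) (hfield a) t v = 0) ->
  forall t w, a t w = 0.
Proof.
move=> sk H la h; have [X [_ hX _] XE] := cocycle_coboundary H (cocycle_hfield la h).
have [sa _ _] := la; apply: (hfield_inj sa) => t v.
(* [Negz n] is [-(n + 1)]: the degree of the primitive is negative, so the primitive is zero. *)
have E : s%:Z - k%:Z + 1 = Negz (k - s).-2 by rewrite NegzE; lia.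
rewrite E /= in hX.
rewrite -XE; have -> : X = fun _ _ => 0.
  by apply: funext => t'; apply: funext => x; exact: hX.
rewrite /schouten /insertion big1 ?mulr0 => [|s' _]; last first.
  by rewrite big1 ?mulr0// => u _; rewrite partial_cst mulr0.
by rewrite big1 ?mulr0 ?subr0// => s' _; rewrite big1 ?mulr0// => u _; rewrite mul0r.
Qed.

Lemma big_tuple1 (F : 1.-tuple 'I_D -> R) :
  \sum_(w : 1.-tuple 'I_D) F w = \sum_i F [tuple i].
Proof.
rewrite big_tupleS; apply: eq_bigr => i _; rewrite big_tuple0; congr F.
Qed.

(** In degree 0 all components are constants. A fiber component is the value of [X] on a linear
    coordinate, hence fiberwise linear, and a fiberwise linear constant is zero. *)
Lemma Vlin10 (X : mvf R D 1) : @Vlin R n q 1 0 X -> exists c : 'I_n -> R, forall x,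
  (forall b, X [tuple lshift q b] x = c b) /\ (forall j, X [tuple rshift n j] x = 0).
Proof.
case=> _ hX lX.
have cX t : {c | forall x, X t x = c}.
  apply: cid; have [a aE] := hX t; exists (a [tuple]) => x.
  by rewrite aE big_tuple0 big_ord0 mulr1.
exists (fun b => sval (cX [tuple lshift q b])) => x; split.
  by move=> b; exact: (svalP (cX [tuple lshift q b])).
move=> j; pose f (i : 'I_1) : 'rV[R]_D -> R := fun z => z 0 (rshift n j).
have [|+ _ _] := lX f; first by move=> i; exact: smooth_coord.
have fE z : mvf_eval X f z = X [tuple rshift n j] z.
  rewrite /mvf_eval big_tuple1 (bigD1 (rshift n j))//= [X in _ + X]big1 => [|i ij].
    have E1 : (rshift n j == rshift n j)%:R = 1 :> R by rewrite eqxx.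
    by rewrite big_ord1 tnth0 partial_coord E1 mulr1 addr0.
  by rewrite big_ord1 tnth0 partial_coord (negbTE ij) mulr0.
move=> /(_ _) h; have {}h : vlinear (mvf_eval X f).
  by apply: h => i y a z w; rewrite /f !row_mxEr !mxE.
have := h 0 (-1) 0 0; rewrite !fE scaleN1r oppr0 addr0 mulN1r addNr => E0.
have [a aE] := hX [tuple rshift n j].
by rewrite -[RHS]E0 !aE !big_tuple0 !big_ord0.
Qed.

Lemma partial_alternating (K : mvf R D 2) (s : 'S_2) t u v : Defs.alternating setT K ->
  (forall t, smooth_on setT (K t)) ->
  partial u (K [tuple tnth t (s i) | i < 2]) v = (-1) ^+ s * partial u (K t) v.
Proof.
move=> aK sK; rewrite -partialZ; last exact: (smooth_C1 (sK t) (I : setT v)).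
by congr (partial u _ v); apply: funext => x; exact: aK.
Qed.

(** The insertion that differentiates [X] vanishes. In the other one both permutations contribute
    the same term, as [P] is alternating, which cancels the division by 2; the minus sign is that of
    the second half of [schouten]. *)
Lemma schouten_constant (P : mvf R D 2) (X : mvf R D 1) (c : 'I_n -> R) t v :
  Defs.alternating setT P -> (forall t, smooth_on setT (P t)) ->
  (forall x, (forall b, X [tuple lshift q b] x = c b) /\ (forall j, X [tuple rshift n j] x = 0)) ->
  @schouten R D 1 0 P X t v = - \sum_b c b * partial (lshift q b) (P t) v.
Proof.
move=> aP sP XE.
have XE' t' : exists c', X t' = fun=> c'.
  case/tupleP: t' => i t'; rewrite (tuple0 t'); case: (split_ordP i) => j ->.
    exists (c j); apply: funext => x; rewrite -(XE x).1; congr X; exact: val_inj.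
  exists 0; apply: funext => x; rewrite -[RHS]((XE x).2 j); congr X; exact: val_inj.
rewrite /schouten muln0 expr0 mul1r [X in X - _](_ : _ = 0) ?sub0r; last first.
  rewrite /insertion big1 ?mulr0// => s _; rewrite big1 ?mulr0// => u _.
  by have [c' ->] := XE' [tuple tnth t (s (inord j)) | j < 1]; rewrite partial_cst mulr0.
congr (- _); rewrite /insertion.
have -> : \sum_b c b * partial (lshift q b) (P t) v =
    \sum_(u < D) X [tuple u] v * partial u (P t) v.
  rewrite big_split_ord /= [X in _ = _ + X]big1 ?addr0 => [|j _]; last first.
    by rewrite (XE v).2 mul0r.
  by apply: eq_bigr => b _; rewrite (XE v).1.
have E (s : 'S_2) : (-1) ^+ s * (\sum_(u < D)
     X [tuple of u :: [tuple tnth t (s (inord (1.+1 + j))) | j < 0]] v *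
     partial u (P [tuple tnth t (s (inord j)) | j < 2]) v) =
    \sum_(u < D) X [tuple u] v * partial u (P t) v.
  rewrite mulr_sumr; apply: eq_bigr => u _.
  have -> : [tuple tnth t (s (inord j)) | j < 2] = [tuple tnth t (s j) | j < 2].
    by apply: eq_from_tnth => j; rewrite !tnth_mktuple inord_val.
  rewrite partial_alternating// mulrCA signrMK; congr (X _ _ * _).
  by apply: val_inj; rewrite /= ; congr (_ :: _); rewrite enum_ord0.
under eq_bigr do rewrite E.
by rewrite sumr_const card_Sn fact0 muln1 -[X in _ * X]mulr_natl mulrA mulVf ?mul1r// pnatr_eq0.
Qed.

Lemma rigid_top s (p : coef2 R D s.+1) (a : coef2 R D s) :
  linear_coef p ->
  H2lin (hfield p) s.+1 s = [set coboundaries (hfield p) s.+1 s] ->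
  linear_coef a -> (forall t v, @schouten R D 1 1 (hfield p) (hfield a) t v = 0) ->
  exists c : 'I_n -> R, forall t w,
    a t w = \sum_b c b * p t [tuple of lshift q b :: w].
Proof.
move=> lp H la h; have [X hX XE] := cocycle_coboundary H (cocycle_hfield la h).
have [sa _ _] := la; have [sp _ _] := lp.
have E : s%:Z - s.+1%:Z + 1 = 0 by lia.
rewrite E in hX; have [c cE] := Vlin10 hX.
have [aP _ _] := Vlin_hfield lp.
(* The sign comes from [schouten_constant], the factor [s.+1] from differentiating a polynomial of
   degree [s.+1]. *)
exists (fun b => - (s.+1%:R * c b)) => t w.
pose a' (w : s.-tuple 'I_D) := \sum_b - (s.+1%:R * c b) * p t [tuple of lshift q b :: w].
have sa' : symmetric_coef a'.
  move=> w1 w2 w12; apply: eq_bigr => b _; congr (_ * _); apply: sp.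
  by rewrite /= perm_cons.
apply/eqP; rewrite -subr_eq0 -/(a' w); apply/eqP.
apply: (@hpoly_inj _ _ _ (fun w => a t w - a' w)) => [w1 w2 w12|v].
  by rewrite (sa t _ _ w12) (sa' _ _ w12).
rewrite hpolyB; have -> : hpoly (a t) v = hfield a t v by [].
rewrite -XE (schouten_constant _ _ aP _ cE); last by move=> t'; exact: smooth_hpoly.
rewrite /a' hpoly_sum -sumrN -sumrB big1// => b _.
rewrite hpolyZ partial_hpoly//; ring.
Qed.

(** Injectivity turns into an estimate, through [injective_forms_bound]. The forms [L] make room for
    the projection condition imposed in degree [k - 1]. *)
Lemma coef_bound k s (p : coef2 R D k) (T : Type)
    (L : T -> ({: 2.-tuple 'I_D * s.-tuple 'I_D} -> R) -> R) :
  (forall x, linear_form (L x)) -> symmetric_coef2 p ->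
  (forall a : coef2 R D s, linear_coef a ->
     (forall t v, @schouten R D 1 1 (hfield p) (hfield a) t v = 0) ->
     (forall x, L x (fun i => a i.1 i.2) = 0) -> forall t w, a t w = 0) ->
  exists2 C : R, 0 < C & forall (a : coef2 R D s) (e : R), 0 <= e -> linear_coef a ->
     (forall t v, `|v| <= 1 -> `|@schouten R D 1 1 (hfield p) (hfield a) t v| <= e) ->
     (forall x, L x (fun i => a i.1 i.2) = 0) -> bounded_coef a (C * e).
Proof.
move=> lL sp inj.
pose I := {: 2.-tuple 'I_D * s.-tuple 'I_D}.
pose J : Type := ((2.-tuple 'I_D * s.-tuple 'I_D * s.-tuple 'I_D) +
  ('S_2 * 2.-tuple 'I_D * s.-tuple 'I_D) + (2.-tuple 'I_D * s.-tuple 'I_D) +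
  (3.-tuple 'I_D * {v : 'rV[R]_D | `|v| <= 1}) + T)%type.
(* The linear conditions defining [linear_coef] are themselves taken as forms, so that these
   forms are jointly injective on all coefficient arrays. *)
pose l (j : J) (a : I -> R) : R :=
  match j with
  | inl (inl (inl (inl (t, w, w')))) => if perm_eq w w' then a (t, w) - a (t, w') else 0
  | inl (inl (inl (inr (g, t, w)))) =>
      a ([tuple tnth t (g i) | i < 2], w) - (-1) ^+ (g : 'S_2) * a (t, w)
  | inl (inl (inr (t, w))) =>
      if count (@fiber_index n q) t != (count (@fiber_index n q) w).+1 then a (t, w) else 0
  | inl (inr (t, v)) => @schouten R D 1 1 (hfield p) (hfield (fun t w => a (t, w))) t (sval v)
  | inr x => L x a
  end.
have ll j : linear_form (l j).
  case: j => [[[[[[t w] w']|[[g t] w]]|[t w]]|[t v]]|x] c a b /=.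
  - by case: ifP => _; rewrite ?mulr0 ?addr0// opprD addrACA mulrBr.
  - by rewrite mulrDr opprD addrACA mulrBr [_ * (c * _)]mulrCA.
  - by case: ifP => _; rewrite ?mulr0 ?addr0.
  - exact: linear_form_bracket.
  - exact: lL.
have linj a : (forall j, l j a = 0) -> forall i, a i = 0.
  move=> h [t w]; apply: (inj (fun t w => a (t, w))).
  - split=> [t' w1 w2 w12|g t' w'|t' w' htw].
    + have := h (inl (inl (inl (inl (t', w1, w2))))); rewrite /= w12 => /eqP.
      by rewrite subr_eq0 => /eqP.
    + have := h (inl (inl (inl (inr (g, t', w'))))) => /= /eqP.
      by rewrite subr_eq0 => /eqP.
    + by have := h (inl (inl (inr (t', w')))); rewrite /= htw.
  - move=> t0; apply: schouten_homog => //.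
      move=> t' w1 w2 w12.
      have := h (inl (inl (inl (inl (t', w1, w2))))); rewrite /= w12 => /eqP.
      by rewrite subr_eq0 => /eqP.
    by move=> v v1; exact: (h (inl (inr (t0, exist _ v v1)))).
  - move=> x; have := h (inr x) => /=; rewrite -[RHS]/(0 : R) => <-.
    by congr (L x); apply: funext => -[].
have [C C0 CP] := injective_forms_bound ll linj.
exists C => // a e e0 la ha hL t w.
have [sa aa za] := la.
apply: (CP (fun i => a i.1 i.2) e e0 _ (t, w)).
case=> [[[[[[t' w1] w2]|[[g t'] w']]|[t' w']]|[t' v]]|x] /=.
- by case: ifP => [w12|_]; rewrite ?(sa t' _ _ w12) ?subrr normr0.
- by rewrite aa subrr normr0.
- by case: ifP => [htw|_]; rewrite ?(za _ _ htw) normr0.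
- exact: ha (svalP v).
- by rewrite hL normr0.
Qed.

End Rigidity.

(** * Zeros of maps close to a submersion *)

Section ContractionFixpoint.
Variables (R : realType) (d : nat).

(** The distance from [c] to [T c] has a minimum on the compact ball, and passing from a minimizer
    [p] to [T p] at least halves it, so the minimum is 0. *)
Lemma contraction_fixpoint (T : 'rV[R]_d -> 'rV[R]_d) (r : R) : 0 <= r ->
  (forall c, `|c| <= r -> `|T c| <= r) ->
  (forall c c', `|c| <= r -> `|c'| <= r -> `|T c - T c'| <= 2^-1 * `|c - c'|) ->
  exists2 c, `|c| <= r & T c = c.
Proof.
move=> r0 TB TL.
pose B : set 'rV[R]_d := [set c | `|c| <= r].
pose g c := `|c - T c|.
have Tc c : B c -> forall e : R, 0 < e -> \forall c' \near within B (nbhs c), `|T c - T c'| < e.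
  move=> Bc e e0; rewrite near_withinE.
  have : \forall c' \near c, `|c - c'| < e.
    by apply/nbhs_ballP; exists e => //= z; rewrite -ball_normE.
  apply: filterS => c' h Bc'; apply: le_lt_trans (TL _ _ Bc Bc') _.
  by have := normr_ge0 (c - c'); move: h; lra.
have gc : {within B, continuous g}.
  apply/subspace_continuousP => c Bc.
  apply: cvg_norm; apply: cvgB; first exact: cvg_within.
  apply/cvgrPdist_lt => e e0; exact: Tc.
have cB : compact B.
  apply: bounded_closed_compact.
    exists r; split; first exact: num_real.
    by move=> x rx c Bc; apply: le_trans Bc (ltW rx).
  have -> : B = (fun x : 'rV[R]_d => `|x|) @^-1` [set x | x <= r] by [].
  by apply: closed_comp => [c _|]; [exact: norm_continuous|exact: closed_le].
have B0 : B !=set0 by exists 0; rewrite /B /= normr0.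
have [p pB pmin] := EVT_min_rV B0 cB gc.
have Bp : B p by move: pB; rewrite inE.
exists p => //; have := pmin (T p); rewrite inE => /(_ (TB _ Bp)).
have := TL _ _ Bp (TB _ Bp); rewrite -/(g p) -/(g (T p)) => h1 h2.
have : g p <= 0 by move: h1 h2; lra.
by rewrite normr_le0 subr_eq0 eq_sym => /eqP.
Qed.

Lemma norm_mulmx_le m n (x : 'rV[R]_m) (B : 'M[R]_(m, n)) :
  `|x *m B| <= (\sum_i \sum_j `|B i j|) * `|x|.
Proof.
have S0 : 0 <= \sum_i \sum_j `|B i j| by apply: sumr_ge0 => i _; exact: sumr_ge0.
apply/rV_normP; first by rewrite mulr_ge0.
move=> j; rewrite mxE; apply: le_trans (ler_norm_sum _ _ _) _.
rewrite mulr_suml; apply: ler_sum => i _; rewrite normrM mulrC.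
apply: ler_pM => //; last exact: rV_norm_coord.
by rewrite (bigD1 j)//= lerDl sumr_ge0.
Qed.

(** Parameters of norm at most [r] give points at distance at most [b * r]; the error [(2 * b)^-1]
    then becomes the Lipschitz constant 1/2, and the bound [r / 2] at [x0] makes the contraction
    preserve the ball. *)
Lemma zero_near_submersion n (h : 'rV[R]_n -> 'rV[R]_d) (x0 : 'rV[R]_n) (J : 'M[R]_(n, d))
    (B : 'M[R]_(d, n)) (b r : R) :
  B *m J = 1%:M -> 0 < b -> \sum_i \sum_j `|B i j| <= b -> 0 <= r ->
  (forall x x', `|x - x0| <= b * r -> `|x' - x0| <= b * r ->
     `|h x - h x' - (x - x') *m J| <= (2 * b)^-1 * `|x - x'|) ->
  `|h x0| <= r / 2 ->
  exists2 x, `|x - x0| <= b * r & h x = 0.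
Proof.
move=> BJ b0 Bb r0 hJ h0.
(* Along the slice [x0 + c *m B] the map [h] is the identity up to a Lipschitz error [1 / 2], so
   its zeros there are the fixed points of a contraction. *)
pose T c := c - h (x0 + c *m B).
have nB (c : 'rV[R]_d) : `|c *m B| <= b * `|c|.
  by apply: le_trans (norm_mulmx_le _ _) _; rewrite ler_wpM2r.
have near_x0 (c : 'rV[R]_d) : `|c| <= r -> `|x0 + c *m B - x0| <= b * r.
  move=> cr; rewrite addrC addKr; apply: le_trans (nB c) _.
  by rewrite ler_wpM2l// ltW.
have TL (c c' : 'rV[R]_d) : `|c| <= r -> `|c'| <= r -> `|T c - T c'| <= 2^-1 * `|c - c'|.
  move=> cr cr'; have := hJ _ _ (near_x0 c cr) (near_x0 c' cr').
  have -> : x0 + c *m B - (x0 + c' *m B) = (c - c') *m B.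
    by rewrite mulmxBl opprD addrACA subrr add0r.
  rewrite -mulmxA BJ mulmx1 => H.
  have -> : T c - T c' = - (h (x0 + c *m B) - h (x0 + c' *m B) - (c - c')).
    by rewrite /T [RHS]opprB opprD addrACA -opprD.
  rewrite normrN; apply: le_trans H _.
  have b2 : 0 <= (2 * b)^-1 by rewrite invr_ge0 mulr_ge0// ltW.
  apply: le_trans (ler_wpM2l b2 (nB (c - c'))) _.
  by rewrite invfM mulrA -[_ * _ * b]mulrA mulVf ?mulr1// gt_eqF.
have T0 : `|T 0| <= r / 2 by rewrite /T mul0mx addr0 sub0r normrN.
have TB (c : 'rV[R]_d) : `|c| <= r -> `|T c| <= r.
  move=> cr; have := TL c 0 cr; rewrite normr0 subr0 => /(_ r0) h1.
  have : `|T c| <= `|T c - T 0| + `|T 0| by rewrite -{1}(subrK (T 0) (T c)) ler_normD.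
  move: h1 T0 cr; lra.
have [c cr Tc] := contraction_fixpoint r0 TB TL.
exists (x0 + c *m B); first exact: near_x0.
by move: Tc; rewrite /T -[RHS]subr0 => /addrI/oppr_inj.
Qed.

(** A ball of the maximum norm contains the box spanned by any two of its points, so [MVT_box]
    applies; each of the [n] coordinates contributes one error term. *)
Lemma affine_approximation n (f : 'rV[R]_n -> R) (x0 : 'rV[R]_n) (J : 'I_n -> R) (r e : R) :
  (forall x, `|x - x0| <= r -> (forall i, derivable f x (delta_mx 0 i))) ->
  (forall x i, `|x - x0| <= r -> `|partial i f x - J i| <= e) ->
  forall x x', `|x - x0| <= r -> `|x' - x0| <= r -> 0 <= r ->
  `|f x - f x' - \sum_i (x 0 i - x' 0 i) * J i| <= n%:R * e * `|x - x'|.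
Proof.
move=> df pf x x' xr xr' r0.
have bx z : box x' x z -> `|z - x0| <= r.
  move=> bz; apply/rV_normP => // j; rewrite !mxE.
  move/(rV_normP _ r0)/(_ j): xr; move/(rV_normP _ r0)/(_ j): xr'; rewrite !mxE !ler_norml.
  by move: (bz j); lra.
have [|xi xiP ->] := @MVT_box R n f x' x.
  by move=> z i /bx zr; exact: df.
rewrite -sumrB; apply: le_trans (ler_norm_sum _ _ _) _.
rewrite -mulrA -[n in n%:R]card_ord mulr_natl -sumr_const; apply: ler_sum => i _.
rewrite [(x 0 i - _) * _]mulrC -mulrBl normrM; apply: ler_pM => //.
  by apply: pf; exact: bx.
by have := rV_norm_coord (x - x') i; rewrite !mxE.
Qed.

End ContractionFixpoint.

(** * Charts of the dual bundle *)

Section DualAtlas.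
Variables (R : realType) (n q : nat) (M : manifold R n) (F : bundle M q).
Implicit Types (ci : chart (dual_atlas F)) (m : M).

Lemma open_chart_image (c : chart (atl M)) (O : set M) : open O ->
  open (cmap c @` (dom c `&` O)).
Proof.
move=> oO; rewrite openE => _ [m [dm Om] <-].
have im : img c (cmap c m) by exists m.
have h1 : nbhs (cmap c m) (img c) by apply: open_nbhs_nbhs; split => //; exact: img_open.
have h2 : nbhs (cmap c m) (cinv c @^-1` O).
  by apply: (cinv_continuous im); rewrite cmapK//; exact: open_nbhs_nbhs.
apply: filterS2 h1 h2 => _ [m' dm' <-]; rewrite /= cmapK// => Om'.
by exists m'.
Qed.

Lemma tmapK (i : triv F) m v : tdom i m -> ((tmap i m)^-1)%VF (tmap i m v) = v.
Proof.
move=> dm; apply: lker0_lfunK; apply/lker0P; exact: bij_inj (tmap_bijective dm).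
Qed.

Lemma tmapVK (i : triv F) m w : tdom i m -> tmap i m (((tmap i m)^-1)%VF w) = w.
Proof.
move=> dm; have [g _ gK] := tmap_bijective dm.
by rewrite -(gK w) tmapK.
Qed.

Definition covector (m : M) (i : triv F) (y : 'rV[R]_q) (v : fiber F m) : R^o :=
  \sum_(j < q) y 0 j * tmap i m v 0 j.

Lemma covector_is_linear (m : M) (i : triv F) y : linear (@covector m i y).
Proof.
move=> a u v; rewrite /covector scaler_sumr -big_split; apply: eq_bigr => j _.
by rewrite linearP !mxE mulrDr; congr (_ + _); rewrite mulrCA.
Qed.

HB.instance Definition _ (m : M) (i : triv F) y :=
  GRing.isLinear.Build R (fiber F m) R^o *:%R (@covector m i y) (@covector_is_linear m i y).

Definition covector_lfun (m : M) (i : triv F) y : 'Hom(fiber F m, R^o) := linfun (@covector m i y).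

Lemma covector_lfunE (m : M) (i : triv F) y v : covector_lfun m i y v = @covector m i y v.
Proof. exact: lfunE. Qed.

Lemma dual_cinvE ci (x : 'rV[R]_n) (y : 'rV[R]_q) :
  cinv ci (row_mx x y) = existT _ (cinv ci.1 x) (covector_lfun (cinv ci.1 x) ci.2 y).
Proof. by rewrite /= /dual_cinv row_mxKl row_mxKr. Qed.

Lemma covector_frame (m : M) (i : triv F) y j : tdom i m ->
  covector_lfun m i y (((tmap i m)^-1)%VF (delta_mx 0 j)) = y 0 j.
Proof.
move=> dm; rewrite covector_lfunE /covector tmapVK// (bigD1 j)//= mxE !eqxx mulr1.
by rewrite big1 ?addr0// => l lj; rewrite mxE eqxx /= (negbTE lj) mulr0.
Qed.

Lemma covector_lfun_onto (m : M) (i : triv F) (xi : 'Hom(fiber F m, R^o)) : tdom i m ->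
  covector_lfun m i (\row_j (xi (((tmap i m)^-1)%VF (delta_mx 0 j)) : R)) = xi.
Proof.
move=> dm; apply/lfunP => v; rewrite covector_lfunE /covector.
rewrite -[in RHS](tmapK v dm) [tmap i m v in RHS]row_sum_delta !linear_sum.
by apply: eq_bigr => j _; rewrite !linearZ mxE mulrC.
Qed.

Lemma covector_lfunP (m : M) (i : triv F) (c : R) y z :
  covector_lfun m i (c *: y + z) = c *: covector_lfun m i y + covector_lfun m i z.
Proof.
apply/lfunP => v; rewrite add_lfunE scale_lfunE !covector_lfunE /covector.
rewrite scaler_sumr -big_split; apply: eq_bigr => j _.
by rewrite !mxE mulrDl; congr (_ + _); rewrite -mulrA.
Qed.

Definition base_dom ci : set M := dom ci.1 `&` tdom ci.2.
Definition base_img ci : set 'rV[R]_n := cmap ci.1 @` base_dom ci.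

Lemma open_base_dom ci : open (base_dom ci).
Proof. by apply: openI; [exact: dom_open|exact: tdom_open]. Qed.

Lemma open_base_img ci : open (base_img ci).
Proof. by apply: open_chart_image; exact: tdom_open. Qed.

Lemma dual_cmapE ci m (xi : 'Hom(fiber F m, R^o)) :
  cmap ci (existT _ m xi) = row_mx (cmap ci.1 m)
    (\row_j (xi (((tmap ci.2 m)^-1)%VF (delta_mx 0 j)) : R)).
Proof. by []. Qed.

Lemma base_img_cinv ci x : base_img ci x ->
  base_dom ci (cinv ci.1 x) /\ cmap ci.1 (cinv ci.1 x) = x.
Proof. by case=> m [dm tm] <-; rewrite cmapK. Qed.

Lemma dual_cinvK ci z : over (base_img ci) z -> cmap ci (cinv ci z) = z.
Proof.
move=> Uz; rewrite -{1}(hsubmxK z) dual_cinvE dual_cmapE.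
have [[dm tm] ->] := base_img_cinv Uz.
rewrite -[RHS](hsubmxK z); congr (row_mx _ _); apply/rowP => j.
by rewrite mxE covector_frame.
Qed.

Lemma dual_dom_cinv ci z : over (base_img ci) z -> dom ci (cinv ci z).
Proof. by move=> Uz; have [] := base_img_cinv Uz. Qed.

Lemma dual_imgE ci : img ci = over (base_img ci).
Proof.
apply/seteqP; split => [_ [[m xi] dm <-]|z Uz].
  by rewrite /over /= row_mxKl; exists m.
by exists (cinv ci z); [exact: dual_dom_cinv|exact: dual_cinvK].
Qed.

Lemma dual_cmapK ci e : dom ci e -> cinv ci (cmap ci e) = e.
Proof.
case: e => m xi [/= dm tm].
rewrite -[LHS]/(cinv ci (row_mx (cmap ci.1 m)
  (\row_j (xi (((tmap ci.2 m)^-1)%VF (delta_mx 0 j)) : R)))) dual_cinvE cmapK//.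
by congr existT; exact: covector_lfun_onto.
Qed.

Lemma open_dual_img ci : open (img ci).
Proof. rewrite dual_imgE; apply: open_over; exact: open_base_img. Qed.

Lemma zero_at_cmap ci m : cmap ci (zero_at F m) = row_mx (cmap ci.1 m) 0.
Proof. by rewrite dual_cmapE; congr row_mx; apply/rowP => j; rewrite !mxE zero_lfunE. Qed.

Definition overlap ci ci' : set 'rV[R]_(n + q) :=
  over (cmap ci.1 @` (dom ci.1 `&` (tdom ci.2 `&` base_dom ci'))).

Lemma open_overlap ci ci' : open (overlap ci ci').
Proof.
apply: open_over; apply: open_chart_image; apply: openI; first exact: tdom_open.
exact: open_base_dom.
Qed.

Lemma overlap_cmap ci ci' e : dom ci e -> dom ci' e -> overlap ci ci' (cmap ci e).
Proof. by case: e => m xi [/= d1 d2] [/= d1' d2']; rewrite /overlap /over /= row_mxKl; exists m. Qed.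

Lemma overlap_cinv ci ci' z : overlap ci ci' z ->
  [/\ dom ci (cinv ci z), dom ci' (cinv ci z) & cmap ci (cinv ci z) = z].
Proof.
move=> [m [d1 [d2 [d1' d2']]] E].
have Uz : over (base_img ci) z by exists m.
split; [exact: dual_dom_cinv| |exact: dual_cinvK].
by rewrite /= /dual_cinv /= -E cmapK.
Qed.

Lemma overlap_transition ci ci' z : overlap ci ci' z -> overlap ci' ci (transition ci ci' z).
Proof. by move=> /overlap_cinv[d d' E]; exact: overlap_cmap. Qed.

Lemma smooth_lsubmx_comp (U : set 'rV[R]_(n + q)) (V : set 'rV[R]_n) (f : 'rV[R]_n -> R) :
  open U -> open V -> (forall z, U z -> V (lsubmx z)) -> smooth_on V f ->
  smooth_on U (fun z => f (lsubmx z)).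
Proof.
move=> oU oV UV sf; apply: (smooth_comp (tau := lsubmx) oU oV UV sf) => j.
have -> : (fun z : 'rV[R]_(n + q) => lsubmx z 0 j) = fun z => z 0 (lshift q j).
  by apply: funext => z; rewrite mxE.
exact: smooth_coord.
Qed.

(** The base part is a transition of [M]. The fiber part is linear in the fiber coordinates, with
    coefficients from the change of trivialization of [F] in the opposite direction, from [ci'.2] to
    [ci.2], because covectors transform contragrediently. *)
Lemma smooth_transition ci ci' (b : 'I_(n + q)) :
  smooth_on (overlap ci ci') (fun z => transition ci ci' z 0 b).
Proof.
have oO : open (overlap ci ci') by exact: open_overlap.
have sub (O : set M) : (tdom ci.2 `&` base_dom ci') `<=` O ->
    forall z, overlap ci ci' z -> (cmap ci.1 @` (dom ci.1 `&` O)) (lsubmx z).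
  by move=> sO z [m [d1 d2] <-]; exists m => //; split => //; exact: sO.
have tE z : transition ci ci' z = row_mx (transition ci.1 ci'.1 (lsubmx z))
    (\row_j \sum_l z 0 (rshift n l) * tmap ci.2 (cinv ci.1 (lsubmx z))
       (((tmap ci'.2 (cinv ci.1 (lsubmx z)))^-1)%VF (delta_mx 0 j)) 0 l).
  rewrite /transition -{1}(hsubmxK z) dual_cinvE dual_cmapE; congr row_mx.
  apply/rowP => j; rewrite !mxE covector_lfunE /covector.
  by apply: eq_bigr => l _; rewrite mxE.
case: (split_ordP b) => j ->.
  have -> : (fun z => transition ci ci' z 0 (lshift q j)) =
      fun z => transition ci.1 ci'.1 (lsubmx z) 0 j.
    by apply: funext => z; rewrite tE row_mxEl.
  have o1 : open (cmap ci.1 @` (dom ci.1 `&` dom ci'.1)).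
    by apply: open_chart_image; exact: dom_open.
  have s1 : forall z, overlap ci ci' z -> (cmap ci.1 @` (dom ci.1 `&` dom ci'.1)) (lsubmx z).
    by apply: sub => m [_ []].
  exact: (smooth_lsubmx_comp oO o1 s1 (transition_smooth (c := ci.1) (c' := ci'.1) j)).
have -> : (fun z => transition ci ci' z 0 (rshift n j)) =
    fun z => \sum_l z 0 (rshift n l) * tmap ci.2 (cinv ci.1 (lsubmx z))
       (((tmap ci'.2 (cinv ci.1 (lsubmx z)))^-1)%VF (delta_mx 0 j)) 0 l.
  by apply: funext => z; rewrite tE row_mxEr mxE.
apply: smooth_sum => [//|l _]; apply: (smoothM oO); first exact: smooth_coord.
have := @tmap_smooth _ _ _ _ F ci'.2 ci.2 ci.1 (delta_mx 0 j) l.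
apply: smooth_lsubmx_comp => //.
  by apply: open_chart_image; apply: openI; exact: tdom_open.
by apply: sub => m [t1 [_ t2]].
Qed.

End DualAtlas.

(** * Vanishing of jets and changes of chart *)

Section Vanishing.
Variables (R : realType) (d : nat).
Implicit Types (U : set 'rV[R]_d) (f g : 'rV[R]_d -> R) (x : 'rV[R]_d).

Definition vanishes l f x := forall w : seq 'I_d, (size w <= l)%N -> partials w f x = 0.

Lemma vanishesW l l' f x : (l' <= l)%N -> vanishes l f x -> vanishes l' f x.
Proof. by move=> ll' h w wl; apply: h; exact: leq_trans ll'. Qed.

Lemma vanishesS l f x :
  vanishes l.+1 f x <-> f x = 0 /\ forall i, vanishes l (partial i f) x.
Proof.
split=> [h|[h0 h] w].
  split=> [|i w wl]; first exact: (h [::]).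
  by have := h (rcons w i); rewrite size_rcons /partials foldr_rcons; apply.
case/lastP: w => [//|w i]; rewrite size_rcons /partials foldr_rcons; exact: h.
Qed.

Lemma vanishes_eq_on U l f g x : open U -> (forall z, U z -> f z = g z) -> U x ->
  vanishes l f x -> vanishes l g x.
Proof. by move=> oU fg Ux h w wl; rewrite -(partials_eq_on oU fg w Ux) h. Qed.

Lemma vanishes0 l x : vanishes l (fun=> 0) x.
Proof.
elim: l => [|l IH]; first by case.
apply/vanishesS; split => // i.
have -> : partial i (fun _ : 'rV[R]_d => 0) = fun=> 0; last exact: IH.
by apply: funext => z; exact: partial_cst.
Qed.

Lemma vanishesD U l f g x : open U -> smooth_on U f -> smooth_on U g -> U x ->
  vanishes l f x -> vanishes l g x -> vanishes l (fun z => f z + g z) x.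
Proof.
move=> oU; elim: l f g => [|l IH] f g sf sg Ux hf hg.
  have f0 : f x = 0 := hf [::] isT; have g0 : g x = 0 := hg [::] isT.
  by case=> // _; rewrite /= f0 g0 addr0.
have [f0 hf'] := (vanishesS l f x).1 hf; have [g0 hg'] := (vanishesS l g x).1 hg.
apply/vanishesS; split=> [|i]; first by rewrite f0 g0 addr0.
have := IH _ _ (smooth_partial i sf) (smooth_partial i sg) Ux (hf' i) (hg' i).
apply: (vanishes_eq_on oU) => // z Uz; rewrite partialD//.
  exact: (smooth_C1 sf Uz).
exact: (smooth_C1 sg Uz).
Qed.

Lemma vanishes_sum U l (I : Type) (r : seq I) (F : I -> 'rV[R]_d -> R) x :
  open U -> (forall i, smooth_on U (F i)) -> U x -> (forall i, vanishes l (F i) x) ->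
  vanishes l (fun z => \sum_(i <- r) F i z) x.
Proof.
move=> oU sF Ux hF; elim: r => [|i r IH].
  by under eq_fun do rewrite big_nil; exact: vanishes0.
under eq_fun do rewrite big_cons.
by apply: (vanishesD oU) => //; apply: smooth_sum.
Qed.

Lemma vanishesM U l f g x : open U -> smooth_on U f -> smooth_on U g -> U x ->
  vanishes l g x -> vanishes l (fun z => f z * g z) x.
Proof.
move=> oU; elim: l f g => [|l IH] f g sf sg Ux hg.
  have g0 : g x = 0 := hg [::] isT.
  by case=> // _; rewrite /= g0 mulr0.
have [g0 hg'] := (vanishesS l g x).1 hg.
apply/vanishesS; split=> [|i]; first by rewrite g0 mulr0.
have si := smooth_partial i sf; have sgi := smooth_partial i sg.
have h1 := IH _ _ si sg Ux (vanishesW (leqnSn l) hg).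
have h2 := IH _ _ sf sgi Ux (hg' i).
have := vanishesD oU (smoothM oU si sg) (smoothM oU sf sgi) Ux h1 h2.
apply: (vanishes_eq_on oU) => // z Uz; rewrite partialM//.
  exact: (smooth_C1 sf Uz).
exact: (smooth_C1 sg Uz).
Qed.

End Vanishing.

(** By the chain rule a derivative of the composite is a combination of composites of the
    derivatives of [phi], whose jets vanish to one order less; [vanishesM] absorbs the smooth
    factors. *)
Lemma vanishes_comp (R : realType) (d d' l : nat) (U : set 'rV[R]_d) (V : set 'rV[R]_d')
    (phi : 'rV[R]_d' -> R) (tau : 'rV[R]_d -> 'rV[R]_d') x :
  open U -> open V -> (forall z, U z -> V (tau z)) -> smooth_on V phi ->
  (forall j, smooth_on U (fun z => tau z 0 j)) -> U x ->
  vanishes l phi (tau x) -> vanishes l (phi \o tau) x.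
Proof.
move=> oU oV UV; elim: l phi => [|l IH] phi sphi stau Ux h.
  by case=> // _; exact: (h [::]).
have [h0 h'] := (vanishesS l phi (tau x)).1 h.
apply/vanishesS; split=> [|i]; first exact: h0.
have sp j : smooth_on U (partial j phi \o tau).
  by apply: (smooth_comp oU oV UV _ stau); exact: smooth_partial.
have st j : smooth_on U (partial i (fun z => tau z 0 j)) by exact: smooth_partial.
have : vanishes l (fun z => \sum_j partial i (fun z => tau z 0 j) z * (partial j phi \o tau) z) x.
  apply: (vanishes_sum _ oU) => [j||j]; [exact: (smoothM oU (st j) (sp j))|exact: Ux|].
  apply: (vanishesM oU (st j) (sp j) Ux).
  by apply: IH; [exact: smooth_partial|exact: stau|exact: Ux|exact: h'].
apply: (vanishes_eq_on oU) => // z Uz.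
have C1 : Cn 1 V phi by have /smooth_onP := sphi; exact.
rewrite (partial_comp _ oV C1 (UV _ Uz)); last by move=> j; exact: (smooth_C1 (stau j) Uz).
by apply: eq_bigr => j _; rewrite mulrC.
Qed.

Section JetChart.
Variables (R : realType) (n q : nat) (M : manifold R n) (F : bundle M q).

Lemma smooth_coef (Pi : bivector_field F) ci t : smooth_on (img ci) (Pi ci t).
Proof. exact: coef_smooth. Qed.

(** One chart is enough: by [coef_change] the components in another chart are sums of smooth
    functions times pullbacks of those in [ci]. *)
Lemma jet_vanishes_chart l (Pi : bivector_field F) ci e : dom ci e ->
  (forall t, vanishes l (Pi ci t) (cmap ci e)) -> jet_vanishes l Pi e.
Proof.
move=> de h c w t dce; move: w.
pose sg := transition c ci.
have oO := @open_overlap _ _ _ _ F c ci.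
have Ox : overlap c ci (cmap c e) by exact: overlap_cmap.
have sO ci1 ci2 : overlap ci1 ci2 `<=` @img R _ (n + q) (dual_atlas F) ci1.
  by move=> z /overlap_cinv[d1 _ E]; exists (cinv ci1 z).
have ssg j : smooth_on (overlap c ci) (fun z => sg z 0 j) by exact: smooth_transition.
have sOO z : overlap c ci z -> overlap ci c (sg z) by exact: overlap_transition.
have sgE : sg (cmap c e) = cmap ci e by rewrite /sg /transition dual_cmapK.
pose Psi (u : 2.-tuple 'I_(n + q)) z := \prod_(i < 2) partial (tnth u i)
  (fun x => transition ci c x 0 (tnth t i)) z.
have sPsi u : smooth_on (overlap ci c) (Psi u).
  apply: smooth_prod => [|i _]; first exact: open_overlap.
  by apply: smooth_partial; exact: smooth_transition.
have E z : overlap c ci z -> \sum_u (Psi u \o sg) z * (Pi ci u \o sg) z = Pi c t z.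
  move=> Oz; have [d1 d2 zE] := overlap_cinv Oz.
  by rewrite -{3}zE (coef_change Pi t d2 d1).
suff : vanishes l (fun z => \sum_u (Psi u \o sg) z * (Pi ci u \o sg) z) (cmap c e).
  exact: (vanishes_eq_on oO E Ox).
have oO' := @open_overlap _ _ _ _ F ci c.
have sPi u : smooth_on (overlap ci c) (Pi ci u).
  by apply: smooth_sub (sO ci c) _; exact: smooth_coef.
have sPsi' u : smooth_on (overlap c ci) (Psi u \o sg) by exact: (smooth_comp oO oO' sOO (sPsi u) ssg).
have sPi' u : smooth_on (overlap c ci) (Pi ci u \o sg) by exact: (smooth_comp oO oO' sOO (sPi u) ssg).
apply: (vanishes_sum _ oO) => [u||u]; [exact: (smoothM oO (sPsi' u) (sPi' u))|exact: Ox|].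
apply: (vanishesM oO (sPsi' u) (sPi' u) Ox).
apply: (vanishes_comp oO oO' sOO (sPi u) ssg Ox); rewrite sgE; exact: h.
Qed.

End JetChart.

(** * Linear Poisson structures in a chart, through test functions *)

Section LocalForm.
Variables (R : realType) (n q : nat) (M : manifold R n) (F : bundle M q).
Variables (ci : chart (dual_atlas F)) (x0 : 'rV[R]_n) (r : R).
Hypotheses (r0 : 0 < r) (ballU : forall x, `|x - x0| <= r -> base_img ci x).

(* A cut-off of the coordinate [al]. Its differential over [x0] is a positive multiple of that of
   the coordinate because the bump function is critical at its center. *)
Definition test_coord (al : 'I_(n + q)) (z : 'rV[R]_(n + q)) : R :=
  bumpf x0 r (lsubmx z) * (z 0 al - row_mx x0 0 0 al).

(** Extended by zero to all of [E], since [linear_poisson] speaks of globally defined functions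
    only. *)
Definition test_fun (al : 'I_(n + q)) (e : dual_total F) : R :=
  if `[< base_dom ci (projT1 e) >] then test_coord al (cmap ci e) else 0.

Lemma smooth_test_coord al : smooth_on setT (test_coord al).
Proof.
apply: (smoothM openT).
  exact: (smooth_lsubmx_comp openT openT (fun _ _ => I) (smooth_bumpf x0 r)).
by apply: (smoothD openT); [exact: smooth_coord|exact: smooth_cst].
Qed.

Lemma partial_test_coord al b y :
  partial b (test_coord al) (row_mx x0 y) = bumpf x0 r x0 * (b == al)%:R.
Proof.
have sb : smooth_on setT (fun z : 'rV[R]_(n + q) => bumpf x0 r (lsubmx z)).
  exact: (smooth_lsubmx_comp openT openT (fun _ _ => I) (smooth_bumpf x0 r)).
have Cb := smooth_C1 sb (I : setT (row_mx x0 y)).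
have Cc : C1_at (fun z : 'rV[R]_(n + q) => z 0 al - row_mx x0 0 0 al) (row_mx x0 y).
  by apply: C1_atD; [exact: C1_at_coord|exact: C1_at_cst].
rewrite partialM// row_mxKl partialD; [|exact: C1_at_coord|exact: C1_at_cst].
rewrite partial_coord partial_cst addr0 [X in X * _](_ : _ = 0) ?mul0r ?add0r//.
case: (split_ordP b) => j ->.
  have [_ <-] := slice_base j Cb; rewrite -(partial_bumpf_center x0 r j) partialE.
  have -> : (fun x : 'rV[R]_n => bumpf x0 r (lsubmx (row_mx x y))) = bumpf x0 r.
    by apply: funext => x; rewrite row_mxKl.
  by [].
have g1 : graded 1 setT (fun z : 'rV[R]_(n + q) => bumpf x0 r (lsubmx z)).
  by move=> x _ y1 y2; rewrite !row_mxKl.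
have g0 : graded 0 setT (partial (rshift n j) (fun z : 'rV[R]_(n + q) => bumpf x0 r (lsubmx z))).
  exact: graded_partial_fiber.
exact: (g0 x0 I y).
Qed.

Lemma compact_cball : compact [set x | `|x - x0| <= r].
Proof.
apply: bounded_closed_compact.
  exists (`|x0| + r); split; first exact: num_real.
  move=> c rc x /= xr; apply: le_trans (ltW rc).
  by rewrite -(subrK x0 x) (le_trans (ler_normD _ _))// addrC lerD2l.
have -> : [set x | `|x - x0| <= r] = closed_ball x0 r.
  by rewrite closed_ballE//; apply/seteqP; split => x; rewrite /closed_ball_ /= distrC.
exact: closed_ball_closed.
Qed.

Lemma test_fun_transition al c z : overlap c ci z ->
  test_fun al (cinv c z) = (test_coord al \o transition c ci) z.
Proof.
move=> /overlap_cinv[_ d2 _]; rewrite /test_fun; by case: asboolP.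
Qed.

(** Over the domain of [ci] the function is smooth by its formula. The remaining points lie over the
    complement of the compact image of the ball, which is closed because [M] is Hausdorff, and over
    that complement the function is zero. *)
Lemma smooth_test_fun al : smooth_function (dual_atlas F) (test_fun al).
Proof.
move=> c; apply: smooth_local => y; rewrite dual_imgE => Uy.
have [dm|ndm] := pselect (base_dom ci (cinv c.1 (lsubmx y))).
  exists (overlap c ci).
  have oO : open (overlap c ci) by exact: open_overlap.
  have Oy : overlap c ci y.
    have [[d1 d2] E] := base_img_cinv Uy.
    by exists (cinv c.1 (lsubmx y)).
  split => //; apply: (smooth_eq (f := test_coord al \o transition c ci) oO).
    by move=> z Oz; rewrite /= test_fun_transition.
  apply: (smooth_comp oO openT (fun _ _ => I) (smooth_test_coord al)) => j.
  exact: smooth_transition.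
pose K := cinv ci.1 @` [set x | `|x - x0| <= r].
have clK : closed K.
  apply: compact_closed; first exact: manifold_hausdorff.
  apply: continuous_compact; last exact: compact_cball.
  apply: continuous_in_subspaceT => x; rewrite inE /= => /ballU[m [d1 d2] <-].
  by apply: cinv_continuous; exists m.
pose O := ~` K; have oO : open O by rewrite openC.
pose V : set 'rV[R]_(n + q) := over (cmap c.1 @` (dom c.1 `&` (tdom c.2 `&` O))).
have oV : open V.
  by apply: open_over; apply: open_chart_image; apply: openI => //; exact: tdom_open.
have [[d1 d2] E] := base_img_cinv Uy.
exists V; split => //.
  exists (cinv c.1 (lsubmx y)) => //; split => //; split => // -[x xr xE].
  apply: ndm; rewrite -xE; have [m [e1 e2] <-] := ballU xr.
  by rewrite cmapK.
apply: (smooth_eq (f := fun=> 0) oV); last exact: smooth_cst.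
move=> z [m [e1 [e2 mO]] mE]; rewrite /= /test_fun.
have pz : projT1 (dual_cinv c z) = m by rewrite /= -mE cmapK.
case: asboolP => //; case: (dual_cinv c z) pz => m' xi /= pz [f1 f2]; subst m'.
rewrite /test_coord row_mxKl bumpf_out ?mul0r// leNgt; apply/negP => h.
apply: mO; exists (cmap ci.1 m); first exact: ltW.
by rewrite cmapK.
Qed.

Lemma test_fun_linear (j : 'I_q) : fiberwise_linear (test_fun (rshift n j)).
Proof.
move=> m a xi eta; rewrite /test_fun /=; case: asboolP => _; last by rewrite mulr0 addr0.
rewrite /test_coord !row_mxKl !row_mxEr !mxE !subr0 add_lfunE scale_lfunE.
by rewrite mulrDr; congr (_ + _); rewrite mulrCA.
Qed.

Lemma test_fun_basic (a : 'I_n) : basic (test_fun (lshift q a)).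
Proof.
exists (fun m => if `[< base_dom ci m >] then
  bumpf x0 r (cmap ci.1 m) * (cmap ci.1 m 0 a - x0 0 a) else 0).
apply: funext => -[m xi]; rewrite /test_fun /=; case: asboolP => // _.
by rewrite /test_coord !row_mxKl !row_mxEl.
Qed.

Lemma partial_test_fun al c y i :
  let e := cinv ci (row_mx x0 y) in dom c e -> base_img ci x0 ->
  partial i (test_fun al \o cinv c) (cmap c e) =
  bumpf x0 r x0 * partial i (fun x => transition c ci x 0 al) (cmap c e).
Proof.
move=> e dce Ux0.
have Uz : over (base_img ci) (row_mx x0 y) by apply/over_row.
have de : dom ci e by exact: dual_dom_cinv.
have Oe : overlap c ci (cmap c e) by exact: overlap_cmap.
have oO : open (overlap c ci) by exact: open_overlap.
have tE : transition c ci (cmap c e) = row_mx x0 y.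
  by rewrite /transition dual_cmapK// dual_cinvK.
rewrite (partial_eq_on (g := test_coord al \o transition c ci) oO _ i Oe); last first.
  by move=> z Oz; rewrite -test_fun_transition.
have C1 : Cn 1 setT (test_coord al) by have /smooth_onP := smooth_test_coord al; exact.
rewrite (partial_comp i openT C1 (I : setT (transition c ci (cmap c e)))); last first.
  move=> j; apply: (smooth_C1 _ Oe); exact: smooth_transition.
rewrite tE (bigD1 al)//= partial_test_coord eqxx mulr1 big1 ?addr0// => b bal.
by rewrite partial_test_coord (negbTE bal) mulr0 mul0r.
Qed.

(** Along the fiber over [x0] the components of [Pi] are recovered up to a positive constant.
    [bracket] computes in the chart given by [chart_at], and [coef_change] leads back to [ci]. *)
Lemma bracket_test (Pi : bivector_field F) (al be : 'I_(n + q)) y : base_img ci x0 ->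
  bracket Pi (test_fun al) (test_fun be) (cinv ci (row_mx x0 y)) =
  bumpf x0 r x0 ^+ 2 * Pi ci [tuple al; be] (row_mx x0 y).
Proof.
move=> Ux0; rewrite /bracket.
set e := cinv ci (row_mx x0 y); set c := chart_at (dual_atlas F) e.
have Uz : over (base_img ci) (row_mx x0 y) by apply/over_row.
have de : dom ci e by exact: dual_dom_cinv.
have dce : dom c e.
  by rewrite /c; case: e {c de} => m xi; split; [exact: dom_chart_at|exact: tdom_triv_at].
rewrite -(dual_cinvK Uz) -/e (coef_change Pi [tuple al; be] dce de) mulr_sumr.
apply: eq_bigr => u _; rewrite !big_ord_recl !big_ord0 !mulr1.
rewrite !partial_test_fun//= !(tnth_nth al) /=; ring.
Qed.
End LocalForm.

Section LinearPoisson.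
Variables (R : realType) (n q : nat) (M : manifold R n) (F : bundle M q).

Lemma linear_poisson_graded (Pi : bivector_field F) ci (t : 2.-tuple 'I_(n + q)) :
  linear_poisson Pi -> graded (count (@fiber_index n q) t) (base_img ci) (Pi ci t).
Proof.
move=> [_ LP].
(* Test functions centered at [x0] give the components over [x0] only; this is enough, as [graded]
   is a condition on each fiber separately. *)
suff H x0 : base_img ci x0 -> graded (count (@fiber_index n q) t) [set x0] (Pi ci t).
  move: H; case: (count _ _) => [|[|[|m]]] //= H x Ux; exact: (H x Ux x erefl).
move=> Ux0.
have [r r0 ballU] : exists2 r, 0 < r & forall x, `|x - x0| <= r -> base_img ci x.
  have /nbhs_rV_normP[r r0 rP] : nbhs x0 (base_img ci).
    by apply: open_nbhs_nbhs; split => //; exact: open_base_img.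
  exists (r / 2); first by rewrite divr_gt0.
  by move=> x xr; apply: rP; rewrite distrC (le_lt_trans xr)// ltr_pdivrMr// ltr_pMr// ltr1n.
have b0 : bumpf x0 r x0 ^+ 2 != 0 by rewrite expf_neq0// gt_eqF// bumpf_center.
have sT al : smooth_function (dual_atlas F) (test_fun ci x0 r al) by exact: smooth_test_fun.
have BT al be y := bracket_test r Pi al be y Ux0.
have lin (j : 'I_q) := test_fun_linear ci x0 r j.
have bas (a : 'I_n) := test_fun_basic ci x0 r a.
(* [linear_poisson] treats the pair (linear, basic) in this order; the opposite order follows by
   alternation below. *)
have mixed (j : 'I_q) (a : 'I_n) y z :
    Pi ci [tuple rshift n j; lshift q a] (row_mx x0 y) =
    Pi ci [tuple rshift n j; lshift q a] (row_mx x0 z).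
  have [_ /(_ (lin j) (bas a))[g gE] _] := LP _ _ (sT (rshift n j)) (sT (lshift q a)).
  apply: (mulfI b0); rewrite -!BT gE /=; congr g.
  by rewrite /dual_cinv !row_mxKl.
case/tupleP: t => al t; case/tupleP: t => be t; rewrite (tuple0 t) {t}.
have -> : [tuple of al :: [tuple of be :: [tuple]]] = [tuple al; be] by apply: val_inj.
case: (split_ordP al) => a ->; case: (split_ordP be) => b ->;
  rewrite /= ?fiber_index_lshift ?fiber_index_rshift /= => _ -> y.
- have [_ _ h] := LP _ _ (sT (lshift q a)) (sT (lshift q b)).
  by apply: (mulfI b0); rewrite -BT h// mulr0.
- move=> z.
  have sw w : Pi ci [tuple lshift q a; rshift n b] (row_mx x0 w) =
      - Pi ci [tuple rshift n b; lshift q a] (row_mx x0 w).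
    have Uw : img ci (row_mx x0 w) by rewrite dual_imgE; apply/over_row.
    have := coef_alternating Pi (tperm ord0 ord_max) [tuple rshift n b; lshift q a] Uw.
    rewrite odd_tperm /= expr1 mulN1r => <-; congr (Pi ci _ _).
    apply: eq_from_tnth => i; rewrite tnth_mktuple permE /=.
    by case: i => -[|[|]] //= ?.
  by rewrite !sw (mixed b a y z).
- by move=> z; exact: mixed.
- move=> y1 z1.
  have [h _ _] := LP _ _ (sT (rshift n a)) (sT (rshift n b)).
  apply: (mulfI b0); rewrite mulrDr mulrCA -!BT.
  by rewrite !dual_cinvE covector_lfunP h//; exact: lin.
Qed.

End LinearPoisson.

(** * The estimate extracted from the Jacobi identity *)

Section BracketEstimate.
Variables (R : realType) (d : nat).

Lemma hfieldB l (a b : coef2 R d l) :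
  hfield (fun t w => a t w - b t w) = fun t v => hfield a t v - hfield b t v.
Proof. by apply: funext => t; apply: funext => v; rewrite /hfield hpolyB. Qed.

(** An insertion is not symmetric, so it takes the two terms [i = k] and [i = s], distinct because
    [s < k], to form the bracket of [a k] and [a s]. Replacing [a k] by [p] costs an error of size
    [e * b s] in each, and all other terms go to the right-hand side. *)
Lemma bracket_estimate k (B : R) : 0 <= B -> exists2 C : R, 0 < C &
  forall (p : coef2 R d k) (a : forall i, coef2 R d i) (b : nat -> R) (e : R) s,
    (s < k)%N -> symmetric_coef2 p -> (forall i, symmetric_coef2 (a i)) ->
    (forall i, 0 <= b i) -> (forall i, (i <= 2 * k)%N -> bounded_coef (a i) (b i)) ->
    (forall i, (i <= 2 * k)%N -> b i <= B) -> (forall i, (i < k)%N -> b i <= e) -> 0 <= e ->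
    bounded_coef (fun t w => a k t w - p t w) e ->
    (forall t v, \sum_(i < (k + s).+1)
       @insertion R d 1 1 2 (hfield (a i)) (hfield (a (k + s - i)%N)) t v = 0) ->
    forall t v, `|v| <= 1 ->
    `|@schouten R d 1 1 (hfield p) (hfield (a s)) t v| <=
      C * (e * \sum_(r < k) b r + \sum_(r < s) b r).
Proof.
move=> B0; have [C0 C0_gt0 bd] := insertion_bound_le R d (2 * k).
(* The sum has at most [2k + 1] terms, two more account for replacing [a k] by [p], and [1 + B]
   absorbs the factors that are merely bounded. *)
exists ((2 * k + 3)%:R * (C0 * (1 + B))).
  by rewrite !mulr_gt0// ?ltr_pwDl// ltr0n addn3.
move=> p a b e s sk.
have s2 : (s <= 2 * k)%N by lia.
have k2 : (k <= 2 * k)%N by lia.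
have k_lt : (k < (k + s).+1)%N by lia.
have s_lt : (s < (k + s).+1)%N by lia.
have ks_le : ((k + s).+1 <= 2 * k + 1)%N by lia.
have index_le i : (i <= k + s)%N -> (i <= 2 * k)%N /\ (k + s - i <= 2 * k)%N by lia.
have index_mid i : (s <= i)%N -> i != s -> (i < k)%N -> (k + s - i < k)%N by lia.
have index_high i : (k <= i)%N -> i != k -> (i <= k + s)%N -> (k + s - i < s)%N by lia.
move=> sp sa b0 ab bB be e0 ap jac t v v1.
set S := \sum_(r < k) b r; set sg := \sum_(r < s) b r.
have S0 : 0 <= S by apply: sumr_ge0.
have sg0 : 0 <= sg by apply: sumr_ge0.
have bS i : (i < k)%N -> b i <= S.
  by move=> ik; rewrite /S (bigD1 (Ordinal ik))//= lerDl sumr_ge0.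
have bsg i : (i < s)%N -> b i <= sg.
  by move=> ik; rewrite /sg (bigD1 (Ordinal ik))//= lerDl sumr_ge0.
pose T := C0 * (e * S + B * sg).
have TE : T <= C0 * (1 + B) * (e * S + sg).
  rewrite /T -mulrA ler_wpM2l//; first exact: ltW.
  have h1 : 0 <= e * S by rewrite mulr_ge0.
  have h2 : 0 <= B * (e * S) by rewrite mulr_ge0.
  rewrite mulrDr !mulrDl !mul1r; lra.
have T1 : C0 * (e * S) <= T.
  by rewrite /T mulrDr lerDl mulr_ge0 ?mulr_ge0// ltW.
have T2 : C0 * (B * sg) <= T.
  by rewrite /T mulrDr lerDr mulr_ge0 ?mulr_ge0// ltW.
have term i : (i <= k + s)%N -> i != k -> i != s ->
    `|@insertion R d 1 1 2 (hfield (a i)) (hfield (a (k + s - i)%N)) t v| <= T.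
  move=> iks ik is_.
  have [i2 j2] := index_le i iks.
  apply: le_trans (bd _ _ _ _ _ _ t v i2 j2 (b0 i) (b0 (k + s - i)%N) (sa _) (ab _ i2) (ab _ j2) v1) _.
  (* Three ranges: for [i < s] the first factor is below degree [s]; for [s < i < k] so is the
     partner index between [s] and [k], and one factor is at most [e]; for [i > k] the partner is
     below degree [s]. *)
  have [lt_is|ge_is] := ltnP i s.
    apply: le_trans T2; rewrite ler_wpM2l//; first exact: ltW.
    by rewrite mulrC; apply: ler_pM => //; [exact: bB|exact: bsg].
  have [lt_ik|ge_ik] := ltnP i k.
    apply: le_trans T1; rewrite ler_wpM2l//; first exact: ltW.
    by rewrite mulrC; apply: ler_pM => //; [exact: be (index_mid _ ge_is is_ lt_ik)|exact: bS].
  apply: le_trans T2; rewrite ler_wpM2l//; first exact: ltW.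
  by apply: ler_pM => //; [exact: bB|exact: bsg (index_high _ ge_ik ik iks)].
have := jac t v; rewrite (bigD1 (Ordinal k_lt))//= (bigD1 (Ordinal s_lt))/=; last first.
  by rewrite -val_eqE /= ltn_eqF.
rewrite addKn addnK; set rest := \sum_(i < _ | _) _ => jac0.
have rest_le : `|rest| <= (2 * k + 1)%:R * T.
  have T0 : 0 <= T by apply: le_trans T1; rewrite !mulr_ge0// ltW.
  apply: le_trans (ler_norm_sum _ _ _) _.
  apply: (@le_trans _ _ (\sum_(i < (k + s).+1) T)).
    rewrite [leRHS](bigID (fun i : 'I_(k + s).+1 => (i != Ordinal k_lt) && (i != Ordinal s_lt)))/=.
    rewrite -[leLHS]addr0; apply: lerD; last by rewrite sumr_ge0.
    apply: ler_sum => i /andP[ik is_]; apply: term => //; first by rewrite -ltnS.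
  by rewrite sumr_const card_ord -[leLHS]mulr_natl ler_wpM2r// ler_nat.
have sap : symmetric_coef2 (fun t w => a k t w - p t w).
  by move=> t' w w' ww'; rewrite (sa k t' _ _ ww') (sp t' _ _ ww').
have d1 := bd _ _ _ _ _ _ t v k2 s2 e0 (b0 s) (sa s) ap (ab s s2) v1.
have d2 := bd _ _ _ _ _ _ t v s2 k2 (b0 s) e0 sap (ab s s2) ap v1.
have ebs : C0 * (e * b s) <= T.
  by apply: le_trans T1; rewrite ler_wpM2l ?(ltW C0_gt0)// ler_wpM2l// bS.
rewrite [b s * e]mulrC in d2.
rewrite hfieldB insertionBl in d1.
rewrite hfieldB insertionBr in d2; try by move=> t'; exact: C1_at_hpoly.
rewrite schouten11E.
move: jac0 d1 d2; set A1 := insertion (hfield (a k)) _ t v; set A2 := insertion _ (hfield (a k)) t v.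
set P1 := insertion (hfield p) _ t v; set P2 := insertion _ (hfield p) t v => jac0 d1 d2.
have -> : P1 + P2 = - rest - (A1 - P1) - (A2 - P2).
  have -> : rest = - A1 - A2 by rewrite -[LHS](addKr (A1 + A2)) -[A1 + A2 + rest]addrA jac0; ring.
  ring.
apply: le_trans (ler_normB _ _) _; apply: le_trans (lerD (ler_normB _ _) (lexx _)) _.
rewrite normrN.
apply: (@le_trans _ _ ((2 * k + 3)%:R * T)); last by rewrite -mulrA ler_wpM2l.
have -> : (2 * k + 3)%:R * T = (2 * k + 1)%:R * T + T + T.
  by rewrite !natrD !mulrDl; ring.
by apply: lerD; [apply: lerD|] => //; [exact: le_trans d1 ebs|exact: le_trans d2 ebs].
Qed.

Definition coef_norm l (a : coef2 R d l) : R :=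
  \sum_(t : 2.-tuple 'I_d) \sum_(w : l.-tuple 'I_d) `|a t w|.

Lemma coef_norm_ge0 l (a : coef2 R d l) : 0 <= coef_norm a.
Proof. by apply: sumr_ge0 => t _; exact: sumr_ge0. Qed.

Lemma bounded_coef_norm l (a : coef2 R d l) : bounded_coef a (coef_norm a).
Proof.
move=> t w; rewrite /coef_norm (bigD1 t)//= (bigD1 w)//= -addrA lerDl.
by rewrite addr_ge0// sumr_ge0// => t' _; exact: sumr_ge0.
Qed.

Lemma coef_norm_le l (a : coef2 R d l) e : bounded_coef a e ->
  coef_norm a <= #|{: 2.-tuple 'I_d}|%:R * #|{: l.-tuple 'I_d}|%:R * e.
Proof.
move=> ae; apply: (@le_trans _ _ (\sum_(t : 2.-tuple 'I_d) \sum_(w : l.-tuple 'I_d) e)).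
  by apply: ler_sum => t _; apply: ler_sum => w _; exact: ae.
by rewrite !sumr_const -mulrnA -[leLHS]mulr_natl mulnC natrM.
Qed.
End BracketEstimate.

(** * Jets of a linear Poisson structure *)

Section Jets.
Variables (R : realType) (n q : nat) (M : manifold R n) (F : bundle M q).
Notation D := (n + q)%N.

Lemma partialsZ d (U : set 'rV[R]_d) c f w x : open U -> smooth_on U f -> U x ->
  partials w (fun z => c * f z) x = c * partials w f x.
Proof.
move=> oU sf; elim: w x => [//|i w IH] x Ux.
rewrite -[LHS]/(partial i (partials w (fun z => c * f z)) x) (partial_eq_on oU IH i Ux).
by rewrite partialZ//; exact: (smooth_C1 (smooth_partials w sf) Ux).
Qed.

Definition jet (Pi : bivector_field F) ci i z : coef2 R D i :=
  fun t w => i`!%:R^-1 * partials w (Pi ci t) z.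

Arguments jet Pi ci i z t w : clear implicits.

(** A derivative lowers the fiber degree by its number of fiber letters, and on the zero section
    zero and fiberwise linear functions vanish, so only the basic ones leave a coefficient. *)
Lemma linear_jet (Pi : bivector_field F) ci i x : linear_poisson Pi -> base_img ci x ->
  linear_coef (jet Pi ci i (row_mx x 0)).
Proof.
move=> LP Ux; have Iz : img ci (row_mx x 0) by rewrite dual_imgE; apply/over_row.
have oI : open (img ci) by exact: open_dual_img.
split.
- move=> t w w' ww'; congr (_ * _); apply: (partials_perm oI _ Iz ww'); exact: smooth_coef.
- move=> s t w; rewrite /jet mulrCA; congr (_ * _).
  rewrite -(partialsZ _ _ oI (@smooth_coef _ _ _ _ F Pi ci t) Iz).
  by apply: (partials_eq_on oI) Iz => z Iz; exact: coef_alternating.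
move=> t w tw; rewrite /jet.
have t3 : (count (@fiber_index n q) t < 3)%N by rewrite ltnS -[X in (_ <= X)%N](size_tuple t) count_size.
have so : smooth_on (over (base_img ci)) (Pi ci t) by rewrite -dual_imgE; exact: smooth_coef.
have oB : open (base_img ci) by exact: open_base_img.
have g := graded_partials w oB so t3 (linear_poisson_graded ci t LP).
rewrite (graded_val0 g _ _ Ux) ?mulr0//; first by apply: leq_ltn_trans t3; exact: leq_subr.
apply: contra tw => /eqP tw1; apply/eqP; lia.
Qed.

Lemma jet_jacobi (Pi : bivector_field F) ci l z t v : poisson Pi -> img ci z ->
  \sum_(i < l.+1) @insertion R D 1 1 2 (hfield (jet Pi ci i z))
    (hfield (jet Pi ci (l - i) z)) t v = 0.
Proof.
move=> PP Iz; have oI : open (img ci) by exact: open_dual_img.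
have sP : smooth_mvf (img ci) (Pi ci) by move=> t'; exact: smooth_coef.
rewrite -[RHS](taylor_jacobi v t l oI sP Iz (PP ci)).
have E i : hfield (jet Pi ci i z) = fun t v => taylor i (Pi ci t) z v.
  by apply: funext => t'; apply: funext => v'; rewrite (taylorE _ _ oI (sP t') Iz).
by apply: eq_bigr => i _; rewrite !E.
Qed.

Lemma homogeneous_part_jet (Pi : bivector_field F) ci k m :
  homogeneous_part k Pi m ci = hfield (jet Pi ci k (cmap ci (zero_at F m))).
Proof. by apply: funext => t; apply: funext => v; rewrite /hfield /jet hpolyZ. Qed.

Lemma partials_locally_close d (U : set 'rV[R]_d) (K : mvf R d 2) z0 L (eta : R) :
  open U -> smooth_mvf U K -> U z0 -> 0 < eta ->
  \forall z \near z0, forall (w : seq 'I_d) t, (size w <= L)%N ->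
    `|partials w (K t) z - partials w (K t) z0| < eta.
Proof.
move=> oU sK Uz0 eta0.
have : \forall z \near z0, forall (i : 'I_L.+1) (t : 2.-tuple 'I_d) (w : i.-tuple 'I_d),
    `|partials w (K t) z - partials w (K t) z0| < eta.
  apply: (filter_forall (nbhs_filter z0)) => i; apply: (filter_forall (nbhs_filter z0)) => t.
  apply: (filter_forall (nbhs_filter z0)) => w.
  have /cvgrPdist_lt/(_ _ eta0) := C1_continuous (smooth_C1 (smooth_partials w (sK t)) Uz0).
  by apply: filterS => z; rewrite distrC.
apply: filterS => z h w t wL; exact: (h (Ordinal (wL : (size w < L.+1)%N)) t (in_tuple w)).
Qed.

End Jets.
Arguments jet {R n q M F} Pi ci i z t w.

(** * Small jets satisfying the Jacobi identity vanish *)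

Section RigidJets.
Variables (R : realType) (d : nat).

(** [bracket_estimate] and the rigidity bounds yield the recursion of [triangular_vanishing]. The
    threshold [e] does not depend on the jets [a], so it can be fixed before the neighborhood. [Q]
    stands for the vanishing of the projection and [lin] for [linear_coef]. *)
Lemma rigid_jets_vanish k (p : coef2 R d k) (Q : (forall i, coef2 R d i) -> Prop) (B : R)
    (lin : forall i, coef2 R d i -> Prop) :
  0 <= B -> symmetric_coef2 p -> (forall i (a : coef2 R d i), lin i a -> symmetric_coef2 a) ->
  (forall s, (s < k)%N -> exists2 C : R, 0 < C & forall (a : forall i, coef2 R d i) (e : R),
     0 <= e -> lin s (a s) -> Q a ->
     (forall t v, `|v| <= 1 -> `|@schouten R d 1 1 (hfield p) (hfield (a s)) t v| <= e) ->
     bounded_coef (a s) (C * e)) ->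
  exists2 e : R, 0 < e & forall a : forall i, coef2 R d i,
    (forall i, lin i (a i)) -> Q a ->
    (forall i, (i <= 2 * k)%N -> bounded_coef (a i) B) ->
    (forall i, (i < k)%N -> bounded_coef (a i) e) ->
    bounded_coef (fun t w => a k t w - p t w) e ->
    (forall l t v, \sum_(i < l.+1)
       @insertion R d 1 1 2 (hfield (a i)) (hfield (a (l - i)%N)) t v = 0) ->
    forall s, (s < k)%N -> forall t w, a s t w = 0.
Proof.
move=> B0 sp linS Cs.
pose cd i : R := #|{: 2.-tuple 'I_d}|%:R * #|{: i.-tuple 'I_d}|%:R.
have cd0 i : 0 <= cd i by rewrite mulr_ge0.
pose Nm := 1 + \sum_(i < (2 * k).+1) cd i.
have Nm1 : 0 < Nm by rewrite ltr_pwDl// sumr_ge0.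
have cdN i : (i <= 2 * k)%N -> cd i <= Nm.
  rewrite -ltnS => ik; rewrite /Nm (bigD1 (Ordinal ik))//= addrCA lerDl.
  by rewrite addr_ge0// sumr_ge0.
have [C C0 est] := @bracket_estimate R d k (Nm * B) (mulr_ge0 (ltW Nm1) B0).
have [c cP] := choice (fun s : 'I_k => (fun H => let: ex_intro2 C h1 h2 := H in
   ex_intro (fun C => _ /\ _) C (conj h1 h2)) (Cs s (ltn_ord s))).
pose c1 := \sum_(s < k) cd s * (c s * C).
have c1_ge s : 0 <= cd (s : 'I_k) * (c s * C) by rewrite !mulr_ge0// ltW//; case: (cP s).
have c10 : 0 <= c1 by apply: sumr_ge0.
have c1k : 0 < (1 + c1) ^+ k by rewrite exprn_gt0// ltr_pwDl.
(* Chosen so that [Nm * e * (1 + c1) ^+ k] is 1/2; [Nm] converts bounds on single coefficients into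
   bounds on [coef_norm]. *)
pose e := (2 * Nm * (1 + c1) ^+ k)^-1.
have e0 : 0 < e by rewrite invr_gt0 !mulr_gt0.
exists e => // a la Qa aB ae ap jac.
pose b i := coef_norm (a i).
have b_le i r : (i <= 2 * k)%N -> 0 <= r -> bounded_coef (a i) r -> b i <= Nm * r.
  move=> ik r0 ar; apply: le_trans (coef_norm_le ar) _.
  by rewrite ler_wpM2r// cdN.
have k2 : (k <= 2 * k)%N by lia.
have vanish := @triangular_vanishing R k c1 (Nm * e) b c10 (mulr_ge0 (ltW Nm1) (ltW e0)).
have small : Nm * e * (1 + c1) ^+ k < 1.
  have -> : Nm * e * (1 + c1) ^+ k = 2^-1.
    rewrite /e; field; by rewrite !gt_eqF.
  by rewrite invf_lt1// ltr1n.
have b0 i : 0 <= b i by exact: coef_norm_ge0.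
have step s : (s < k)%N -> b s <= c1 * (Nm * e * \sum_(r < k) b r + \sum_(r < s) b r).
  move=> sk; set X := (X in c1 * X).
  have X0 : 0 <= X by rewrite addr_ge0// ?sumr_ge0// !mulr_ge0// ?sumr_ge0// ltW.
  have br t v : `|v| <= 1 -> `|@schouten R d 1 1 (hfield p) (hfield (a s)) t v| <= C * X.
    apply: (est p a b (Nm * e) s sk sp (fun i => linS i _ (la i)) b0).
    - by move=> i _; exact: bounded_coef_norm.
    - by move=> i ik; apply: b_le => //; exact: aB.
    - move=> i ik; apply: b_le; [exact: leq_trans (ltnW ik) k2|exact: ltW|exact: ae].
    - by rewrite mulr_ge0 ?(ltW e0) ?(ltW Nm1).
    - move=> t' w'; apply: le_trans (ap t' w') _.
      by rewrite ler_peMl ?(ltW e0)// /Nm lerDl sumr_ge0.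
    - by move=> t' v'; exact: jac.
  have [_ /(_ a (C * X) (mulr_ge0 (ltW C0) X0) (la s) Qa br) bs] := cP (Ordinal sk).
  apply: le_trans (coef_norm_le bs) _; rewrite !mulrA ler_wpM2r// -mulrA.
  by rewrite /c1 (bigD1 (Ordinal sk))//= -/(cd s) lerDl sumr_ge0.
move=> s sk t w; apply/eqP; rewrite -normr_le0 -(vanish small b0 step s sk).
exact: bounded_coef_norm.
Qed.

End RigidJets.

(** * Dependence of the jet on the base point *)

Section FirstOrder.
Variables (R : realType) (n q : nat) (M : manifold R n) (F : bundle M q).
Notation D := (n + q)%N.
Variable K : nat.
Definition jet_index : finType := (2.-tuple 'I_D * K.-tuple 'I_D)%type.

Definition jet_row (Pi : bivector_field F) ci x : 'rV[R]_#|jet_index| :=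
  \row_i jet Pi ci K (row_mx x 0) (enum_val i).1 (enum_val i).2.

(** On the zero section, the Jacobian matrix of [jet_row]. Row [b] is also the coefficient array of
    the derivative of the homogeneous part of degree [K.+1] in the base direction [b]: moving the
    base point acts along the kernel found in [rigid_top]. *)
Definition jet_derivative (Pi : bivector_field F) ci z : 'M[R]_(n, #|jet_index|) :=
  \matrix_(b < n, i < #|jet_index|) (K`!%:R^-1 *
    partials (lshift q b :: (enum_val i : 2.-tuple 'I_D * K.-tuple 'I_D)%type.2)
      (Pi ci (enum_val i : 2.-tuple 'I_D * K.-tuple 'I_D)%type.1) z).

Lemma invf_fact_le1 : K`!%:R^-1 <= 1 :> R.
Proof. by rewrite invf_le1 ?ltr0n ?fact_gt0// ler1n fact_gt0. Qed.

Lemma norm_row_mx0 (x y : 'rV[R]_n) :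
  `|row_mx x 0 - row_mx y (0 : 'rV[R]_q)| <= `|x - y|.
Proof.
apply/rV_normP => // j; rewrite opp_row_mx add_row_mx subr0.
case: (split_ordP j) => i ->; first by rewrite row_mxEl; exact: rV_norm_coord.
by rewrite row_mxEr mxE normr0.
Qed.

(** The Jacobian of [Pi] at the single point [x0] serves for every nearby [Pi'], so the projection
    and its one-sided inverse depend on [Pi] only. *)
Lemma jet_row_affine (Pi Pi' : bivector_field F) ci x0 (rho eta : R) : 0 <= rho -> 0 <= eta ->
  (forall x, `|x - x0| <= rho -> base_img ci x) ->
  (forall z w t, `|z - row_mx x0 0| <= rho -> (size w <= K.+1)%N ->
     `|partials w (Pi' ci t) z - partials w (Pi ci t) (row_mx x0 0)| <= eta) ->
  forall x x', `|x - x0| <= rho -> `|x' - x0| <= rho ->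
  `|jet_row Pi' ci x - jet_row Pi' ci x' - (x - x') *m jet_derivative Pi ci (row_mx x0 0)| <=
    n%:R * eta * `|x - x'|.
Proof.
move=> rho0 eta0 ballU close x x' xr xr'.
apply/rV_normP; first by rewrite !mulr_ge0.
move=> i; rewrite !mxE.
set t := (enum_val i).1; set w := (enum_val i).2.
pose f x := jet Pi' ci K (row_mx x 0) t w.
have df y b : `|y - x0| <= rho -> is_derive y (delta_mx 0 b) f
    (K`!%:R^-1 * partials (lshift q b :: w) (Pi' ci t) (row_mx y 0)).
  move=> yr; have Uz : img ci (row_mx y 0) by rewrite dual_imgE; apply/over_row; exact: ballU.
  have sw : smooth_on (img ci) (partials w (Pi' ci t)) by apply: smooth_partials; exact: smooth_coef.
  have C := smooth_C1 sw Uz.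
  have := @slice_base R n q (fun z => K`!%:R^-1 * partials w (Pi' ci t) z) y 0 b (C1_atZ _ C).
  by rewrite partialZ.
have := @affine_approximation R n f x0
  (fun b => K`!%:R^-1 * partials (lshift q b :: w) (Pi ci t) (row_mx x0 0)) rho eta _ _ x x' xr xr' rho0.
have -> : \sum_j (x - x') 0 j * jet_derivative Pi ci (row_mx x0 0) j i =
    \sum_b (x 0 b - x' 0 b) * (K`!%:R^-1 * partials (lshift q b :: w) (Pi ci t) (row_mx x0 0)).
  by apply: eq_bigr => b _; rewrite !mxE.
apply.
  by move=> y yr b; have [] := df y b yr.
move=> y b yr; rewrite partialE; have [_ ->] := df y b yr.
rewrite -mulrBr normrM ger0_norm ?invr_ge0//.
apply: le_trans (ler_wpM2l _ (close _ _ _ _ _)) _; first by rewrite invr_ge0.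
- exact: le_trans (norm_row_mx0 _ _) yr.
- by rewrite /= size_tuple.
- by rewrite ler_piMl// invf_fact_le1.
Qed.

Definition coef_row (a : coef2 R D K) : 'rV[R]_#|jet_index| :=
  \row_i a (enum_val i).1 (enum_val i).2.

(** In degree [K] the kernel of the bracket with [p] lies in the row space of [jet_derivative],
    where [X] is faithful; in lower degrees the kernel is zero. *)
Lemma rigid_coef_bounds (Pi : bivector_field F) ci z : let p := jet Pi ci K.+1 z in
  linear_coef p ->
  (forall s, (s < K.+1)%N -> H2lin (hfield p) K.+1 s = [set coboundaries (hfield p) K.+1 s]) ->
  exists d (X : 'M[R]_(#|jet_index|, d)) (B : 'M[R]_(d, n)),
    B *m (jet_derivative Pi ci z *m X) = 1%:M /\
    forall s, (s < K.+1)%N -> exists2 C : R, 0 < C &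
      forall (a : forall i, coef2 R D i) (e : R), 0 <= e -> linear_coef (a s) ->
        coef_row (a K) *m X = 0 ->
        (forall t v, `|v| <= 1 -> `|@schouten R D 1 1 (hfield p) (hfield (a s)) t v| <= e) ->
        bounded_coef (a s) (C * e).
Proof.
move=> p lp H; have [d [X [B [BX JX]]]] := rank_factor_projection (jet_derivative Pi ci z).
exists d, X, B; split => // s sK; have [sp _ _] := lp.
move: (sK); rewrite ltnS leq_eqVlt => /orP[/eqP ->|sK'].
  pose L (e : 'I_d) (a : {: 2.-tuple 'I_D * K.-tuple 'I_D} -> R) : R :=
    \sum_i a (enum_val i) * X i e.
  have lL e : linear_form (L e).
    move=> c a b; rewrite /L mulr_sumr -big_split; apply: eq_bigr => i _.
    by rewrite mulrDl mulrA.
  have LE (a : coef2 R D K) e : L e (fun i => a i.1 i.2) = (coef_row a *m X) 0 e.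
    by rewrite mxE; apply: eq_bigr => i _; rewrite mxE.
  have inj (a : coef2 R D K) : linear_coef a ->
      (forall t v, @schouten R D 1 1 (hfield p) (hfield a) t v = 0) ->
      (forall e, L e (fun i => a i.1 i.2) = 0) -> forall t w, a t w = 0.
    move=> la br aX; have [c aE] := rigid_top lp (H K (ltnSn K)) la br.
    (* The division reconciles the factor [1 / K.+1]![in]p[with]1 / K[!] in [jet_derivative]. *)
    pose u : 'rV[R]_n := \row_b (c b / K.+1%:R).
    have uJ : coef_row a = u *m jet_derivative Pi ci z.
      apply/rowP => i; rewrite !mxE aE; apply: eq_bigr => b _; rewrite !mxE /p /jet.
      by rewrite factS natrM invfM !mulrA.
    have aX0 : coef_row a *m X = 0 by apply/rowP => e; rewrite -LE aX mxE.
    rewrite uJ in aX0; have := JX u aX0; rewrite -uJ => /rowP a0 t w.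
    by have := a0 (enum_rank (t, w)); rewrite !mxE enum_rankK.
  have [C C0 CP] := coef_bound lL sp inj.
  exists C => // a e e0 la aX br; apply: CP => // x.
  by rewrite LE aX mxE.
(* Below degree [K] no projection is imposed, so the additional form is trivial. *)
pose L (x : unit) (a : {: 2.-tuple 'I_D * s.-tuple 'I_D} -> R) : R := 0.
have lL x : linear_form (L x) by move=> c a b; rewrite /L mulr0 addr0.
have inj (a : coef2 R D s) : linear_coef a ->
    (forall t v, @schouten R D 1 1 (hfield p) (hfield a) t v = 0) ->
    (forall x, L x (fun i => a i.1 i.2) = 0) -> forall t w, a t w = 0.
  by move=> la br _; apply: (rigid_low _ (H s sK) la br).
have [C C0 CP] := coef_bound lL sp inj.
by exists C => // a e e0 la _ br; apply: CP.
Qed.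
End FirstOrder.

(** * Choice of the neighborhoods and the stability theorem *)

Section Neighborhoods.
Variables (R : realType) (n q : nat) (M : manifold R n) (F : bundle M q).

Lemma norm_lsubmx_sub (z : 'rV[R]_(n + q)) x : `|lsubmx z - x| <= `|z - row_mx x 0|.
Proof.
apply/rV_normP => // j; rewrite !mxE.
have <- : (z - row_mx x 0) 0 (lshift q j) = z 0 (lshift q j) - x 0 j.
  by rewrite mxE; congr (_ + _); rewrite mxE row_mxEl.
exact: rV_norm_coord.
Qed.

Lemma base_neighborhood (ci : chart (dual_atlas F)) (m : M) (Omega : set M) :
  base_dom ci m -> nbhs m Omega ->
  nbhs (cmap ci.1 m) [set x | base_img ci x /\ Omega (cinv ci.1 x)].
Proof.
move=> dm Om; have [d1 d2] := dm.
have im : img ci.1 (cmap ci.1 m) by exists m.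
have h1 : nbhs (cmap ci.1 m) (base_img ci).
  by apply: open_nbhs_nbhs; split; [exact: open_base_img|exists m].
have h2 : nbhs (cmap ci.1 m) (cinv ci.1 @^-1` Omega).
  by apply: (cinv_continuous im); rewrite cmapK.
exact: filterI h1 h2.
Qed.
End Neighborhoods.

Theorem theorem1p3 (R : realType) (n q : nat) (M : manifold R n)
  (F : bundle M q) (Pi : bivector_field F) (k : nat) (m : M)
  (ci : chart (dual_atlas F)) :
  linear_poisson Pi ->
  (1 <= k)%N ->
  singularity k Pi m ->
  dom ci (zero_at F m) ->
  (forall s : nat, (s < k)%N ->
     let P := homogeneous_part k Pi m ci in
     H2lin P k s = [set coboundaries P k s]) ->
  k_stable k Pi m.
Proof.
move=> LP k1 [jv njv] dm H Omega Om.
case: k k1 jv njv H => [//|K] _ jv njv H; rewrite /= in jv.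
have K1 : (K.+1 <= 2 * K.+1)%N by rewrite leq_pmull.
have K0 : (K <= 2 * K.+1)%N by exact: leq_trans K1.
set x0 := cmap ci.1 m; set z0 : 'rV[R]_(n + q) := row_mx x0 0.
have z0E : cmap ci (zero_at F m) = z0 by exact: zero_at_cmap.
have dm' : base_dom ci m by [].
have Ux0 : base_img ci x0 by exists m.
have Iz0 : img ci z0 by rewrite dual_imgE; apply/over_row.
have oI : open (img ci) by exact: open_dual_img.
pose p := jet Pi ci K.+1 z0.
have lp : linear_coef p := linear_jet K.+1 LP Ux0.
have [sp _ _] := lp.
have H' s : (s < K.+1)%N -> H2lin (hfield p) K.+1 s = [set coboundaries (hfield p) K.+1 s].
  by move=> sK; have := H s sK; rewrite /= homogeneous_part_jet z0E.
have [d [X [Bm [BX Cs]]]] := rigid_coef_bounds lp H'.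
(* Bounds the Taylor coefficients of [Pi] at [z0] up to degree [2k]; the bound [1 + B0] below leaves
   room for those of [Pi'], which differ by at most [eta <= 1]. *)
pose B0 := \sum_(i < (2 * K.+1).+1) coef_norm (jet Pi ci i z0).
have B00 : 0 <= B0 by apply: sumr_ge0 => i _; exact: coef_norm_ge0.
have [e1 e10 rigid] := @rigid_jets_vanish R (n + q) K.+1 p
  (fun a => coef_row (a K) *m X = 0) (1 + B0) (fun i a => linear_coef a)
  (addr_ge0 ler01 B00) sp (fun i a la => let: And3 h _ _ := la in h) Cs.
pose nX := 1 + \sum_i \sum_j `|X i j|.
have nX0 : 0 < nX by rewrite ltr_pwDl// sumr_ge0// => i _; exact: sumr_ge0.
pose b := 1 + \sum_i \sum_j `|Bm i j|.
have b0 : 0 < b by rewrite ltr_pwDl// sumr_ge0// => i _; exact: sumr_ge0.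
(* A fixed nonzero derivative of order at most [k]. By closeness it stays nonzero for [Pi'], so the
   order of the new singularity cannot exceed [k]. *)
have [w1 [t1 [w1K c1]]] : exists w1 t1, (size w1 <= K.+1)%N /\ partials w1 (Pi ci t1) z0 != 0.
  apply: contrapT => hn; apply: njv; apply: (jet_vanishes_chart dm) => t w wK.
  rewrite z0E; apply/eqP; apply: contrapT => /negP hw; apply: hn.
  by exists w, t.
(* The four upper bounds serve the rigidity threshold, the uniform bound on the jets, the survival
   of the nonzero derivative, and the contraction. *)
have [eta [eta0 eta_e1 eta_1 eta_c1 eta_b]] : exists eta : R,
    [/\ 0 < eta, eta <= e1, eta <= 1, eta < `|partials w1 (Pi ci t1) z0| &
     nX * (n%:R * eta) <= (2 * b)^-1].
  have nn : 0 < nX * (n%:R + 1) by rewrite mulr_gt0// ltr_wpDl.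
  have g : 0 < `|partials w1 (Pi ci t1) z0| / 2 by rewrite divr_gt0// normr_gt0.
  have f : 0 < (2 * b)^-1 / (nX * (n%:R + 1)) by rewrite divr_gt0// invr_gt0 mulr_gt0.
  exists (Num.min (Num.min e1 1) (Num.min (`|partials w1 (Pi ci t1) z0| / 2)
    ((2 * b)^-1 / (nX * (n%:R + 1))))); split.
  - by rewrite !lt_min e10 ltr01 g f.
  - by rewrite !ge_min lexx.
  - by rewrite !ge_min lexx orbT.
  - apply: (@le_lt_trans _ _ (`|partials w1 (Pi ci t1) z0| / 2)).
      by rewrite !ge_min lexx !orbT.
    by rewrite ltr_pdivrMr// ltr_pMr ?normr_gt0// ltr1n.
  - set eta := Num.min _ _.
    have : eta <= (2 * b)^-1 / (nX * (n%:R + 1)) by rewrite !ge_min lexx !orbT.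
    rewrite ler_pdivlMr// mulrC -mulrA => h; apply: le_trans h.
    have eta0 : 0 <= eta by rewrite !le_min !ltW.
    by rewrite ler_wpM2l ?(ltW nX0)// ler_wpM2r// lerDl.
(* One half is for the variation of the derivatives of [Pi] over the ball, the other for the
   distance from [Pi] to [Pi']. *)
have eta2 : 0 < eta / 2 by rewrite divr_gt0.
have [rho rho0 rhoP] : exists2 rho : R, 0 < rho &
    (forall x, `|x - x0| <= rho -> base_img ci x /\ Omega (cinv ci.1 x)) /\
    (forall z, `|z - z0| <= rho -> forall w t, (size w <= 2 * K.+1)%N ->
      `|partials w (Pi ci t) z - partials w (Pi ci t) z0| < eta / 2).
  have [r1 r10 r1P] := nbhs_rV_normP (base_neighborhood dm' Om).
  have sP : smooth_mvf (img ci) (Pi ci) by move=> t; exact: smooth_coef.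
  have [r2 r20 r2P] := nbhs_rV_normP (partials_locally_close (2 * K.+1) oI sP Iz0 eta2).
  have rm : 0 < Num.min r1 r2 by rewrite lt_min r10.
  have lt_rm y : y <= Num.min r1 r2 / 2 -> y < r1 /\ y < r2.
    have : Num.min r1 r2 <= r1 by rewrite ge_min lexx.
    have : Num.min r1 r2 <= r2 by rewrite ge_min lexx orbT.
    by split; lra.
  exists (Num.min r1 r2 / 2); first by rewrite divr_gt0.
  split=> [x /lt_rm[xr _]|z /lt_rm[_ zr]]; first by apply: r1P; rewrite distrC.
  by apply: r2P; rewrite distrC.
have [ballO closePi] := rhoP.
(* With this radius [zero_near_submersion] finds its zero within [rho] of [x0], hence over
   [Omega]. *)
pose r := rho / b.
have r0 : 0 < r by rewrite divr_gt0.
have brE : b * r = rho by rewrite /r mulrC divfK// gt_eqF.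
(* The second bound makes the projected jet of [Pi'] at [x0] at most [r / 2], since the jet of [Pi]
   of order [k - 1] vanishes there and [nX] bounds the projection. *)
pose eps := Num.min (eta / 2) (r / 2 / nX).
have eps0 : 0 < eps by rewrite lt_min eta2 !divr_gt0.
pose W : set (bivector_field F) := [set Pi' | forall w t z, (size w <= 2 * K.+1)%N ->
  `|z - z0| <= rho -> `|partials w (Pi' ci t) z - partials w (Pi ci t) z| < eps].
exists W; split.
  exists 1%N, (fun=> ci), (fun=> [set z | `|z - z0| <= rho]), eps; split => //.
    move=> _; split; first exact: compact_cball.
    move=> z /= zr; rewrite dual_imgE; apply: (ballO _ _).1.
    exact: le_trans (norm_lsubmx_sub z x0) zr.
  by move=> Pi' h w t z wk zr; exact: (h ord0).
move=> Pi' WPi' LP'.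
have close z w t : `|z - z0| <= rho -> (size w <= 2 * K.+1)%N ->
    `|partials w (Pi' ci t) z - partials w (Pi ci t) z0| <= eta.
  move=> zr wk; have h1 := WPi' w t z wk zr; have h2 := closePi z zr w t wk.
  have e2 : eps <= eta / 2 by rewrite ge_min lexx.
  apply: le_trans (ler_distD (partials w (Pi ci t) z) _ _) _.
  by move: h1 h2 e2; lra.
have rho_ge0 := ltW rho0; have eta_ge0 := ltW eta0.
have ballU x (xr : `|x - x0| <= rho) := (ballO x xr).1.
have close1 z w t (zr : `|z - z0| <= rho) (wK : (size w <= K.+1)%N) :=
  close z w t zr (leq_trans wK K1).
have jet_le z i t w : `|z - z0| <= rho -> (i <= 2 * K.+1)%N ->
    `|jet Pi' ci i z t w - jet Pi ci i z0 t w| <= eta.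
  move=> zr ik; rewrite /jet -mulrBr normrM ger0_norm ?invr_ge0//.
  apply: le_trans (ler_wpM2l _ (close z w t zr _)) _; rewrite ?invr_ge0// ?size_tuple//.
  by rewrite ler_piMl// invf_fact_le1.
have z0_near : `|z0 - z0| <= rho by rewrite subrr normr0.
have jet0 i t w : (i <= K)%N -> jet Pi ci i z0 t w = 0.
  by move=> iK; rewrite /jet -z0E jv ?mulr0// size_tuple.
pose h x := jet_row K Pi' ci x *m X.
have hX (u : 'rV[R]_#|jet_index n q K|) : `|u *m X| <= nX * `|u|.
  apply: le_trans (norm_mulmx_le _ _) _; rewrite ler_wpM2r// lerDr.
  exact: ler01.
have [|||x xr hx] := @zero_near_submersion R d n h x0 _ Bm b r BX b0 _ (ltW r0).
- by rewrite lerDr ler01.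
- move=> x x'; rewrite brE => xr xr'.
  rewrite /h -mulmxBl mulmxA -mulmxBl; apply: le_trans (hX _) _.
  have A := jet_row_affine rho_ge0 eta_ge0 ballU close1 xr xr'.
  apply: le_trans (ler_wpM2l (ltW nX0) A) _.
  by rewrite !mulrA ler_wpM2r// -mulrA.
- rewrite /h; apply: le_trans (hX _) _.
  rewrite mulrC -ler_pdivlMr//; apply/rV_normP; first by rewrite !divr_ge0// ltW.
  move=> i; rewrite mxE /jet normrM ger0_norm ?invr_ge0//.
  set w := (enum_val i).2; set t := (enum_val i).1.
  have wK : (size w <= K)%N by rewrite size_tuple.
  have wk : (size w <= 2 * K.+1)%N := leq_trans wK K0.
  have := WPi' w t z0 wk z0_near; rewrite -{2}z0E jv// subr0 => lt_eps.
  have : eps <= r / 2 / nX by rewrite ge_min lexx orbT.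
  apply: le_trans; apply: le_trans (ltW lt_eps).
  by rewrite ler_piMl// invf_fact_le1.
rewrite brE in xr.
set z : 'rV[R]_(n + q) := row_mx x 0.
have zr : `|z - z0| <= rho by apply: le_trans (norm_row_mx0 _ _ _) xr.
have Ux := ballU x xr.
have Iz : img ci z by rewrite dual_imgE; apply/over_row.
have vanish : forall s, (s < K.+1)%N -> forall t w, jet Pi' ci s z t w = 0.
  apply: (rigid (fun i => jet Pi' ci i z)) => //.
  - by move=> i; exact: linear_jet.
  - move=> i ik t w; rewrite -[jet _ _ _ _ _ _](subrK (jet Pi ci i z0 t w)).
    apply: le_trans (ler_normD _ _) _; apply: lerD.
      exact: le_trans (jet_le _ _ _ _ zr ik) eta_1.
    apply: le_trans (bounded_coef_norm _ t w) _.
    have ik' : (i < (2 * K.+1).+1)%N by [].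
    rewrite /B0 (bigD1 (Ordinal ik'))//= lerDl sumr_ge0// => j _; exact: coef_norm_ge0.
  - move=> i ik t w; have := jet_le z i t w zr (leq_trans (ltnW ik) K1).
    by rewrite jet0// subr0 => /le_trans; apply.
  - by move=> t w; exact: le_trans (jet_le _ _ _ _ zr K1) eta_e1.
  - by move=> l t v; apply: jet_jacobi => //; exact: LP'.1.
have [dx xE] := base_img_cinv Ux.
have zE : cmap ci (zero_at F (cinv ci.1 x)) = z by rewrite zero_at_cmap xE.
exists (cinv ci.1 x); split; first exact: (ballO x xr).2.
split.
  apply: (jet_vanishes_chart (ci := ci)) => // t w wK; rewrite zE.
  have := vanish (size w) (leq_ltn_trans wK (ltnSn K)) t (in_tuple w).
  by move/eqP; rewrite mulf_eq0 invr_eq0 pnatr_eq0 gtn_eqF ?fact_gt0//= => /eqP.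
(* If the [k]-jet vanished too, the chosen derivative of [Pi] at [z0] would be at most [eta]. *)
move=> jk; have := close1 z w1 t1 zr w1K.
rewrite -zE jk// sub0r normrN => /(lt_le_trans eta_c1).
by rewrite ltxx.
Qed.
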